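(* Let $H$ be either of the two cubic H\'enon maps $H_3^{+}$, $H_3^{-}$ with $M_1=0$, i.e. $H_3^{\pm}:\mathbb{R}^2\to\mathbb{R}^2$, $(x,y)\mapsto(\bar x,\bar y)$, $\bar x=y$, $\bar y=-x+M_2y\pm y^3$, where $M_2\in\mathbb{R}$. Let $p,q$ be mutually prime positive integers with $q>3$ odd, and suppose that the fixed point $O(0,0)$ of $H$ is at the $p:q$ resonance, i.e. the linear part of $H$ at $O$ has eigenvalues $e^{\pm 2\pi i p/q}$. Then this $p:q$ resonance at $O$ is at least triple degenerate; that is, the coefficients $A,B,C$ of the resonant terms in the local normal form of $H$ at $O$, $$\bar z=e^{2\pi i p/q}\left(z+\Omega(|z|^2)\,z+A(z^* )^{q-1}+Bz^{q+1}+Cz(z^* )^{q}\right)+O(|z|^{q+2}),$$ satisfy $A=B=C=0$.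
   Context: The maps $H_3^{\pm}$ with general parameters are $\bar x=y$, $\bar y=-x+M_1+M_2y\pm y^3$. They are area-preserving and reversible with respect to the involution $h:(x,y)\mapsto(y,x)$, i.e. $H^{-1}=h\circ H\circ h$. For $M_1=0$ they also commute with the central symmetry $(x,y)\mapsto(-x,-y)$. Normal form: here $z$ is a complex coordinate near $O$ (with $z=0$ at $O$), $z^*$ is its complex conjugate, and $\Omega$ is a polynomial with $\Omega(0)=0$ (it collects the terms $|z|^{2k}z$). The normal form is obtained by a local smooth change of coordinates near $O$ that respects the structure of the map: in the coordinate $z$ the map is still area-preserving, the involution $h$ acts as $z\mapsto z^*$, and the central symmetry acts as $z\mapsto -z$. Degeneracy: the $p:q$ resonance at $O$ is called at least triple degenerate if the map $H$ can be brought by such a change of coordinates to the normal form $$\bar z=e^{2\pi i p/q}\left(z+\Omega(|z|^2)\,z+A(z^* )^{q-1}+Bz^{q+1}+Cz(z^* )^{q}\right)+O(|z|^{q+2})$$ with all three coefficients $A$, $B$, $C$ equal to zero. *)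

(* Defs.v *)
(* Stdlib reals with Coquelicot. Both R^2 and the complex plane C are the type
   R * R, so planar maps and maps of the coordinate z share the notions below. *)
From Stdlib Require Import Reals Arith.
From Coquelicot Require Import Coquelicot.
Local Open Scope R_scope.

Definition H3_plus (M1 M2 : R) (v : R * R) : R * R :=
  (snd v, - fst v + M1 + M2 * snd v + snd v ^ 3).

Definition H3_minus (M1 M2 : R) (v : R * R) : R * R :=
  (snd v, - fst v + M1 + M2 * snd v - snd v ^ 3).

Definition near_O (P : R * R -> Prop) : Prop :=
  locally_2d (fun x y => P (x, y)) 0 0.

(* C^oo on a neighbourhood of the origin: one neighbourhood serves every order n. *)
Definition smooth_near_O (F : R * R -> R * R) : Prop :=
  near_O (fun v => forall n : nat,
    ex_diff_n (fun x y => fst (F (x, y))) n (fst v) (snd v) /\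
    ex_diff_n (fun x y => snd (F (x, y))) n (fst v) (snd v)).

Definition d_dx (f : R * R -> R) (v : R * R) : R :=
  Derive (fun x => f (x, snd v)) (fst v).

Definition d_dy (f : R * R -> R) (v : R * R) : R :=
  Derive (fun y => f (fst v, y)) (snd v).

Definition jac_det (F : R * R -> R * R) (v : R * R) : R :=
  d_dx (fun w => fst (F w)) v * d_dy (fun w => snd (F w)) v
  - d_dy (fun w => fst (F w)) v * d_dx (fun w => snd (F w)) v.

Definition area_preserving_near_O (F : R * R -> R * R) : Prop :=
  near_O (fun v => Rabs (jac_det F v) = 1).

(* l is an eigenvalue, over the complex numbers, of the linear part of F at v. *)
Definition linear_part_eigenvalue
    (F : R * R -> R * R) (v : R * R) (l : C) : Prop :=
  exists a b : C, ~ (a = 0%C /\ b = 0%C) /\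
    (RtoC (d_dx (fun w => fst (F w)) v) * a
      + RtoC (d_dy (fun w => fst (F w)) v) * b)%C = (l * a)%C /\
    (RtoC (d_dx (fun w => snd (F w)) v) * a
      + RtoC (d_dy (fun w => snd (F w)) v) * b)%C = (l * b)%C.

Definition expi (t : R) : C := (cos t, sin t).

Definition res_angle (p q : nat) : R := 2 * PI * INR p / INR q.

Definition at_resonance (p q : nat) (F : R * R -> R * R) : Prop :=
  F (0, 0) = (0, 0) /\
  linear_part_eigenvalue F (0, 0) (expi (res_angle p q)) /\
  linear_part_eigenvalue F (0, 0) (expi (- res_angle p q)).

(* z = phi (x, y), with local inverse psi, is a local smooth coordinate at the
   origin that respects the structure of H: in it H is area-preserving, the
   reversing involution (x, y) |-> (y, x) is z |-> z^*, and the central symmetry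
   is z |-> - z. *)
Definition structural_coordinate
    (H : R * R -> R * R) (phi : R * R -> C) (psi : C -> R * R) : Prop :=
  phi (0, 0) = 0%C /\
  smooth_near_O phi /\ smooth_near_O psi /\
  near_O (fun v => psi (phi v) = v) /\
  near_O (fun z => phi (psi z) = z) /\
  area_preserving_near_O (fun z => phi (H (psi z))) /\
  near_O (fun v => phi (snd v, fst v) = Cconj (phi v)) /\
  near_O (fun v => phi (- fst v, - snd v) = Copp (phi v)).

Definition is_polynomial (Om : R -> C) : Prop :=
  exists (n : nat) (a : nat -> C),
    forall t : R, Om t = sum_n (fun k => Cmult (a k) (RtoC (t ^ k))) n.

Definition normal_form_poly
    (p q : nat) (Om : R -> C) (cA cB cC : C) (z : C) : C :=
  (expi (res_angle p q) *
    (z + Om (Cmod z ^ 2)%R * z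
       + cA * Cpow (Cconj z) (q - 1)
       + cB * Cpow z (q + 1)
       + cC * z * Cpow (Cconj z) q))%C.

(* In the coordinate z = phi (x, y), the map H has the normal form of the p:q
   resonance, with remainder O(|z|^(q+2)), and resonant coefficients cA, cB, cC. *)
Definition has_normal_form
    (p q : nat) (H : R * R -> R * R) (phi : R * R -> C) (psi : C -> R * R)
    (Om : R -> C) (cA cB cC : C) : Prop :=
  structural_coordinate H phi psi /\
  is_polynomial Om /\ Om 0 = 0%C /\
  exists K : R, near_O (fun z : C =>
    Cmod (Cminus (phi (H (psi z))) (normal_form_poly p q Om cA cB cC z))
      <= K * Cmod z ^ (q + 2)).

Definition at_least_triple_degenerate
    (p q : nat) (H : R * R -> R * R) : Prop :=
  exists (phi : R * R -> C) (psi : C -> R * R) (Om : R -> C),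
    has_normal_form p q H phi psi Om 0%C 0%C 0%C.

(* Main.v *)
(* Since H commutes with v |-> -v, every structural coordinate makes it an odd map of z, while the
   three resonant monomials have even degree because q is odd: their sum is O(|z|^(q+2)), hence zero.

   A normalizing coordinate is built from a linear one by removing the non-resonant terms of the odd
   degrees k = 3, 5, ..., q one after the other.  With r = exp(2 i pi p / q) and the leading error g
   of degree k, the equation g + r^-1 X(r z) - X = c |z|^(k-1) z is solvable, a resonant monomial of
   odd degree at most q being a power of |z|^2 times z.  As r^q = 1, telescoping along an orbit of
   the rotation shows that X can be taken equivariant under conjugation (by reversibility) and that
   its divergence is rotation invariant (by area preservation).  Then, up to the harmless radial
   field div(X) z / (k+1), X is the Hamiltonian field of S = - Im(z^* X) / (k+1), and the map
   (u, V + S_u(u,V)) |-> (u + S_V(u,V), V) is an exactly area-preserving change of coordinates that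
   agrees with z + X to leading order and commutes with both symmetries. *)
Require Import Defs.
From Stdlib Require Import Reals Arith ZArith Lra Lia Psatz ClassicalEpsilon.
From Coquelicot Require Import Coquelicot.
Local Open Scope R_scope.

(** * Plane calculus and germs at the origin *)

(** The obstacle is that the structural constraints are exact while normalization proceeds order by
    order: a truncated change [z + X] would spoil area preservation at higher order, and a solution
    of the homological equation is determined only up to resonant terms, so it need not respect
    conjugation. Hence the invariances of the leading error are extracted from the exact identities
    by comparing homogeneous parts, and the change of coordinates is realised exactly through an
    implicit function theorem. The twist part W already produced is a black box: it is smooth,
    O(|z|^3), and commutes with all rotations. Order 3 is what makes the substitution of z + W + f
    for z inside a term of degree k cost only O(|z|^(k+2)); as oddness excludes degree k + 1, one
    step gains two orders. The parity of q keeps odd degrees free of obstruction: a resonant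
    monomial z^a conj(z)^b has q dividing a - b - 1, an even number when a + b is odd, so apart from
    a = b + 1 its degree is at least 2q - 1 > q. *)

Lemma near_all (P : R * R -> Prop) : (forall v, P v) -> near_O P.
Proof. intros h; exists (mkposreal 1 Rlt_0_1); intros; apply h. Qed.

Lemma near_mp (P Q : R * R -> Prop) :
  near_O P -> near_O (fun v => P v -> Q v) -> near_O Q.
Proof. intros h1 h2; exact (locally_2d_impl _ _ _ _ h2 h1). Qed.

Lemma near_and (P Q : R * R -> Prop) :
  near_O P -> near_O Q -> near_O (fun v => P v /\ Q v).
Proof. exact (locally_2d_and _ _ _ _). Qed.

Lemma near_at0 (P : R * R -> Prop) : near_O P -> P (0, 0).
Proof. intros h; exact (locally_2d_singleton _ _ _ h). Qed.

Lemma near_box (d : R) : 0 < d -> near_O (fun v => Rabs (fst v) < d /\ Rabs (snd v) < d).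
Proof.
  intros hd; exists (mkposreal d hd); simpl; intros u v.
  now rewrite !Rminus_0_r.
Qed.

Lemma near_box_inv (P : R * R -> Prop) :
  near_O P -> exists d, 0 < d /\ forall v, Rabs (fst v) < d -> Rabs (snd v) < d -> P v.
Proof.
  intros [d hd]; exists d; split; [apply cond_pos|].
  intros [x y] hx hy; apply hd; now rewrite Rminus_0_r.
Qed.

(** A statement about germs is proved by feeding in known germ facts with [near] and closing with
    [near_end]; the fact fed last becomes the first premise of the pointwise goal. [hnf_near]
    unfolds a unary predicate such as [smoothR] to expose [near_O]. *)
Ltac hnf_near h := let T := type of h in lazymatch T with near_O _ => idtac | ?f _ => unfold f in h end.
Ltac near H := let h := fresh in pose proof H as h; hnf_near h; apply (near_mp _ _ h); clear h.
Ltac near_end := apply near_all.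

Lemma abs_fst_le_Cmod (z : C) : Rabs (fst z) <= Cmod z.
Proof. eapply Rle_trans; [apply Rmax_l|apply Rmax_Cmod]. Qed.

Lemma abs_snd_le_Cmod (z : C) : Rabs (snd z) <= Cmod z.
Proof. eapply Rle_trans; [apply Rmax_r|apply Rmax_Cmod]. Qed.

Lemma Cmod_le_abs (z : C) : Cmod z <= Rabs (fst z) + Rabs (snd z).
Proof.
  destruct z as [x y]; unfold Cmod; simpl fst; simpl snd.
  rewrite <- (sqrt_pow2 (Rabs x + Rabs y)) by (apply Rplus_le_le_0_compat; apply Rabs_pos).
  apply sqrt_le_1_alt.
  rewrite <- (pow2_abs x), <- (pow2_abs y).
  generalize (Rabs_pos x), (Rabs_pos y); nra.
Qed.

Lemma near_ball (d : R) : 0 < d -> near_O (fun z => Cmod z < d).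
Proof.
  intros hd; near (near_box (d / 2) ltac:(lra)); near_end.
  intros z [h1 h2]; generalize (Cmod_le_abs z); lra.
Qed.

Definition tends0 (F : R * R -> R * R) : Prop :=
  forall d, 0 < d -> near_O (fun v => Cmod (F v) < d).

Lemma near_comp (F : R * R -> R * R) (P : R * R -> Prop) :
  tends0 F -> near_O P -> near_O (fun v => P (F v)).
Proof.
  intros hF hP; destruct (near_box_inv P hP) as [d [hd h]].
  near (hF d hd); near_end; intros v hv; apply h.
  - generalize (abs_fst_le_Cmod (F v)); lra.
  - generalize (abs_snd_le_Cmod (F v)); lra.
Qed.

Lemma tends0_comp (F G : R * R -> R * R) :
  tends0 F -> tends0 G -> tends0 (fun v => F (G v)).
Proof. intros hF hG d hd; exact (near_comp G _ hG (hF d hd)). Qed.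

(** Total (Frechet) differentiability with differential [a dx + b dy]. Existence of partials alone
    would not survive composition; this does, and it determines [d_dx] and [d_dy]. *)
Definition dlim (f : R * R -> R) (v : R * R) (a b : R) : Prop :=
  differentiable_pt_lim (fun x y => f (x, y)) (fst v) (snd v) a b.

Definition cont (f : R * R -> R) (v : R * R) : Prop :=
  continuity_2d_pt (fun x y => f (x, y)) (fst v) (snd v).

Definition around (v : R * R) (P : R * R -> Prop) : Prop :=
  locally_2d (fun x y => P (x, y)) (fst v) (snd v).

Lemma dlim_cont f v a b : dlim f v a b -> cont f v.
Proof. intros h; apply differentiable_continuity_pt; now exists a, b. Qed.

Lemma dlim_unique f v a b : dlim f v a b -> d_dx f v = a /\ d_dy f v = b.
Proof.
  intros h; apply differentiable_pt_lim_unique in h; exact h.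
Qed.

Lemma dlim_ext f g v a b :
  around v (fun w => f w = g w) -> dlim f v a b -> dlim g v a b.
Proof. intros h; apply differentiable_pt_lim_ext, h. Qed.

Lemma dlim_comp f (F : R * R -> R * R) v a b a1 b1 a2 b2 :
  dlim f (F v) a b -> dlim (fun w => fst (F w)) v a1 b1 ->
  dlim (fun w => snd (F w)) v a2 b2 ->
  dlim (fun w => f (F w)) v (a * a1 + b * a2) (a * b1 + b * b2).
Proof.
  intros h h1 h2.
  apply (differentiable_pt_lim_ext (fun x y => f (fst (F (x, y)), snd (F (x, y))))).
  { apply locally_2d_forall; intros x y; now rewrite <- surjective_pairing. }
  apply (differentiable_pt_lim_comp (fun x y => f (x, y))
    (fun x y => fst (F (x, y))) (fun x y => snd (F (x, y)))); auto.
  destruct v; exact h.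
Qed.

Lemma dlim_filterdiff f v a b :
  dlim f v a b <->
  filterdiff (fun u : R * R => f (fst u, snd u)) (locally v)
    (fun u : R * R => fst u * a + snd u * b).
Proof.
  unfold dlim; rewrite <- filterdiff_differentiable_pt_lim; now destruct v.
Qed.

Lemma dlim_fst v : dlim fst v 1 0.
Proof.
  intros e; apply locally_2d_forall; intros x y; simpl.
  replace (_ - _) with 0 by ring; rewrite Rabs_R0.
  apply Rmult_le_pos; [apply Rlt_le, cond_pos|].
  eapply Rle_trans; [apply Rabs_pos|apply Rmax_l].
Qed.

Lemma dlim_snd v : dlim snd v 0 1.
Proof.
  intros e; apply locally_2d_forall; intros x y; simpl.
  replace (_ - _) with 0 by ring; rewrite Rabs_R0.
  apply Rmult_le_pos; [apply Rlt_le, cond_pos|].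
  eapply Rle_trans; [apply Rabs_pos|apply Rmax_l].
Qed.

Lemma dlim_const c v : dlim (fun _ => c) v 0 0.
Proof.
  intros e; apply locally_2d_forall; intros x y; simpl.
  replace (_ - _) with 0 by ring; rewrite Rabs_R0.
  apply Rmult_le_pos; [apply Rlt_le, cond_pos|].
  eapply Rle_trans; [apply Rabs_pos|apply Rmax_l].
Qed.

(** With addition and multiplication differentiated as functions of a pair, the sum and product
    rules become instances of the chain rule. *)
Lemma dlim_add_op v : dlim (fun w => fst w + snd w) v 1 1.
Proof.
  intros e; apply locally_2d_forall; intros x y; simpl.
  replace (_ - _) with 0 by ring; rewrite Rabs_R0.
  apply Rmult_le_pos; [apply Rlt_le, cond_pos|].
  eapply Rle_trans; [apply Rabs_pos|apply Rmax_l].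
Qed.

Lemma dlim_mul_op v : dlim (fun w => fst w * snd w) v (snd v) (fst v).
Proof.
  intros e; exists e; destruct v as [a b]; simpl; intros x y hx hy.
  replace (_ - _) with ((x - a) * (y - b)) by ring; rewrite Rabs_mult.
  rewrite Rmult_comm.
  apply Rmult_le_compat; try apply Rabs_pos; [lra|apply Rmax_l].
Qed.

Lemma dlim_plus f g v a b c d :
  dlim f v a b -> dlim g v c d -> dlim (fun w => f w + g w) v (a + c) (b + d).
Proof.
  intros hf hg.
  replace (a + c) with (1 * a + 1 * c) by ring.
  replace (b + d) with (1 * b + 1 * d) by ring.
  exact (dlim_comp _ (fun w => (f w, g w)) v _ _ _ _ _ _ (dlim_add_op _) hf hg).
Qed.

Lemma dlim_mult f g v a b c d :
  dlim f v a b -> dlim g v c d ->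
  dlim (fun w => f w * g w) v (a * g v + f v * c) (b * g v + f v * d).
Proof.
  intros hf hg.
  replace (a * g v + f v * c) with (g v * a + f v * c) by ring.
  replace (b * g v + f v * d) with (g v * b + f v * d) by ring.
  exact (dlim_comp _ (fun w => (f w, g w)) v _ _ _ _ _ _ (dlim_mul_op _) hf hg).
Qed.

Lemma dlim_scal k f v a b : dlim f v a b -> dlim (fun w => k * f w) v (k * a) (k * b).
Proof.
  intros h; generalize (dlim_mult (fun _ => k) f v 0 0 a b (dlim_const k v) h).
  now rewrite !Rmult_0_l, !Rplus_0_l.
Qed.

Lemma dlim_opp f v a b : dlim f v a b -> dlim (fun w => - f w) v (- a) (- b).
Proof.
  intros h; apply (dlim_ext (fun w => (-1) * f w)).
  { apply locally_2d_forall; intros; ring. }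
  replace (- a) with ((-1) * a) by ring; replace (- b) with ((-1) * b) by ring.
  now apply dlim_scal.
Qed.

Lemma dlim_minus f g v a b c d :
  dlim f v a b -> dlim g v c d -> dlim (fun w => f w - g w) v (a - c) (b - d).
Proof. intros hf hg; apply dlim_plus; [|apply dlim_opp]; auto. Qed.

Lemma dlim_inv f v a b :
  f v <> 0 -> dlim f v a b ->
  dlim (fun w => / f w) v (- a * (/ f v * / f v)) (- b * (/ f v * / f v)).
Proof.
  intros h0 hf.
  assert (h : dlim (fun w => / fst w) (f v, 0) (- / (f v * f v)) 0).
  { apply (differentiable_pt_lim_proj1_0 (fun x => / x) (f v) 0).
    apply is_derive_Reals. auto_derive; auto. simpl. field; auto. }
  generalize (dlim_comp _ (fun w => (f w, 0)) v _ _ _ _ _ _ h hf (dlim_const 0 v)).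
  simpl.
  replace (- / (f v * f v) * a + 0 * 0) with (- a * (/ f v * / f v)) by (field; auto).
  replace (- / (f v * f v) * b + 0 * 0) with (- b * (/ f v * / f v)) by (field; auto).
  auto.
Qed.

(** * Functions of class C^n on an open set, and smooth germs *)

Definition open2 (U : R * R -> Prop) : Prop := forall v, U v -> around v U.

Definition Cn (n : nat) (U : R * R -> Prop) (f : R * R -> R) : Prop :=
  forall v, U v -> ex_diff_n (fun x y => f (x, y)) n (fst v) (snd v).

Lemma Cn_cont n U f v : Cn n U f -> U v -> cont f v.
Proof. intros h hv; generalize (h v hv); destruct n; now intros [? _]. Qed.

Lemma Cn_le m n U f : (m <= n)%nat -> Cn n U f -> Cn m U f.
Proof. intros hmn h v hv; exact (ex_diff_n_m n m hmn _ _ _ (h v hv)). Qed.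

Lemma Cn_ext n U f g : open2 U -> (forall v, U v -> f v = g v) -> Cn n U f -> Cn n U g.
Proof.
  intros hU e h v hv; apply (ex_diff_n_ext_loc (fun x y => f (x, y))); [|auto].
  generalize (hU v hv); apply locally_2d_impl, locally_2d_forall; intros; now apply e.
Qed.

Lemma Cn_sub n (U W : R * R -> Prop) f : (forall v, W v -> U v) -> Cn n U f -> Cn n W f.
Proof. intros h hf v hv; apply hf, h, hv. Qed.

Lemma Cn_deriv n U f : Cn (S n) U f -> Cn n U (d_dx f) /\ Cn n U (d_dy f).
Proof.
  intros h; split; intros v hv; destruct (h v hv) as (_ & _ & _ & h1 & h2).
  - exact h1.
  - exact h2.
Qed.

(** Both partials exist and [d_dx f] is continuous, which is enough for total differentiability. *)
Lemma Cn_dlim n U f v : open2 U -> Cn (S n) U f -> U v -> dlim f v (d_dx f v) (d_dy f v).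
Proof.
  intros hU h hv; apply filterdiff_differentiable_pt_lim.
  destruct v as [x y]; simpl fst; simpl snd.
  apply (is_derive_filterdiff (fun x y => f (x, y)) x y (fun x y => d_dx f (x, y))).
  - generalize (hU (x, y) hv); intros h1; apply locally_2d_locally in h1; revert h1.
    apply filter_imp; intros [a b] hab; simpl.
    destruct (h (a, b) hab) as (_ & h2 & _); apply Derive_correct, h2.
  - destruct (h (x, y) hv) as (_ & _ & h2 & _); apply Derive_correct, h2.
  - destruct (Cn_deriv n U f h) as [h1 _].
    generalize (Cn_cont n U _ _ h1 hv); intros h2.
    apply continuity_2d_pt_filterlim in h2; exact h2.
Qed.

(** The engine of the closure properties below: a total differential with C^n coefficients gives
    class C^(n+1), so each rule of differentiation turns into a closure rule by induction on n. *)
Lemma Cn_intro n U f fx fy :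
  open2 U -> (forall v, U v -> dlim f v (fx v) (fy v)) ->
  Cn n U fx -> Cn n U fy -> Cn (S n) U f.
Proof.
  intros hU hd hx hy v hv.
  assert (e : forall w, U w -> fx w = d_dx f w /\ fy w = d_dy f w).
  { intros w hw; destruct (dlim_unique _ _ _ _ (hd w hw)); auto. }
  split; [exact (dlim_cont _ _ _ _ (hd v hv))|].
  assert (h := hd v hv); apply dlim_filterdiff in h.
  destruct v as [x y]; simpl fst; simpl snd.
  split; [|split; [|split]].
  - exists (fx (x, y)); apply is_derive_Reals.
    generalize (derivable_pt_lim_comp_2d (fun x y => f (x, y)) (fun t => t) (fun _ => y) x
      (fx (x, y)) (fy (x, y)) 1 0 (hd (x, y) hv)).
    rewrite Rmult_1_r, Rmult_0_r, Rplus_0_r; intros k; apply k.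
    + apply derivable_pt_lim_id.
    + apply derivable_pt_lim_const.
  - exists (fy (x, y)); apply is_derive_Reals.
    generalize (derivable_pt_lim_comp_2d (fun x y => f (x, y)) (fun _ => x) (fun t => t) y
      (fx (x, y)) (fy (x, y)) 0 1 (hd (x, y) hv)).
    rewrite Rmult_1_r, Rmult_0_r, Rplus_0_l; intros k; apply k.
    + apply derivable_pt_lim_const.
    + apply derivable_pt_lim_id.
  - apply (Cn_ext n U fx (d_dx f)) in hx; [exact (hx (x, y) hv)|auto|apply e].
  - apply (Cn_ext n U fy (d_dy f)) in hy; [exact (hy (x, y) hv)|auto|apply e].
Qed.

Lemma Cn_const n U c : open2 U -> Cn n U (fun _ => c).
Proof.
  intros hU; revert c; induction n as [|n IH]; intros c.
  - intros v _; split; auto; apply continuity_2d_pt_const.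
  - apply (Cn_intro n U _ (fun _ => 0) (fun _ => 0)); auto using dlim_const.
Qed.

Lemma Cn_fst n U : open2 U -> Cn n U fst.
Proof.
  intros hU; destruct n.
  - intros v _; split; auto; apply continuity_2d_pt_id1.
  - apply (Cn_intro n U _ (fun _ => 1) (fun _ => 0)); auto using dlim_fst, Cn_const.
Qed.

Lemma Cn_snd n U : open2 U -> Cn n U snd.
Proof.
  intros hU; destruct n.
  - intros v _; split; auto; apply continuity_2d_pt_id2.
  - apply (Cn_intro n U _ (fun _ => 0) (fun _ => 1)); auto using dlim_snd, Cn_const.
Qed.

Lemma Cn_plus n U f g : open2 U -> Cn n U f -> Cn n U g -> Cn n U (fun v => f v + g v).
Proof.
  intros hU; revert f g; induction n as [|n IH]; intros f g hf hg.
  - intros v hv; split; auto; apply continuity_2d_pt_plus; [apply (hf v hv)|apply (hg v hv)].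
  - destruct (Cn_deriv _ _ _ hf), (Cn_deriv _ _ _ hg).
    apply (Cn_intro n U _ (fun v => d_dx f v + d_dx g v) (fun v => d_dy f v + d_dy g v)); auto.
    intros v hv; apply dlim_plus; apply (Cn_dlim n U); auto.
Qed.

Lemma Cn_mult n U f g : open2 U -> Cn n U f -> Cn n U g -> Cn n U (fun v => f v * g v).
Proof.
  intros hU; revert f g; induction n as [|n IH]; intros f g hf hg.
  - intros v hv; split; auto; apply continuity_2d_pt_mult; [apply (hf v hv)|apply (hg v hv)].
  - destruct (Cn_deriv _ _ _ hf), (Cn_deriv _ _ _ hg).
    assert (Cn n U f) by (eapply Cn_le; [|eassumption]; lia).
    assert (Cn n U g) by (eapply Cn_le; [|eassumption]; lia).
    apply (Cn_intro n U _ (fun v => d_dx f v * g v + f v * d_dx g v)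
      (fun v => d_dy f v * g v + f v * d_dy g v)); auto using Cn_plus.
    intros v hv; apply dlim_mult; apply (Cn_dlim n U); auto.
Qed.

Lemma Cn_inv n U f :
  open2 U -> (forall v, U v -> f v <> 0) -> Cn n U f -> Cn n U (fun v => / f v).
Proof.
  intros hU h0; induction n as [|n IH]; intros hf.
  - intros v hv; split; auto; apply continuity_2d_pt_inv; [apply (hf v hv)|].
    generalize (h0 v hv); now destruct v.
  - destruct (Cn_deriv _ _ _ hf) as [hx hy].
    assert (Cn n U f) by (eapply Cn_le; [|eassumption]; lia).
    assert (hm : forall g, Cn n U g -> Cn n U (fun v => - g v)).
    { intros g hg; apply (Cn_ext n U (fun v => (-1) * g v)); auto.
      - intros; ring.
      - apply Cn_mult; auto using Cn_const. }
    apply (Cn_intro n U _ (fun v => - d_dx f v * (/ f v * / f v))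
      (fun v => - d_dy f v * (/ f v * / f v))); auto 6 using Cn_mult.
    intros v hv; apply dlim_inv; auto; apply (Cn_dlim n U); auto.
Qed.

(** The induction runs over all [f] at once, since the chain rule calls for the partials of [f]
    composed with the same [F]. *)
Lemma Cn_comp n U W f (F : R * R -> R * R) :
  open2 U -> open2 W -> (forall v, W v -> U (F v)) ->
  Cn n U f -> Cn n W (fun v => fst (F v)) -> Cn n W (fun v => snd (F v)) ->
  Cn n W (fun v => f (F v)).
Proof.
  intros hU hW hF; revert f; induction n as [|n IH]; intros f hf h1 h2.
  - intros v hv; split; auto.
    assert (k := proj1 (hf _ (hF v hv))).
    assert (k1 := proj1 (h1 _ hv)); assert (k2 := proj1 (h2 _ hv)).
    apply continuity_2d_pt_filterlim in k.
    apply continuity_2d_pt_filterlim in k1.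
    apply continuity_2d_pt_filterlim in k2.
    apply continuity_2d_pt_filterlim.
    destruct v as [x y]; cbv beta in *; simpl fst in *; simpl snd in *.
    destruct (F (x, y)) as [a b] eqn:eF; simpl in *.
    apply (filterlim_ext (fun z : R * R => f (fst (F (fst z, snd z)), snd (F (fst z, snd z))))).
    { intros z; now rewrite <- surjective_pairing. }
    refine (filterlim_comp_2 _ _ (fun p q : R => f (p, q)) k1 k2 _).
    intros P hP. generalize (k P hP). intros [e he]; exists (ball a e) (ball b e).
    apply locally_ball. apply locally_ball. intros; now apply (he (_, _)).
  - destruct (Cn_deriv _ _ _ hf), (Cn_deriv _ _ _ h1), (Cn_deriv _ _ _ h2).
    assert (Cn n W (fun v => fst (F v))) by (eapply Cn_le; [|eassumption]; lia).
    assert (Cn n W (fun v => snd (F v))) by (eapply Cn_le; [|eassumption]; lia).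
    apply (Cn_intro n W _
      (fun v => d_dx f (F v) * d_dx (fun w => fst (F w)) v
        + d_dy f (F v) * d_dx (fun w => snd (F w)) v)
      (fun v => d_dx f (F v) * d_dy (fun w => fst (F w)) v
        + d_dy f (F v) * d_dy (fun w => snd (F w)) v)); auto 6 using Cn_plus, Cn_mult.
    intros v hv; apply dlim_comp;
      [apply (Cn_dlim n U)|apply (Cn_dlim n W)|apply (Cn_dlim n W)]; auto.
Qed.

Definition box (d : R) (v : R * R) : Prop := Rabs (fst v) < d /\ Rabs (snd v) < d.

Lemma box_open d : open2 (box d).
Proof.
  intros [x y] [hx hy]; simpl in hx, hy.
  assert (h : 0 < Rmin (d - Rabs x) (d - Rabs y)) by (apply Rmin_glb_lt; lra).
  exists (mkposreal _ h); simpl; intros u v hu hv.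
  generalize (Rmin_l (d - Rabs x) (d - Rabs y)), (Rmin_r (d - Rabs x) (d - Rabs y)).
  intros h1 h2.
  generalize (Rabs_triang (u - x) x), (Rabs_triang (v - y) y).
  replace (u - x + x) with u by ring; replace (v - y + y) with v by ring.
  split; simpl; lra.
Qed.

Lemma box_0 d : 0 < d -> box d (0, 0).
Proof. split; simpl; rewrite Rabs_R0; auto. Qed.

Lemma open_around (U P : R * R -> Prop) v :
  open2 U -> U v -> (forall w, U w -> P w) -> around v P.
Proof.
  intros hU hv h; generalize (hU v hv); apply locally_2d_impl, locally_2d_forall; auto.
Qed.

Lemma near_around (P : R * R -> Prop) : near_O P -> near_O (fun v => around v P).
Proof.
  intros h; destruct (near_box_inv P h) as [d [hd hP]].
  near (near_box d hd); near_end; intros v hv.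
  apply (open_around (box d)); auto using box_open.
  intros w [? ?]; auto.
Qed.

Definition smoothR (f : R * R -> R) : Prop :=
  near_O (fun v => forall n : nat, ex_diff_n (fun x y => f (x, y)) n (fst v) (snd v)).

Lemma smoothR_box f : smoothR f <-> exists d, 0 < d /\ forall n, Cn n (box d) f.
Proof.
  split.
  - unfold smoothR; intros h; destruct (near_box_inv _ h) as [d [hd hf]]; exists d; split; auto.
    intros n v [h1 h2]; apply hf; auto.
  - intros [d [hd hf]]; near (near_box d hd); near_end; intros v hv n; apply hf, hv.
Qed.

Lemma Cn_box_le n d e f : e <= d -> Cn n (box d) f -> Cn n (box e) f.
Proof. intros h; apply Cn_sub; intros v [? ?]; split; lra. Qed.

Lemma smoothR_box2 f g :
  smoothR f -> smoothR g -> exists d, 0 < d /\ (forall n, Cn n (box d) f) /\ forall n, Cn n (box d) g.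
Proof.
  intros hf hg; apply smoothR_box in hf, hg.
  destruct hf as [d [hd hf]], hg as [e [he hg]].
  exists (Rmin d e); split; [now apply Rmin_glb_lt|].
  split; intros n; [apply (Cn_box_le n d)|apply (Cn_box_le n e)]; auto using Rmin_l, Rmin_r.
Qed.

Lemma smoothR_const c : smoothR (fun _ => c).
Proof. apply smoothR_box; exists 1; split; [lra|]; auto using Cn_const, box_open. Qed.

Lemma smoothR_fst : smoothR fst.
Proof. apply smoothR_box; exists 1; split; [lra|]; auto using Cn_fst, box_open. Qed.

Lemma smoothR_snd : smoothR snd.
Proof. apply smoothR_box; exists 1; split; [lra|]; auto using Cn_snd, box_open. Qed.

Lemma smoothR_plus f g : smoothR f -> smoothR g -> smoothR (fun v => f v + g v).
Proof.
  intros hf hg; destruct (smoothR_box2 f g hf hg) as [d [hd [h1 h2]]].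
  apply smoothR_box; exists d; auto using Cn_plus, box_open.
Qed.

Lemma smoothR_mult f g : smoothR f -> smoothR g -> smoothR (fun v => f v * g v).
Proof.
  intros hf hg; destruct (smoothR_box2 f g hf hg) as [d [hd [h1 h2]]].
  apply smoothR_box; exists d; auto using Cn_mult, box_open.
Qed.

Lemma smoothR_ext f g : near_O (fun v => f v = g v) -> smoothR f -> smoothR g.
Proof.
  intros h hf; near (near_around _ h); near hf; near_end.
  intros v h1 h2 n; apply (ex_diff_n_ext_loc (fun x y => f (x, y))); auto.
Qed.

Lemma smoothR_opp f : smoothR f -> smoothR (fun v => - f v).
Proof.
  intros hf; apply (smoothR_ext (fun v => (-1) * f v)).
  - near_end; intros; ring.
  - apply smoothR_mult; auto using smoothR_const.
Qed.

Lemma smoothR_minus f g : smoothR f -> smoothR g -> smoothR (fun v => f v - g v).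
Proof. intros; apply smoothR_plus; auto using smoothR_opp. Qed.

Lemma smoothR_pow f n : smoothR f -> smoothR (fun v => f v ^ n).
Proof. intros h; induction n; simpl; auto using smoothR_const, smoothR_mult. Qed.

Lemma smoothR_dx f : smoothR f -> smoothR (d_dx f).
Proof.
  intros h; apply smoothR_box in h; destruct h as [d [hd h]].
  apply smoothR_box; exists d; split; auto; intros n; now apply Cn_deriv.
Qed.

Lemma smoothR_dy f : smoothR f -> smoothR (d_dy f).
Proof.
  intros h; apply smoothR_box in h; destruct h as [d [hd h]].
  apply smoothR_box; exists d; split; auto; intros n; now apply Cn_deriv.
Qed.

Lemma smoothR_dlim f : smoothR f -> near_O (fun v => dlim f v (d_dx f v) (d_dy f v)).
Proof.
  intros h; apply smoothR_box in h; destruct h as [d [hd h]].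
  near (near_box d hd); near_end; intros v hv.
  apply (Cn_dlim 0 (box d)); auto using box_open.
Qed.

Lemma smoothR_cont f : smoothR f -> forall e, 0 < e -> near_O (fun v => Rabs (f v - f (0, 0)) < e).
Proof. unfold smoothR; intros h e he; exact (proj1 (near_at0 _ h O) (mkposreal e he)). Qed.

Lemma smooth_iff F :
  smooth_near_O F <-> smoothR (fun v => fst (F v)) /\ smoothR (fun v => snd (F v)).
Proof.
  split.
  - intros h; split; near h; near_end; intros v h1 n; apply (h1 n).
  - intros [h1 h2]; near h1; near h2; near_end; intros v k2 k1 n; split; auto.
Qed.

Lemma smooth_tends0 F : smooth_near_O F -> F (0, 0) = (0, 0) -> tends0 F.
Proof.
  intros h h0 d hd; apply smooth_iff in h; destruct h as [h1 h2].
  near (smoothR_cont _ h1 (d / 2) ltac:(lra)); near (smoothR_cont _ h2 (d / 2) ltac:(lra)).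
  near_end; intros v; rewrite h0; simpl; rewrite !Rminus_0_r.
  intros k2 k1; generalize (Cmod_le_abs (F v)); lra.
Qed.

Lemma smoothR_comp f F : smooth_near_O F -> F (0, 0) = (0, 0) -> smoothR f -> smoothR (fun v => f (F v)).
Proof.
  intros hF h0 hf; assert (ht := smooth_tends0 F hF h0).
  apply smoothR_box in hf; destruct hf as [d [hd hf]].
  apply smooth_iff in hF; destruct hF as [h1 h2].
  destruct (smoothR_box2 _ _ h1 h2) as [e [he [k1 k2]]].
  destruct (near_box_inv _ (ht d hd)) as [e' [he' k3]].
  apply smoothR_box; exists (Rmin e e'); split; [now apply Rmin_glb_lt|]; intros n.
  apply (Cn_comp n (box d)); auto using box_open.
  - intros v [hx hy]; generalize (Rmin_r e e'); intros hr.
    assert (k := k3 v ltac:(lra) ltac:(lra)).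
    generalize (abs_fst_le_Cmod (F v)), (abs_snd_le_Cmod (F v)); split; lra.
  - apply (Cn_box_le n e); auto using Rmin_l.
  - apply (Cn_box_le n e); auto using Rmin_l.
Qed.

Lemma smooth_comp F G :
  smooth_near_O F -> smooth_near_O G -> G (0, 0) = (0, 0) -> smooth_near_O (fun v => F (G v)).
Proof.
  intros hF hG h0; apply smooth_iff in hF; destruct hF; apply smooth_iff; split.
  - now apply (smoothR_comp (fun v => fst (F v))).
  - now apply (smoothR_comp (fun v => snd (F v))).
Qed.

Lemma d_ext f g :
  near_O (fun v => f v = g v) -> smoothR f ->
  near_O (fun v => d_dx f v = d_dx g v /\ d_dy f v = d_dy g v).
Proof.
  intros h hf; near (near_around _ h); near (smoothR_dlim f hf); near_end.
  intros v h1 h2; apply (dlim_ext _ _ _ _ _ h2), dlim_unique in h1; destruct h1; auto.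
Qed.

Lemma jac_det_ext F G :
  near_O (fun v => F v = G v) -> smooth_near_O F ->
  near_O (fun v => jac_det F v = jac_det G v).
Proof.
  intros h hF; apply smooth_iff in hF; destruct hF as [h1 h2].
  near (d_ext (fun v => fst (F v)) (fun v => fst (G v)) ltac:(near h; near_end; now intros v ->) h1).
  near (d_ext (fun v => snd (F v)) (fun v => snd (G v)) ltac:(near h; near_end; now intros v ->) h2).
  near_end; intros v [k1 k2] [k3 k4]; unfold jac_det; congruence.
Qed.

Lemma jac_det_comp F G :
  smooth_near_O F -> smooth_near_O G -> G (0, 0) = (0, 0) ->
  near_O (fun v => jac_det (fun w => F (G w)) v = jac_det F (G v) * jac_det G v).
Proof.
  intros hF hG h0; assert (ht := smooth_tends0 G hG h0).
  apply smooth_iff in hF, hG; destruct hF as [f1 f2], hG as [g1 g2].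
  near (near_comp _ _ ht (smoothR_dlim _ f1)); near (near_comp _ _ ht (smoothR_dlim _ f2)).
  near (smoothR_dlim _ g1); near (smoothR_dlim _ g2); near_end; intros v k4 k3 k2 k1.
  destruct (dlim_unique _ _ _ _ (dlim_comp _ _ _ _ _ _ _ _ _ k1 k3 k4)) as [e1 e2].
  destruct (dlim_unique _ _ _ _ (dlim_comp _ _ _ _ _ _ _ _ _ k2 k3 k4)) as [e3 e4].
  unfold jac_det; rewrite e1, e2, e3, e4; ring.
Qed.

(** * Mean value estimates and the implicit function theorem *)

Lemma dlim_1d_x f x y a b : dlim f (x, y) a b -> is_derive (fun t => f (t, y)) x a.
Proof.
  intros h; apply is_derive_Reals.
  generalize (derivable_pt_lim_comp_2d (fun x y => f (x, y)) (fun t => t) (fun _ => y) x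
    a b 1 0 h).
  rewrite Rmult_1_r, Rmult_0_r, Rplus_0_r; intros k; apply k.
  - apply derivable_pt_lim_id.
  - apply derivable_pt_lim_const.
Qed.

Lemma dlim_1d_y f x y a b : dlim f (x, y) a b -> is_derive (fun t => f (x, t)) y b.
Proof.
  intros h; apply is_derive_Reals.
  generalize (derivable_pt_lim_comp_2d (fun x y => f (x, y)) (fun _ => x) (fun t => t) y
    a b 0 1 h).
  rewrite Rmult_1_r, Rmult_0_r, Rplus_0_l; intros k; apply k.
  - apply derivable_pt_lim_const.
  - apply derivable_pt_lim_id.
Qed.

Lemma is_derive_cont (f : R -> R) x l : is_derive f x l -> continuity_pt f x.
Proof. intros h; apply derivable_continuous_pt; exists l; now apply is_derive_Reals. Qed.

Lemma MVT_bound (f df : R -> R) a b K :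
  (forall t, Rmin a b <= t <= Rmax a b -> is_derive f t (df t)) ->
  (forall t, Rmin a b <= t <= Rmax a b -> Rabs (df t) <= K) ->
  Rabs (f a - f b) <= K * Rabs (a - b).
Proof.
  intros h hK.
  destruct (MVT_gen f b a df) as [c [hc e]].
  - intros t ht; apply h; rewrite Rmin_comm, Rmax_comm; lra.
  - intros t ht; apply (is_derive_cont f t (df t)), h; rewrite Rmin_comm, Rmax_comm; lra.
  - rewrite e, Rabs_mult; apply Rmult_le_compat_r; [apply Rabs_pos|].
    apply hK; rewrite Rmin_comm, Rmax_comm; lra.
Qed.

Lemma between_abs a b c r : Rmin a b <= c <= Rmax a b -> Rabs a < r -> Rabs b < r -> Rabs c < r.
Proof.
  intros h ha hb; apply Rabs_lt_between; apply Rabs_lt_between in ha, hb.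
  revert h; unfold Rmin, Rmax; destruct (Rle_dec a b); lra.
Qed.

(** The mean value theorem is applied along the horizontal and then the vertical segment through the
    corner [(a', b)], both of which stay in the box. *)
Lemma box_lipschitz f d r K :
  (forall v, box d v -> dlim f v (d_dx f v) (d_dy f v)) ->
  r <= d ->
  (forall v, box r v -> Rabs (d_dx f v) <= K /\ Rabs (d_dy f v) <= K) ->
  forall v w, box r v -> box r w ->
  Rabs (f v - f w) <= K * (Rabs (fst v - fst w) + Rabs (snd v - snd w)).
Proof.
  intros hd hr hK [a b] [a' b'] [ha hb] [ha' hb']; simpl in *.
  assert (h1 : Rabs (f (a, b) - f (a', b)) <= K * Rabs (a - a')).
  { apply (MVT_bound (fun t => f (t, b)) (fun t => d_dx f (t, b))).
    - intros t ht; generalize (between_abs _ _ _ _ ht ha ha'); intros.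
      apply (dlim_1d_x f t b _ (d_dy f (t, b))), hd; split; simpl; lra.
    - intros t ht; generalize (between_abs _ _ _ _ ht ha ha'); intros.
      apply hK; split; simpl; lra. }
  assert (h2 : Rabs (f (a', b) - f (a', b')) <= K * Rabs (b - b')).
  { apply (MVT_bound (fun t => f (a', t)) (fun t => d_dy f (a', t))).
    - intros t ht; generalize (between_abs _ _ _ _ ht hb hb'); intros.
      apply (dlim_1d_y f a' t (d_dx f (a', t))), hd; split; simpl; lra.
    - intros t ht; generalize (between_abs _ _ _ _ ht hb hb'); intros.
      apply hK; split; simpl; lra. }
  replace (f (a, b) - f (a', b')) with
    ((f (a, b) - f (a', b)) + (f (a', b) - f (a', b'))) by ring.
  eapply Rle_trans; [apply Rabs_triang|]; lra.
Qed.

(** Implicit differentiation of [g + T(x, g) = y]. The Lipschitz bound on [g] turns an error small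
    relative to the increment of [g] into one small relative to the increment of [(x, y)]. *)
Lemma dlim_implicit T g v0 c0 d :
  let u0 := (fst v0, g v0) in
  dlim T u0 c0 d -> Rabs d <= / 2 -> 
  around v0 (fun v => g v + T (fst v, g v) = snd v) ->
  around v0 (fun v =>
    Rabs (g v - g v0) <= Rabs (fst v - fst v0) + 2 * Rabs (snd v - snd v0)) ->
  dlim g v0 (- c0 * / (1 + d)) (/ (1 + d)).
Proof.
  intros u0 hT hd he hl e.
  assert (e0 := locally_2d_singleton _ _ _ he); cbv beta in e0.
  (* The final error is 2 * 3 * (e / 6): the factor 3 = 1 + 2 comes from the Lipschitz bound on [g],
     the factor 2 from [|1 / (1 + d)| <= 2]. *)
  assert (he6 : 0 < e / 6) by (generalize (cond_pos e); lra).
  destruct (hT (mkposreal _ he6)) as [r hr].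
  assert (hr3 : 0 < r / 3) by (generalize (cond_pos r); lra).
  assert (hb : around v0 (fun v => Rabs (fst v - fst v0) < r / 3 /\ Rabs (snd v - snd v0) < r / 3)).
  { exists (mkposreal _ hr3); simpl; auto. }
  generalize (locally_2d_and _ _ _ _ hb (locally_2d_and _ _ _ _ he hl)).
  apply locally_2d_impl, locally_2d_forall; intros u v [[hu hv] [e1 hL]].
  destruct v0 as [x y]; simpl in *.
  set (V := g (u, v)) in *; set (V0 := g (x, y)) in *.
  assert (hV : Rabs (V - V0) < r) by lra.
  generalize (hr u V ltac:(lra) hV); intros h.
  assert (hm : Rmax (Rabs (u - x)) (Rabs (V - V0)) <= 3 * Rmax (Rabs (u - x)) (Rabs (v - y))).
  { generalize (Rmax_l (Rabs (u - x)) (Rabs (v - y))), (Rmax_r (Rabs (u - x)) (Rabs (v - y))).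
    generalize (Rabs_pos (u - x)), (Rabs_pos (v - y)); intros.
    apply Rmax_lub; lra. }
  apply Rabs_le_between in hd.
  assert (hd1 : / 2 <= 1 + d) by lra.
  assert (E : V - V0 - (- c0 * / (1 + d) * (u - x) + / (1 + d) * (v - y)) =
    - (/ (1 + d)) * (T (u, V) - T (x, V0) - (c0 * (u - x) + d * (V - V0)))).
  { rewrite <- e1, <- e0; field; lra. }
  rewrite E, Rabs_mult, Rabs_Ropp.
  assert (hi : Rabs (/ (1 + d)) <= 2).
  { rewrite Rabs_pos_eq by (apply Rlt_le, Rinv_0_lt_compat; lra).
    replace 2 with (/ / 2) by field; apply Rinv_le_contravar; lra. }
  set (A := Rabs (T (u, V) - _ - _)) in *.
  assert (A <= e / 6 * (3 * Rmax (Rabs (u - x)) (Rabs (v - y)))).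
  { eapply Rle_trans; [exact h|]; apply Rmult_le_compat_l; lra. }
  generalize (Rabs_pos (/ (1 + d))); intros.
  assert (0 <= A) by (apply Rabs_pos).
  nra.
Qed.

(** Near the origin [V + T(u, V)] has a derivative in [V] between 1/2 and 3/2, so a solution exists
    by the intermediate value theorem and is unique by the Lipschitz constant 1/2 of [T]. The last
    two clauses are the two inverse relations of the shear [(u, V) -> (u, V + T(u, V))]. *)
Lemma implicit_function T :
  smoothR T -> T (0, 0) = 0 -> d_dx T (0, 0) = 0 -> d_dy T (0, 0) = 0 ->
  exists g, smoothR g /\ g (0, 0) = 0 /\
    near_O (fun v => g v + T (fst v, g v) = snd v) /\
    near_O (fun v => g (fst v, snd v + T v) = snd v).
Proof.
  intros hT T0 Tx Ty.
  assert (hn : near_O (fun v => Rabs (d_dx T v) <= / 2 /\ Rabs (d_dy T v) <= / 2)).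
  { near (smoothR_cont _ (smoothR_dx T hT) (/ 2) ltac:(lra)).
    near (smoothR_cont _ (smoothR_dy T hT) (/ 2) ltac:(lra)).
    near_end; intros v; rewrite Tx, Ty, !Rminus_0_r; lra. }
  destruct (near_box_inv _ hn) as [d1 [hd1 hK]].
  destruct (proj1 (smoothR_box T) hT) as [d2 [hd2 hC]].
  set (d := Rmin d1 d2).
  assert (hd : 0 < d) by now apply Rmin_glb_lt.
  assert (hC' : forall n, Cn n (box d) T).
  { intros n; apply (Cn_box_le n d2); [apply Rmin_r|apply hC]. }
  assert (hK' : forall v, box d v -> Rabs (d_dx T v) <= / 2 /\ Rabs (d_dy T v) <= / 2).
  { intros v [h1 h2]; generalize (Rmin_l d1 d2); fold d; intros; apply hK; lra. }
  assert (hdl : forall v, box d v -> dlim T v (d_dx T v) (d_dy T v)).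
  { intros v hv; apply (Cn_dlim 0 (box d)); auto using box_open. }
  assert (hL := box_lipschitz T d d (/ 2) hdl (Rle_refl d) hK').
  (* For [|u| < d/4] and [|V| = 3d/4] one has [|T(u, V)| < d/2], so at the two ends [V + T(u, V)]
     lies beyond [-d/4] and [d/4], on either side of [v]. *)
  assert (ex : forall w, exists V, box (d / 4) w ->
    Rabs V <= 3 * d / 4 /\ V + T (fst w, V) = snd w).
  { intros [u v]; destruct (excluded_middle_informative (box (d / 4) (u, v))) as [[hu hv]|h].
    2: exists 0; tauto.
    simpl in *.
    assert (hend : forall V, Rabs V <= 3 * d / 4 -> Rabs (T (u, V)) <= / 2 * (Rabs u + Rabs V)).
    { intros V hV; generalize (hL (u, V) (0, 0)); simpl; rewrite T0, !Rminus_0_r; intros h; apply h;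
        [split; simpl; lra|apply box_0; auto]. }
    destruct (Ranalysis5.IVT_interv (fun V => V + T (u, V) - v) (- (3 * d / 4)) (3 * d / 4))
      as [V [hV eV]].
    - intros V hV.
      assert (hb : box d (u, V)) by (split; simpl; [lra|apply Rabs_lt_between; lra]).
      generalize (dlim_minus _ _ _ _ _ _ _
        (dlim_plus _ _ _ _ _ _ _ (dlim_snd (u, V)) (hdl _ hb)) (dlim_const v (u, V))).
      intros h1; exact (is_derive_cont _ _ _ (dlim_1d_y _ _ _ _ _ h1)).
    - lra.
    - generalize (hend (- (3 * d / 4))); rewrite Rabs_Ropp, Rabs_pos_eq by lra; intros h.
      specialize (h ltac:(lra)); apply Rabs_le_between in h; apply Rabs_lt_between in hv.
      lra.
    - generalize (hend (3 * d / 4)); rewrite Rabs_pos_eq by lra; intros h.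
      specialize (h ltac:(lra)); apply Rabs_le_between in h; apply Rabs_lt_between in hv.
      lra.
    - exists V; intros _; split; [apply Rabs_le_between; lra|lra]. }
  set (g := fun w => proj1_sig (constructive_indefinite_description _ (ex w))).
  assert (hg : forall w, box (d / 4) w -> Rabs (g w) <= 3 * d / 4 /\ g w + T (fst w, g w) = snd w).
  { intros w; unfold g; now destruct (constructive_indefinite_description _ _). }
  (* Subtracting the two equations gives [|dV| <= |dv| + (|du| + |dV|) / 2], and the term in [dV] is
     absorbed on the left. *)
  assert (hlip : forall v w, box (d / 4) v -> box (d / 4) w ->
    Rabs (g v - g w) <= Rabs (fst v - fst w) + 2 * Rabs (snd v - snd w)).
  { intros v w hv hw; destruct (hg v hv) as [bv ev], (hg w hw) as [bw ew].
    destruct hv as [hv1 hv2], hw as [hw1 hw2].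
    generalize (hL (fst v, g v) (fst w, g w)); simpl; intros h.
    specialize (h ltac:(split; simpl; lra) ltac:(split; simpl; lra)).
    replace (g v - g w) with ((snd v - snd w) + - (T (fst v, g v) - T (fst w, g w))) in * by lra.
    generalize (Rabs_triang (snd v - snd w) (- (T (fst v, g v) - T (fst w, g w)))).
    rewrite (Rabs_Ropp (T _ - _)); intros.
    lra. }
  assert (huniq : forall u V W, Rabs u < d -> Rabs V < d -> Rabs W < d ->
    V + T (u, V) = W + T (u, W) -> V = W).
  { intros u V W hu hV hW e; generalize (hL (u, V) (u, W)); simpl; intros h.
    specialize (h ltac:(split; simpl; lra) ltac:(split; simpl; lra)).
    replace (T (u, V) - T (u, W)) with (- (V - W)) in h by lra.
    rewrite Rabs_Ropp, Rminus_eq_0, Rabs_R0 in h.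
    generalize (Rabs_pos (V - W)); intros; apply Rminus_diag_uniq.
    apply Rabs_eq_0; lra. }
  assert (hd4 : 0 < d / 4) by lra.
  exists g; split; [|split; [|split]].
  - apply smoothR_box; exists (d / 4); split; auto.
    (* Bootstrapping: continuity comes from [hlip], and the partials of [g] are smooth expressions
       in [(u, g)], so if [g] is of class C^n then so are its partials. *)
    induction n as [|n IH].
    + intros [x y] hv; split; auto; intros e.
      assert (he : 0 < e / 3) by (generalize (cond_pos e); lra).
      assert (hb : around (x, y) (fun w => Rabs (fst w - x) < e / 3 /\ Rabs (snd w - y) < e / 3)).
      { exists (mkposreal _ he); simpl; auto. }
      generalize (locally_2d_and _ _ _ _ hb (box_open (d / 4) (x, y) hv)).
      apply locally_2d_impl, locally_2d_forall; simpl; intros u v [[h1 h2] h3].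
      generalize (hlip (u, v) (x, y) h3 hv); simpl; lra.
    + assert (hc : forall f, Cn n (box d) f -> Cn n (box (d / 4)) (fun w => f (fst w, g w))).
      { intros f hf; apply (Cn_comp n (box d) (box (d / 4)) f (fun w => (fst w, g w)));
          auto using box_open, Cn_fst.
        intros w hw; destruct (hg w hw); destruct hw; split; simpl; lra. }
      assert (hi : Cn n (box (d / 4)) (fun w => / (1 + d_dy T (fst w, g w)))).
      { apply (hc (fun v => / (1 + d_dy T v))).
        apply Cn_inv; [apply box_open| |].
        - intros v hv; generalize (proj2 (hK' v hv)); intros h.
          apply Rabs_le_between in h; lra.
        - apply Cn_plus; auto using box_open, Cn_const; now apply Cn_deriv. }
      apply (Cn_intro n _ _ (fun w => (-1) * d_dx T (fst w, g w) * / (1 + d_dy T (fst w, g w)))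
        (fun w => / (1 + d_dy T (fst w, g w)))); auto using box_open.
      * intros w hw; destruct (hg w hw) as [b1 e1].
        assert (hb : box d (fst w, g w)) by (destruct hw; split; simpl; lra).
        replace ((-1) * d_dx T (fst w, g w)) with (- d_dx T (fst w, g w)) by ring.
        apply (dlim_implicit T); auto.
        -- apply hK'; auto.
        -- apply (open_around (box (d / 4))); auto using box_open; intros; now apply hg.
        -- apply (open_around (box (d / 4))); auto using box_open.
      * apply Cn_mult; auto using box_open.
        apply Cn_mult; auto using box_open, Cn_const.
        apply hc, Cn_deriv; auto.
  - destruct (hg (0, 0) (box_0 _ hd4)) as [b1 e1]; simpl in *.
    apply (huniq 0); rewrite ?Rabs_R0; try lra; rewrite T0; lra.
  - near (near_box _ hd4); near_end; intros v hv; now apply hg.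
  - assert (hs : near_O (fun v => box (d / 4) (fst v, snd v + T v))).
    { near (near_box (d / 8) ltac:(lra)).
      near (smoothR_cont T hT (d / 8) ltac:(lra)).
      near_end; intros v; rewrite T0, Rminus_0_r; intros h1 [h2 h3].
      generalize (Rabs_triang (snd v) (T v)); split; simpl; lra. }
    near hs; near (near_box _ hd4); near_end; intros [x y] [h1 h2] h3; simpl in *.
    destruct (hg _ h3) as [b1 e1]; simpl in *.
    apply (huniq x); lra.
Qed.

(** * Jets at the origin *)

Definition bigOR (n : nat) (f : R * R -> R) : Prop :=
  exists K, 0 <= K /\ near_O (fun z => Rabs (f z) <= K * Cmod z ^ n).

Definition bigO (n : nat) (F : R * R -> C) : Prop :=
  exists K, 0 <= K /\ near_O (fun z => Cmod (F z) <= K * Cmod z ^ n).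

Lemma bigO_split n F : bigO n F <-> bigOR n (fun z => fst (F z)) /\ bigOR n (fun z => snd (F z)).
Proof.
  split.
  - intros [K [hK h]]; split; exists K; split; auto; near h; near_end; intros z hz.
    + eapply Rle_trans; [apply abs_fst_le_Cmod|auto].
    + eapply Rle_trans; [apply abs_snd_le_Cmod|auto].
  - intros [[K [hK h]] [L [hL k]]]; exists (K + L); split; [lra|].
    near h; near k; near_end; intros z h2 h1; generalize (Cmod_le_abs (F z)); lra.
Qed.

Lemma bigOR_ext n f g : near_O (fun z => f z = g z) -> bigOR n f -> bigOR n g.
Proof. intros e [K [hK h]]; exists K; split; auto; near e; near h; near_end; intros z h1 <-; auto. Qed.

Lemma bigOR_weaken m n f : (m <= n)%nat -> bigOR n f -> bigOR m f.
Proof.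
  intros hmn [K [hK h]]; exists K; split; auto; near h; near (near_ball 1 Rlt_0_1); near_end.
  intros z h1 h2; eapply Rle_trans; [exact h2|]; apply Rmult_le_compat_l; auto.
  replace n with (m + (n - m))%nat by lia; rewrite pow_add.
  assert (Cmod z ^ (n - m) <= 1).
  { rewrite <- (pow1 (n - m)); apply pow_incr; split; [apply Cmod_ge_0|lra]. }
  assert (0 <= Cmod z ^ m) by (apply pow_le, Cmod_ge_0); nra.
Qed.

Lemma bigOR_plus n f g : bigOR n f -> bigOR n g -> bigOR n (fun z => f z + g z).
Proof.
  intros [K [hK h]] [L [hL k]]; exists (K + L); split; [lra|].
  near h; near k; near_end; intros z h2 h1.
  eapply Rle_trans; [apply Rabs_triang|]; lra.
Qed.

Lemma bigOR_mult n m f g : bigOR n f -> bigOR m g -> bigOR (n + m) (fun z => f z * g z).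
Proof.
  intros [K [hK h]] [L [hL k]]; exists (K * L); split; [now apply Rmult_le_pos|].
  near h; near k; near_end; intros z h2 h1.
  rewrite Rabs_mult, pow_add.
  replace (K * L * _) with ((K * Cmod z ^ n) * (L * Cmod z ^ m)) by ring.
  apply Rmult_le_compat; auto using Rabs_pos.
Qed.

Lemma bigOR_const c : bigOR 0 (fun _ => c).
Proof. exists (Rabs c); split; [apply Rabs_pos|]; near_end; intros; simpl; lra. Qed.

Lemma bigOR_scal n c f : bigOR n f -> bigOR n (fun z => c * f z).
Proof. intros h; exact (bigOR_mult 0 n _ _ (bigOR_const c) h). Qed.

Lemma bigOR_opp n f : bigOR n f -> bigOR n (fun z => - f z).
Proof.
  intros h; apply (bigOR_ext n (fun z => (-1) * f z)); [near_end; intros; ring|].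
  now apply bigOR_scal.
Qed.

Lemma bigOR_minus n f g : bigOR n f -> bigOR n g -> bigOR n (fun z => f z - g z).
Proof. intros; apply bigOR_plus; auto using bigOR_opp. Qed.

Lemma bigOR_0 n : bigOR n (fun _ => 0).
Proof.
  exists 0; split; [lra|]; near_end; intros; rewrite Rabs_R0; lra.
Qed.

Lemma bigOR_fst : bigOR 1 fst.
Proof. exists 1; split; [lra|]; near_end; intros; rewrite pow_1, Rmult_1_l; apply abs_fst_le_Cmod. Qed.

Lemma bigOR_snd : bigOR 1 snd.
Proof. exists 1; split; [lra|]; near_end; intros; rewrite pow_1, Rmult_1_l; apply abs_snd_le_Cmod. Qed.

Lemma bigOR_pow n k f : bigOR n f -> bigOR (k * n) (fun z => f z ^ k).
Proof. intros h; induction k; simpl; [apply bigOR_const|now apply bigOR_mult]. Qed.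

Lemma bigO1_tends0 F : bigO 1 F -> tends0 F.
Proof.
  intros [K [hK h]] d hd.
  assert (0 < d / (K + 1)) by (apply Rdiv_lt_0_compat; lra).
  near h; near (near_ball (d / (K + 1)) ltac:(auto)); near_end; intros z h1 h2.
  apply (Rle_lt_trans _ _ _ h2); rewrite pow_1.
  apply (Rmult_lt_compat_r (K + 1)) in h1; [|lra].
  replace (d / (K + 1) * (K + 1)) with d in h1 by (field; lra).
  generalize (Cmod_ge_0 z); nra.
Qed.

Lemma bigOR_comp n f F : bigO 1 F -> bigOR n f -> bigOR n (fun z => f (F z)).
Proof.
  intros hF [K [hK h]]; assert (ht := bigO1_tends0 F hF); destruct hF as [L [hL k]].
  exists (K * L ^ n); split; [apply Rmult_le_pos; auto; now apply pow_le|].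
  near (near_comp _ _ ht h); near k; near_end; intros z h1 h2.
  eapply Rle_trans; [exact h2|].
  rewrite Rmult_assoc, <- Rpow_mult_distr; apply Rmult_le_compat_l; auto.
  apply pow_incr; split; [apply Cmod_ge_0|]; now rewrite pow_1 in h1.
Qed.

Lemma bigO_comp n G F : bigO 1 F -> bigO n G -> bigO n (fun z => G (F z)).
Proof.
  intros hF hG; apply bigO_split in hG; destruct hG as [h1 h2]; apply bigO_split; split.
  - now apply (bigOR_comp n (fun z => fst (G z))).
  - now apply (bigOR_comp n (fun z => snd (G z))).
Qed.

Lemma bigO_ext n F G : near_O (fun z => F z = G z) -> bigO n F -> bigO n G.
Proof. intros e [K [hK h]]; exists K; split; auto; near e; near h; near_end; intros z h1 <-; auto. Qed.

Lemma bigO_weaken m n F : (m <= n)%nat -> bigO n F -> bigO m F.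
Proof.
  intros h hF; apply bigO_split in hF; destruct hF; apply bigO_split; split; eapply bigOR_weaken; eauto.
Qed.

Lemma bigO_plus n F G : bigO n F -> bigO n G -> bigO n (fun z => F z + G z)%C.
Proof.
  intros hF hG; apply bigO_split in hF, hG; destruct hF, hG; apply bigO_split.
  split; now apply bigOR_plus.
Qed.

Lemma bigO_opp n F : bigO n F -> bigO n (fun z => - F z)%C.
Proof.
  intros hF; apply bigO_split in hF; destruct hF; apply bigO_split; split; now apply bigOR_opp.
Qed.

Lemma bigO_minus n F G : bigO n F -> bigO n G -> bigO n (fun z => F z - G z)%C.
Proof. intros; apply bigO_plus; auto using bigO_opp. Qed.

Lemma bigO_mult n m F G : bigO n F -> bigO m G -> bigO (n + m) (fun z => F z * G z)%C.
Proof.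
  intros [K [hK h]] [L [hL k]]; exists (K * L); split; [now apply Rmult_le_pos|].
  near h; near k; near_end; intros z h2 h1.
  rewrite Cmod_mult, pow_add.
  replace (K * L * _) with ((K * Cmod z ^ n) * (L * Cmod z ^ m)) by ring.
  apply Rmult_le_compat; auto using Cmod_ge_0.
Qed.

Lemma bigO_const c : bigO 0 (fun _ => c).
Proof. exists (Cmod c); split; [apply Cmod_ge_0|]; near_end; intros; simpl; lra. Qed.

Lemma bigO_scal n c F : bigO n F -> bigO n (fun z => c * F z)%C.
Proof. intros h; exact (bigO_mult 0 n _ _ (bigO_const c) h). Qed.

Lemma bigO_id : bigO 1 (fun z => z).
Proof. exists 1; split; [lra|]; near_end; intros; lra. Qed.

Lemma smoothR_bigOR0 f : smoothR f -> bigOR 0 f.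
Proof.
  intros h; exists (Rabs (f (0, 0)) + 1); split; [generalize (Rabs_pos (f (0, 0))); lra|].
  near (smoothR_cont f h 1 Rlt_0_1); near_end; intros z hz; simpl; rewrite Rmult_1_r.
  replace (f z) with (f z - f (0, 0) + f (0, 0)) by ring.
  eapply Rle_trans; [apply Rabs_triang|]; lra.
Qed.

(** Homogeneous polynomials of degree n, zero included, as a predicate on functions; [hpoly_ext]
    makes it invariant under pointwise equality, so that no equality between functions has to be
    proved. *)
Inductive hpoly (n : nat) : (R * R -> R) -> Prop :=
| hpoly_mono a b c : (a + b = n)%nat -> hpoly n (fun v => c * fst v ^ a * snd v ^ b)
| hpoly_plus f g : hpoly n f -> hpoly n g -> hpoly n (fun v => f v + g v)
| hpoly_ext f g : (forall v, f v = g v) -> hpoly n f -> hpoly n g.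

Lemma hpoly_homog n f t v : hpoly n f -> f (t * fst v, t * snd v) = t ^ n * f v.
Proof.
  intros h; induction h as [a b c <-|f g _ IH1 _ IH2|f g e _ IH].
  - simpl; rewrite !Rpow_mult_distr, pow_add; ring.
  - rewrite IH1, IH2; ring.
  - now rewrite <- !e.
Qed.

Lemma hpoly_smoothR n f : hpoly n f -> smoothR f.
Proof.
  intros h; induction h as [a b c <-|f g _ IH1 _ IH2|f g e _ IH].
  - auto 10 using smoothR_mult, smoothR_const, smoothR_pow, smoothR_fst, smoothR_snd.
  - now apply smoothR_plus.
  - apply (smoothR_ext f); auto; near_end; auto.
Qed.

Lemma hpoly_bigOR n f : hpoly n f -> bigOR n f.
Proof.
  intros h; induction h as [a b c <-|f g _ IH1 _ IH2|f g e _ IH].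
  - apply bigOR_mult; [apply bigOR_scal|].
    + generalize (bigOR_pow 1 a fst bigOR_fst); now rewrite Nat.mul_1_r.
    + generalize (bigOR_pow 1 b snd bigOR_snd); now rewrite Nat.mul_1_r.
  - now apply bigOR_plus.
  - apply (bigOR_ext n f); auto; near_end; auto.
Qed.

Lemma Cmod_scal_pair t v : 0 <= t -> Cmod (t * fst v, t * snd v) = t * Cmod v.
Proof.
  intros ht; unfold Cmod; simpl fst; simpl snd.
  replace ((t * fst v) ^ 2 + (t * snd v) ^ 2) with (t ^ 2 * (fst v ^ 2 + snd v ^ 2)) by ring.
  rewrite sqrt_mult_alt by apply pow2_ge_0; now rewrite sqrt_pow2.
Qed.

(** On the ray through [v] the bound reads [t^n |f v| <= K t^(n+1) |v|^(n+1)]; divide by [t^n] and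
    let [t] tend to 0. This turns estimates into identities between leading parts. *)
Lemma homog_zero n (f : R * R -> R) :
  (forall t v, 0 < t -> f (t * fst v, t * snd v) = t ^ n * f v) -> bigOR (S n) f ->
  forall v, f v = 0.
Proof.
  intros hh [K [hK h]] v; destruct (near_box_inv _ h) as [d [hd hb]].
  apply Rabs_eq_0, Rle_antisym; [|apply Rabs_pos].
  apply le_epsilon; intros e he; rewrite Rplus_0_l.
  set (M := Cmod v + 1); assert (hM : 0 < M) by (generalize (Cmod_ge_0 v); unfold M; lra).
  set (L := K * M ^ (S n) + 1).
  assert (0 <= K * M ^ S n) by (apply Rmult_le_pos; auto; apply pow_le; lra).
  assert (hL : 0 < L) by (unfold L; lra).
  (* The first bound keeps [t v] in the neighbourhood; the second gives [t * L <= e], where [L]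
     exceeds [K |v|^(n+1)]. *)
  set (t := Rmin (d / M) (e / L)).
  assert (ht : 0 < t).
  { apply Rmin_glb_lt; apply Rdiv_lt_0_compat; auto. }
  assert (htM : t * M <= d).
  { replace d with (d / M * M) by (field; lra); apply Rmult_le_compat_r; [lra|apply Rmin_l]. }
  assert (htL : t * L <= e).
  { replace e with (e / L * L) by (field; lra); apply Rmult_le_compat_r; [lra|apply Rmin_r]. }
  generalize (hb (t * fst v, t * snd v)); simpl fst; simpl snd; intros k.
  rewrite !Rabs_mult, (Rabs_pos_eq t) in k by lra.
  assert (hM1 : forall x, x <= Cmod v -> t * x < d).
  { intros x hx; apply Rlt_le_trans with (t * M); auto; apply Rmult_lt_compat_l; unfold M; lra. }
  specialize (k (hM1 _ (abs_fst_le_Cmod v)) (hM1 _ (abs_snd_le_Cmod v))).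
  rewrite hh, Cmod_scal_pair, Rabs_mult, Rabs_pos_eq in k by (auto; try lra; apply pow_le; lra).
  rewrite Rpow_mult_distr in k; simpl (t ^ S n) in k.
  assert (0 < t ^ n) by now apply pow_lt.
  assert (hvM : Cmod v ^ S n <= M ^ S n).
  { apply pow_incr; split; [apply Cmod_ge_0|unfold M; lra]. }
  assert (k2 : Rabs (f v) <= t * (K * Cmod v ^ S n)).
  { apply (Rmult_le_reg_l (t ^ n)); auto; lra. }
  eapply Rle_trans; [exact k2|].
  eapply Rle_trans; [|exact htL].
  apply Rmult_le_compat_l; [lra|]; unfold L.
  assert (K * Cmod v ^ S n <= K * M ^ S n) by (apply Rmult_le_compat_l; auto); lra.
Qed.

Lemma hpoly_zero n f : hpoly n f -> bigOR (S n) f -> forall v, f v = 0.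
Proof. intros hf; apply homog_zero; intros; now apply hpoly_homog. Qed.

Lemma hpoly_const_scal n c f : hpoly n f -> hpoly n (fun v => c * f v).
Proof.
  intros h; induction h as [a b k e|f g _ IH1 _ IH2|f g e _ IH].
  - apply (hpoly_ext n (fun v => c * k * fst v ^ a * snd v ^ b)); [intros; ring|now apply hpoly_mono].
  - apply (hpoly_ext n (fun v => c * f v + c * g v)); [intros; ring|now apply hpoly_plus].
  - apply (hpoly_ext n (fun v => c * f v)); [intros; now rewrite e|auto].
Qed.

Lemma dlim_pow f v a b n :
  dlim f v a b -> dlim (fun w => f w ^ n) v (INR n * f v ^ pred n * a) (INR n * f v ^ pred n * b).
Proof.
  intros h; induction n as [|n IH].
  - simpl; rewrite !Rmult_0_l; apply dlim_const.
  - generalize (dlim_mult _ _ _ _ _ _ _ h IH).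
    replace (a * f v ^ n + f v * (INR n * f v ^ pred n * a)) with
      (INR (S n) * f v ^ pred (S n) * a)
      by (destruct n; [simpl; ring|rewrite !S_INR; simpl; ring]).
    replace (b * f v ^ n + f v * (INR n * f v ^ pred n * b)) with
      (INR (S n) * f v ^ pred (S n) * b)
      by (destruct n; [simpl; ring|rewrite !S_INR; simpl; ring]).
    auto.
Qed.

Lemma dlim_mono a b c v :
  dlim (fun v => c * fst v ^ a * snd v ^ b) v
    (c * INR a * fst v ^ pred a * snd v ^ b) (c * INR b * fst v ^ a * snd v ^ pred b).
Proof.
  generalize (dlim_mult _ _ _ _ _ _ _
    (dlim_scal c _ _ _ _ (dlim_pow _ _ _ _ a (dlim_fst v))) (dlim_pow _ _ _ _ b (dlim_snd v))).
  match goal with |- dlim _ _ ?p ?q -> dlim _ _ ?r ?s =>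
    replace r with p by ring; replace s with q by ring end.
  auto.
Qed.

(** Euler's identity is carried along with the partials because [hamiltonian_field] rests on it. *)
Lemma hpoly_deriv n f :
  hpoly (S n) f -> exists fx fy, hpoly n fx /\ hpoly n fy /\
    (forall v, fst v * fx v + snd v * fy v = INR (S n) * f v) /\
    forall v, dlim f v (fx v) (fy v).
Proof.
  intros h; induction h as [a b c e|f g _ [fx [fy [h1 [h2 [h4 h3]]]]] _ [gx [gy [k1 [k2 [k4 k3]]]]]
    |f g e _ [fx [fy [h1 [h2 [h4 h3]]]]]].
  - exists (fun v => c * INR a * fst v ^ pred a * snd v ^ b).
    exists (fun v => c * INR b * fst v ^ a * snd v ^ pred b).
    split; [|split; [|split; [|intros; apply dlim_mono]]].
    + destruct a; [|apply hpoly_mono; simpl; lia].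
      apply (hpoly_ext n (fun v => 0 * fst v ^ 0 * snd v ^ n)); [|now apply hpoly_mono].
      intros; simpl; ring.
    + destruct b; [|apply hpoly_mono; simpl; lia].
      apply (hpoly_ext n (fun v => 0 * fst v ^ 0 * snd v ^ n)); [|now apply hpoly_mono].
      intros; simpl; ring.
    + intros v; rewrite <- e, plus_INR.
      assert (hp : forall m x, INR m * x ^ m = x * (INR m * x ^ pred m)).
      { intros [|m] x; simpl pred; simpl pow; [simpl; ring|ring]. }
      transitivity (c * snd v ^ b * (INR a * fst v ^ a) + c * fst v ^ a * (INR b * snd v ^ b)).
      * rewrite (hp a), (hp b); ring.
      * ring.
  - exists (fun v => fx v + gx v), (fun v => fy v + gy v).
    split; [now apply hpoly_plus|split; [now apply hpoly_plus|split; [|intros v; now apply dlim_plus]]].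
    intros v; rewrite (Rmult_plus_distr_l (INR (S n))), <- h4, <- k4; ring.
  - exists fx, fy; repeat split; auto; intros v; [rewrite <- e; auto|]; apply (dlim_ext f); auto.
    apply locally_2d_forall; auto.
Qed.

(** The antiderivative is normalised to vanish on the axis [x = 0], so that an estimate on [d_dx]
    can be integrated from there. *)
Lemma hpoly_antideriv n f :
  hpoly n f -> exists A Ay, hpoly (S n) A /\ (forall y, A (0, y) = 0) /\ forall v, dlim A v (f v) (Ay v).
Proof.
  intros h; induction h as [a b c e|f g _ [A [Ay [h1 [h2 h3]]]] _ [B [By [k1 [k2 k3]]]]
    |f g e _ [A [Ay [h1 [h2 h3]]]]].
  - exists (fun v => c / INR (S a) * fst v ^ S a * snd v ^ b).
    exists (fun v => c / INR (S a) * INR b * fst v ^ S a * snd v ^ pred b).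
    split; [apply hpoly_mono; lia|split; [intros; simpl; ring|intros v]].
    generalize (dlim_mono (S a) b (c / INR (S a)) v).
    replace (c / INR (S a) * INR (S a) * fst v ^ pred (S a) * snd v ^ b) with
      (c * fst v ^ a * snd v ^ b); auto.
    simpl pred; field; apply not_0_INR; lia.
  - exists (fun v => A v + B v), (fun v => Ay v + By v); split; [now apply hpoly_plus|].
    split; [intros; rewrite h2, k2; ring|intros; now apply dlim_plus].
  - exists A, Ay; repeat split; auto; intros; rewrite <- e; auto.
Qed.

Lemma hpoly_sum n (f : nat -> R * R -> R) k :
  (forall i, (i <= k)%nat -> hpoly n (f i)) -> hpoly n (fun v => sum_f_R0 (fun i => f i v) k).
Proof.
  intros h; induction k as [|k IH]; simpl.
  - apply h; lia.
  - apply (hpoly_plus n (fun v => sum_f_R0 (fun i => f i v) k)); [apply IH; intros|]; apply h; lia.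
Qed.

(** * Taylor expansion, leading parts and orders of vanishing *)

Definition taylor_term (f : R * R -> R) (p : nat) (v : R * R) : R :=
  differential p (fun x y => f (x, y)) 0 0 (fst v) (snd v) / INR (fact p).

Lemma hpoly_taylor_term f p : hpoly p (taylor_term f p).
Proof.
  apply (hpoly_ext p (fun v => / INR (fact p) *
    differential p (fun x y => f (x, y)) 0 0 (fst v) (snd v))).
  { intros; apply Rmult_comm. }
  apply hpoly_const_scal, hpoly_sum; intros i hi; apply hpoly_mono; lia.
Qed.

Lemma taylor f n :
  smoothR f -> bigOR (S n) (fun v => f v - sum_f_R0 (fun p => taylor_term f p v) n).
Proof.
  unfold smoothR; intros h; destruct (Taylor_Lagrange_2d (fun x y => f (x, y)) n 0 0) as [D hD].
  - generalize (near_around _ h); intros hh; apply near_at0 in hh; revert hh.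
    apply locally_2d_impl, locally_2d_forall; intros x y hx; apply hx.
  - exists (Rabs D); split; [apply Rabs_pos|].
    revert hD; apply (locally_2d_impl), locally_2d_forall; intros x y.
    unfold DL_pol; rewrite !Rminus_0_r; intros hD.
    eapply Rle_trans; [exact hD|].
    eapply Rle_trans; [apply Rmult_le_compat_r; [|apply Rle_abs]|].
    + apply pow_le; eapply Rle_trans; [apply Rabs_pos|apply Rmax_l].
    + apply Rmult_le_compat_l; [apply Rabs_pos|].
      apply pow_incr; split; [eapply Rle_trans; [apply Rabs_pos|apply Rmax_l]|].
      exact (Rmax_Cmod (x, y)).
Qed.

(** Order by order: once the lower terms vanish, the term of degree p is [f] minus a Taylor
    remainder, hence O(|v|^(p+1)), and being homogeneous of degree p it is zero. *)
Lemma taylor_vanish f n :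
  smoothR f -> bigOR n f -> forall p, (p < n)%nat ->
  forall v, sum_f_R0 (fun q => taylor_term f q v) p = 0.
Proof.
  intros hs hO; induction p as [|p IH]; intros hp.
  - apply (hpoly_zero 0); [apply (hpoly_taylor_term f 0)|].
    apply (bigOR_ext _ (fun v => f v - (f v - taylor_term f 0 v))).
    { near_end; intros; simpl; ring. }
    apply bigOR_minus; [now apply (bigOR_weaken 1 n)|]; exact (taylor f 0 hs).
  - intros v; simpl; rewrite IH by lia; rewrite Rplus_0_l; revert v.
    apply (hpoly_zero (S p)); [apply hpoly_taylor_term|].
    apply (bigOR_ext _ (fun v => f v - (f v - sum_f_R0 (fun q => taylor_term f q v) (S p)))).
    { near_end; intros v; simpl; rewrite IH by lia; ring. }
    apply bigOR_minus; [now apply (bigOR_weaken _ n)|]; exact (taylor f (S p) hs).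
Qed.

Lemma leading_term f n :
  smoothR f -> bigOR n f -> exists h, hpoly n h /\ bigOR (S n) (fun v => f v - h v).
Proof.
  intros hs hO; exists (taylor_term f n); split; [apply hpoly_taylor_term|].
  apply (bigOR_ext _ (fun v => f v - sum_f_R0 (fun p => taylor_term f p v) n)); [|now apply taylor].
  near_end; intros v; destruct n; simpl; auto.
  rewrite (taylor_vanish f (S n)) by auto; ring.
Qed.

(* The leading part h of d_dx f integrates in x to the part of the same order of
   f (x, y) - f (0, y), so it vanishes as long as its degree is less than n. *)
Lemma bigOR_dx f n : smoothR f -> bigOR (S n) f -> bigOR n (d_dx f).
Proof.
  intros hs hO.
  assert (hp : forall p, (p <= n)%nat -> bigOR p (d_dx f)); [|now apply hp].
  induction p as [|p IH]; intros hp.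
  { apply smoothR_bigOR0, smoothR_dx, hs. }
  destruct (leading_term _ p (smoothR_dx f hs) (IH ltac:(lia))) as [h [hh hr]].
  destruct (hpoly_antideriv p h hh) as [A [Ay [hA [A0 dA]]]].
  assert (hz : forall v, A v = 0).
  { apply (hpoly_zero (S p)); auto.
    assert (h1 : bigOR (S (S p)) (fun v => f v - f (0, snd v))).
    { apply (bigOR_weaken _ (S n)); [lia|]; apply bigOR_minus; auto.
      apply (bigOR_comp _ f (fun v => (0, snd v))); auto.
      apply bigO_split; split; [apply bigOR_0|exact bigOR_snd]. }
    assert (h2 : bigOR (S (S p)) (fun v => (f v - A v) - f (0, snd v))).
    { destruct hr as [K [hK hr]].
      destruct (near_box_inv _ hr) as [d1 [hd1 k1]].
      destruct (near_box_inv _ (smoothR_dlim f hs)) as [d2 [hd2 k2]].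
      exists K; split; auto.
      near (near_box d1 hd1); near (near_box d2 hd2); near_end.
      intros [x y] [b1 b2] [b3 b4]; simpl in *.
      replace (f (0, y)) with (f (0, y) - A (0, y)) by (rewrite A0; ring).
      assert (ht : forall t, Rmin x 0 <= t <= Rmax x 0 -> Rabs t <= Rabs x).
      { intros t; unfold Rmin, Rmax, Rabs; destruct (Rle_dec x 0), (Rcase_abs t), (Rcase_abs x); lra. }
      eapply Rle_trans.
      - apply (MVT_bound (fun t => f (t, y) - A (t, y)) (fun t => d_dx f (t, y) - h (t, y))
          x 0 (K * Cmod (x, y) ^ S p)).
        + intros t hht; specialize (ht t hht).
          eapply (dlim_1d_x (fun w => f w - A w)).
          apply dlim_minus; [apply k2|apply dA]; simpl; lra.
        + intros t hht; specialize (ht t hht).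
          eapply Rle_trans; [apply k1; simpl; lra|].
          apply Rmult_le_compat_l; auto; apply (pow_incr _ _ (S p)); split; [apply Cmod_ge_0|].
          unfold Cmod; simpl fst; simpl snd; apply sqrt_le_1_alt.
          apply Rplus_le_compat_r; rewrite <- (pow2_abs t), <- (pow2_abs x).
          apply pow_incr; split; auto using Rabs_pos.
      - rewrite Rminus_0_r, (Rmult_assoc K); apply Rmult_le_compat_l; auto.
        simpl; rewrite (Rmult_comm _ (Rabs x)).
        apply Rmult_le_compat_r; [apply (pow_le _ (S p)), Cmod_ge_0|].
        exact (abs_fst_le_Cmod (x, y)). }
    apply (bigOR_ext _ (fun v => (f v - f (0, snd v)) - ((f v - A v) - f (0, snd v)))).
    - near_end; intros; ring.
    - now apply bigOR_minus. }
  apply (bigOR_ext _ (fun v => d_dx f v - h v)); auto.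
  near_end; intros v.
  assert (d0 := dA v); apply (dlim_ext A (fun _ => 0)) in d0.
  - apply dlim_unique in d0; destruct d0 as [e _].
    rewrite <- e, (proj1 (dlim_unique _ _ _ _ (dlim_const 0 v))); ring.
  - apply locally_2d_forall; intros; apply hz.
Qed.

Lemma bigOR_dy f n : smoothR f -> bigOR (S n) f -> bigOR n (d_dy f).
Proof.
  intros hs hO.
  assert (hsw : bigO 1 (fun v => (snd v, fst v))).
  { apply bigO_split; split; [exact bigOR_snd|exact bigOR_fst]. }
  assert (h : bigOR n (d_dx (fun v => f (snd v, fst v)))).
  { apply bigOR_dx.
    - apply (smoothR_comp f (fun v => (snd v, fst v))); auto.
      apply smooth_iff; split; [exact smoothR_snd|exact smoothR_fst].
    - now apply (bigOR_comp _ f (fun v => (snd v, fst v))). }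
  apply (bigOR_comp n _ _ hsw) in h; revert h; apply bigOR_ext; near_end; now intros [x y].
Qed.

(** The gradient is O(|z|^n), and [box_lipschitz] is applied on a box of size comparable to
    [|v| + |w|], so that the Lipschitz constant shrinks with the two points. *)
Lemma bigOR_lipschitz f n :
  smoothR f -> bigOR (S n) f -> exists d K, 0 < d /\ 0 <= K /\
    forall v w, box d v -> box d w ->
    Rabs (f v - f w) <= K * (Cmod v + Cmod w) ^ n * Cmod (v - w)%C.
Proof.
  intros hs hO.
  destruct (bigOR_dx f n hs hO) as [K1 [hK1 h1]], (bigOR_dy f n hs hO) as [K2 [hK2 h2]].
  destruct (near_box_inv _ (near_and _ _ (near_and _ _ h1 h2) (smoothR_dlim f hs))) as [d [hd k]].
  set (K := K1 + K2).
  (* In the box of radius [d/8] the sum [s = |v| + |w|] is at most [d/2], so the box of radius [2 s]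
     stays inside the domain of the estimates. On it [|u| <= 4 s], and the factor 2 adds up the two
     coordinates. *)
  exists (d / 8), (2 * K * 4 ^ n); split; [lra|split].
  { assert (0 < 4 ^ n) by (apply pow_lt; lra); unfold K; nra. }
  intros v w hv hw.
  set (s := Cmod v + Cmod w).
  assert (hs0 : 0 <= s) by (generalize (Cmod_ge_0 v), (Cmod_ge_0 w); unfold s; lra).
  destruct (Rle_lt_or_eq_dec 0 s hs0) as [hpos|hz].
  (* If [s = 0], the open box of radius [2 s] is empty; both points are then the origin. *)
  2:{ assert (hvw := conj (Cmod_ge_0 v) (Cmod_ge_0 w)); unfold s in hz.
      assert (ev : v = RtoC 0) by (apply Cmod_eq_0; lra).
      assert (ew : w = RtoC 0) by (apply Cmod_eq_0; lra).
      rewrite ev, ew, Rminus_eq_0, Rabs_R0.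
      apply Rmult_le_pos; [|apply Cmod_ge_0].
      apply Rmult_le_pos; [|now apply pow_le].
      assert (0 < 4 ^ n) by (apply pow_lt; lra); unfold K; nra. }
  assert (hsd : 2 * s <= d).
  { destruct hv, hw; generalize (Cmod_le_abs v), (Cmod_le_abs w); unfold s; lra. }
  eapply Rle_trans.
  - apply (box_lipschitz f d (2 * s) (K * (4 * s) ^ n)); auto.
    + intros u [u1 u2]; apply k; auto.
    + intros u [u1 u2]; destruct (k u) as [[k1 k2] _]; try lra.
      assert (hu : Cmod u ^ n <= (4 * s) ^ n).
      { apply pow_incr; split; [apply Cmod_ge_0|]; generalize (Cmod_le_abs u); lra. }
      assert (0 <= Cmod u ^ n) by (apply pow_le, Cmod_ge_0).
      unfold K; split; nra.
    + generalize (abs_fst_le_Cmod v), (abs_snd_le_Cmod v), (Cmod_ge_0 w); unfold s in *; split; lra.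
    + generalize (abs_fst_le_Cmod w), (abs_snd_le_Cmod w), (Cmod_ge_0 v); unfold s in *; split; lra.
  - rewrite Rpow_mult_distr.
    generalize (abs_fst_le_Cmod (v - w)%C), (abs_snd_le_Cmod (v - w)%C); simpl; intros a1 a2.
    assert (0 <= K * (4 ^ n * s ^ n)).
    { apply Rmult_le_pos; [unfold K; lra|]; apply Rmult_le_pos; apply pow_le; lra. }
    replace (2 * K * 4 ^ n * s ^ n * Cmod (v - w)%C) with
      (K * (4 ^ n * s ^ n) * (2 * Cmod (v - w)%C)) by ring.
    apply Rmult_le_compat_l; auto; unfold Rminus; lra.
Qed.

(** Controls the compositions below: as the gradient of [f] has order n, a correction of order m to
    the argument is felt only at order n + m, so substitutions can be undone inside terms of higher
    order. *)
Lemma bigOR_diff_comp f n m F G :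
  smoothR f -> bigOR (S n) f -> bigO 1 F -> bigO 1 G -> bigO m (fun z => F z - G z)%C ->
  bigOR (n + m) (fun z => f (F z) - f (G z)).
Proof.
  intros hs hO hF hG [K3 [hK3 h3]].
  destruct (bigOR_lipschitz f n hs hO) as [d [K [hd [hK hl]]]].
  assert (tF := bigO1_tends0 F hF); assert (tG := bigO1_tends0 G hG).
  destruct hF as [K1 [hK1 h1]], hG as [K2 [hK2 h2]].
  exists (K * (K1 + K2) ^ n * K3); split.
  { repeat apply Rmult_le_pos; auto; apply pow_le; lra. }
  near (near_comp _ _ tF (near_box d hd)); near (near_comp _ _ tG (near_box d hd)).
  near h1; near h2; near h3; near_end; intros z k3 k2 k1 bG bF.
  eapply Rle_trans; [now apply hl|].
  rewrite pow_1 in k1, k2; rewrite pow_add.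
  replace (K * (K1 + K2) ^ n * K3 * (Cmod z ^ n * Cmod z ^ m)) with
    (K * ((K1 + K2) ^ n * Cmod z ^ n) * (K3 * Cmod z ^ m)) by ring.
  apply Rmult_le_compat; auto using Cmod_ge_0.
  - apply Rmult_le_pos; auto; apply pow_le.
    generalize (Cmod_ge_0 (F z)), (Cmod_ge_0 (G z)); lra.
  - apply Rmult_le_compat_l; auto; rewrite <- Rpow_mult_distr; apply pow_incr.
    generalize (Cmod_ge_0 (F z)), (Cmod_ge_0 (G z)); lra.
Qed.

Lemma bigO_diff_comp H n m F G :
  smooth_near_O H -> bigO (S n) H -> bigO 1 F -> bigO 1 G -> bigO m (fun z => F z - G z)%C ->
  bigO (n + m) (fun z => H (F z) - H (G z))%C.
Proof.
  intros hs hH hF hG hd; apply smooth_iff in hs; destruct hs as [s1 s2].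
  apply bigO_split in hH; destruct hH as [h1 h2].
  apply bigO_split; split.
  - exact (bigOR_diff_comp _ n m F G s1 h1 hF hG hd).
  - exact (bigOR_diff_comp _ n m F G s2 h2 hF hG hd).
Qed.

(** * Area-preserving maps with a generating function *)

Definition locinv (F G : R * R -> R * R) : Prop :=
  smooth_near_O F /\ smooth_near_O G /\ F (0, 0) = (0, 0) /\ G (0, 0) = (0, 0) /\
  near_O (fun v => G (F v) = v) /\ near_O (fun v => F (G v) = v).

Lemma locinv_sym F G : locinv F G -> locinv G F.
Proof. unfold locinv; tauto. Qed.

Lemma locinv_comp F G F' G' :
  locinv F G -> locinv F' G' -> locinv (fun v => F' (F v)) (fun v => G (G' v)).
Proof.
  intros (h1 & h2 & h3 & h4 & h5 & h6) (k1 & k2 & k3 & k4 & k5 & k6).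
  split; [now apply smooth_comp|split; [now apply smooth_comp|]].
  split; [now rewrite h3|split; [now rewrite k4|split]].
  - near h5; near (near_comp F _ (smooth_tends0 F h1 h3) k5); near_end.
    intros v e1 e2; now rewrite e1.
  - near k6; near (near_comp G' _ (smooth_tends0 G' k2 k4) h6); near_end.
    intros v e1 e2; now rewrite e1.
Qed.

(** Equivariance of germs. [a] and [b] may differ, so that [swap] in the plane can correspond to
    [Cconj] in the coordinate. *)
Definition intertwines (F a b : R * R -> R * R) : Prop := near_O (fun v => F (a v) = b (F v)).

Lemma intertwines_comp F G a b c :
  tends0 F -> intertwines F a b -> intertwines G b c -> intertwines (fun v => G (F v)) a c.
Proof.
  intros hF h k; red in h, k; near h; near (near_comp F _ hF k); near_end.
  intros v e1 e2; now rewrite e2.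
Qed.

Lemma intertwines_inv F G a b :
  locinv F G -> tends0 a -> intertwines F a b -> intertwines G b a.
Proof.
  intros (h1 & h2 & h3 & h4 & h5 & h6) ha h.
  assert (tF := smooth_tends0 F h1 h3); assert (tG := smooth_tends0 G h2 h4).
  red in h; near (near_comp G _ tG h); near h6.
  near (near_comp (fun v => a (G v)) _ (tends0_comp _ _ ha tG) h5).
  near_end; intros v e1 e2 e3; rewrite <- e2 at 1; rewrite <- e3, e1; reflexivity.
Qed.

Definition cneg (v : R * R) : R * R := (- fst v, - snd v).

Lemma tends0_cneg : tends0 cneg.
Proof.
  intros d hd; near (near_ball d hd); near_end; intros v.
  replace (cneg v) with (- v)%C by (now destruct v); now rewrite Cmod_opp.
Qed.

Lemma tends0_conj : tends0 Cconj.
Proof.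
  intros d hd; near (near_ball d hd); near_end; intros v; now rewrite Cmod_conj.
Qed.

Lemma smoothR_schwarz f : smoothR f -> near_O (fun v => d_dy (d_dx f) v = d_dx (d_dy f) v).
Proof.
  unfold smoothR; intros h; near (near_around _ h); near_end; intros [x y] hv.
  symmetry; change (Derive (fun z => Derive (fun t => f (z, t)) y) x =
    Derive (fun z => Derive (fun t => f (t, z)) x) y).
  apply (Schwarz (fun x y => f (x, y)) x y).
  - revert hv; apply locally_2d_impl, locally_2d_forall; intros a b hv; simpl in hv.
    destruct (hv 2%nat) as (_ & h1 & h2 & (_ & _ & h3 & _) & (_ & h4 & _)); auto.
  - generalize (locally_2d_singleton _ _ _ hv); intros k.
    destruct (k 2%nat) as (_ & _ & _ & _ & (_ & _ & _ & (h3 & _) & _)); exact h3.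
  - generalize (locally_2d_singleton _ _ _ hv); intros k.
    destruct (k 2%nat) as (_ & _ & _ & (_ & _ & _ & _ & (h3 & _)) & _); exact h3.
Qed.

Lemma smoothR_pair F G : smoothR F -> smoothR G -> smooth_near_O (fun v => (F v, G v)).
Proof. intros; now apply smooth_iff. Qed.

Lemma bigOR_at0 n f : bigOR (S n) f -> f (0, 0) = 0.
Proof.
  intros [K [_ h]]; generalize (near_at0 _ h); simpl.
  change (0, 0) with (RtoC 0); rewrite Cmod_0, Rmult_0_l, Rmult_0_r.
  intros k; apply Rabs_eq_0, Rle_antisym; auto using Rabs_pos.
Qed.

Lemma vanish_deriv f : smoothR f -> bigOR 2 f -> d_dx f (0, 0) = 0 /\ d_dy f (0, 0) = 0.
Proof. intros hs h; split; apply (bigOR_at0 0); [now apply bigOR_dx|now apply bigOR_dy]. Qed.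

Lemma smoothR_bigOR1 f : smoothR f -> f (0, 0) = 0 -> bigOR 1 f.
Proof.
  intros hs f0; destruct (leading_term f 0 hs (smoothR_bigOR0 f hs)) as [h [hh hr]].
  assert (h0 : forall v, h v = 0).
  { intros v; assert (e := hpoly_homog 0 h 0 v hh); simpl in e; rewrite !Rmult_0_l in e.
    generalize (bigOR_at0 _ _ hr); lra. }
  revert hr; apply bigOR_ext; near_end; intros; rewrite h0; ring.
Qed.

Lemma smooth_bigO1 F : smooth_near_O F -> F (0, 0) = (0, 0) -> bigO 1 F.
Proof.
  intros h h0; apply smooth_iff in h; destruct h; apply bigO_split.
  split; apply smoothR_bigOR1; auto; now rewrite h0.
Qed.

Lemma shear_y_locinv T :
  smoothR T -> bigOR 2 T -> exists G, locinv (fun v => (fst v, snd v + T v)) G.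
Proof.
  intros hT hO; destruct (vanish_deriv T hT hO) as [hx hy].
  assert (h0 := bigOR_at0 _ _ hO).
  destruct (implicit_function T hT h0 hx hy) as [g [hg [g0 [h1 h2]]]].
  exists (fun v => (fst v, g v)); split; [|split; [|split; [|split; [|split]]]].
  - apply smoothR_pair; [exact smoothR_fst|]; apply smoothR_plus; auto using smoothR_snd.
  - apply smoothR_pair; auto using smoothR_fst.
  - simpl; rewrite h0; f_equal; ring.
  - simpl; now rewrite g0.
  - near h2; near_end; intros [x y] e; simpl in *; now rewrite e.
  - near h1; near_end; intros [x y] e; simpl in *; now rewrite e.
Qed.

Definition swap (v : R * R) : R * R := (snd v, fst v).

Lemma smooth_swap : smooth_near_O swap.
Proof. apply smoothR_pair; auto using smoothR_fst, smoothR_snd. Qed.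

Lemma locinv_swap : locinv swap swap.
Proof.
  repeat split; auto using smooth_swap; near_end; now intros [x y].
Qed.

Lemma bigO_swap : bigO 1 swap.
Proof. apply bigO_split; split; [exact bigOR_snd|exact bigOR_fst]. Qed.

Lemma locinv_ext F F' G : (forall v, F v = F' v) -> locinv F G -> locinv F' G.
Proof.
  intros e (h1 & h2 & h3 & h4 & h5 & h6); split; [|split; [|split; [|split; [|split]]]]; auto.
  - apply smooth_iff in h1; destruct h1; apply smooth_iff; split;
      [apply (smoothR_ext (fun v => fst (F v)))|apply (smoothR_ext (fun v => snd (F v)))]; auto;
      near_end; intros; now rewrite e.
  - now rewrite <- e.
  - near h5; near_end; intros v; now rewrite e.
  - near h6; near_end; intros v; now rewrite e.
Qed.

Lemma shear_x_locinv T :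
  smoothR T -> bigOR 2 T -> exists G, locinv (fun v => (fst v + T v, snd v)) G.
Proof.
  intros hT hO; destruct (shear_y_locinv (fun v => T (swap v))) as [G hG].
  - apply smoothR_comp; auto using smooth_swap.
  - apply bigOR_comp; auto using bigO_swap.
  - exists (fun v => swap (G (swap v))).
    assert (h := locinv_comp _ _ _ _ locinv_swap (locinv_comp _ _ _ _ hG locinv_swap)).
    revert h; apply locinv_ext; intros [x y]; reflexivity.
Qed.


Lemma jac_det_id v : jac_det (fun w => w) v = 1.
Proof.
  destruct (dlim_unique _ _ _ _ (dlim_fst v)) as [e1 e2].
  destruct (dlim_unique _ _ _ _ (dlim_snd v)) as [e3 e4].
  unfold jac_det; change (fun w : R * R => fst w) with (@fst R R).
  change (fun w : R * R => snd w) with (@snd R R).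
  rewrite e1, e2, e3, e4; ring.
Qed.

Lemma jac_det_inv F G :
  locinv F G -> near_O (fun v => jac_det F v = 1) -> near_O (fun v => jac_det G v = 1).
Proof.
  intros (h1 & h2 & h3 & h4 & h5 & h6) hj.
  assert (tF := smooth_tends0 F h1 h3); assert (tG := smooth_tends0 G h2 h4).
  near (near_comp G _ tG hj); near (jac_det_comp F G h1 h2 h4).
  near (jac_det_ext _ _ h6 (smooth_comp F G h1 h2 h4)).
  near_end; intros v; rewrite jac_det_id; intros -> e1 e2; rewrite e2 in e1; lra.
Qed.

(* phi maps P(u, V) to Q(u, V), and the Jacobians of P and Q are both 1 + Hm_uV. *)
Lemma generating_function_map k Hm :
  (3 <= k)%nat -> hpoly (k + 1) Hm -> (forall v, Hm (fst v, - snd v) = - Hm v) ->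
  (forall v, Hm (cneg v) = Hm v) ->
  exists phi psi, locinv phi psi /\
    near_O (fun v => jac_det phi v = 1) /\ near_O (fun v => jac_det psi v = 1) /\
    intertwines phi Cconj Cconj /\ intertwines phi cneg cneg /\
    bigO (k + 2) (fun z => phi z - z - (d_dy Hm z, (- d_dx Hm z)%R))%C.
Proof.
  intros hk hS hodd heven.
  rewrite Nat.add_1_r in hS; destruct (hpoly_deriv k Hm hS) as (Sx & Sy & hx & hy & _ & hd).
  assert (ex : forall v, d_dx Hm v = Sx v) by (intros v; apply (dlim_unique _ _ _ _ (hd v))).
  assert (ey : forall v, d_dy Hm v = Sy v) by (intros v; apply (dlim_unique _ _ _ _ (hd v))).
  assert (sx := hpoly_smoothR _ _ hx); assert (sy := hpoly_smoothR _ _ hy).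
  assert (ox := hpoly_bigOR _ _ hx); assert (oy := hpoly_bigOR _ _ hy).
  assert (oS := hpoly_bigOR _ _ hS); assert (sS := hpoly_smoothR _ _ hS).
  (* The symmetries of the partials come from differentiating those of [Hm]; they make the two
     shears, hence [phi], equivariant. *)
  assert (symc : forall v, Sx (fst v, - snd v) = - Sx v /\ Sy (fst v, - snd v) = Sy v).
  { intros v.
    assert (h1 := dlim_comp Hm (fun w => (fst w, - snd w)) v _ _ _ _ _ _ (hd _)
      (dlim_fst v) (dlim_opp _ _ _ _ (dlim_snd v))).
    apply (dlim_ext _ (fun w => - Hm w)) in h1; [|apply locally_2d_forall; intros; apply hodd].
    destruct (dlim_unique _ _ _ _ h1) as [a1 b1].
    destruct (dlim_unique _ _ _ _ (dlim_opp _ _ _ _ (hd v))) as [a2 b2].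
    rewrite a2 in a1; rewrite b2 in b1; split; lra. }
  assert (symn : forall v, Sx (cneg v) = - Sx v /\ Sy (cneg v) = - Sy v).
  { intros v.
    assert (h1 := dlim_comp Hm cneg v _ _ _ _ _ _ (hd _)
      (dlim_opp _ _ _ _ (dlim_fst v)) (dlim_opp _ _ _ _ (dlim_snd v))).
    apply (dlim_ext _ Hm) in h1; [|apply locally_2d_forall; intros; apply heven].
    destruct (dlim_unique _ _ _ _ h1) as [a1 b1].
    destruct (dlim_unique _ _ _ _ (hd v)) as [a2 b2].
    rewrite a2 in a1; rewrite b2 in b1; split; lra. }
  set (P := fun v => (fst v, snd v + Sx v)).
  set (Q := fun v => (fst v + Sy v, snd v)).
  destruct (shear_y_locinv Sx sx (bigOR_weaken 2 k _ ltac:(lia) ox)) as [P' hP].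
  destruct (shear_x_locinv Sy sy (bigOR_weaken 2 k _ ltac:(lia) oy)) as [Q' hQ].
  fold P in hP; fold Q in hQ.
  assert (hphi := locinv_comp _ _ _ _ (locinv_sym _ _ hP) hQ).
  assert (jP : near_O (fun v => jac_det P v = jac_det Q v /\ jac_det P v <> 0)).
  { near (smoothR_schwarz Hm sS); near (smoothR_dlim _ sx); near (smoothR_dlim _ sy).
    near (d_ext (d_dx Hm) Sx ltac:(near_end; auto) (smoothR_dx Hm sS)).
    near (d_ext (d_dy Hm) Sy ltac:(near_end; auto) (smoothR_dy Hm sS)).
    near (smoothR_cont _ (smoothR_dy _ sx) (/ 2) ltac:(lra)).
    near_end; intros v hc [e1 _] [_ e2] dy dx e.
    destruct (vanish_deriv Sx sx (bigOR_weaken 2 k _ ltac:(lia) ox)) as [_ e0].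
    rewrite e0, Rminus_0_r in hc; apply Rabs_lt_between in hc.
    destruct (dlim_unique _ _ _ _ (dlim_plus _ _ _ _ _ _ _ (dlim_snd v) dx)) as [p1 p2].
    destruct (dlim_unique _ _ _ _ (dlim_plus _ _ _ _ _ _ _ (dlim_fst v) dy)) as [q1 q2].
    destruct (dlim_unique _ _ _ _ (dlim_fst v)) as [f1 f2].
    destruct (dlim_unique _ _ _ _ (dlim_snd v)) as [f3 f4].
    unfold jac_det, P, Q; simpl fst; simpl snd.
    change (fun w : R * R => fst w) with (@fst R R).
    change (fun w : R * R => snd w) with (@snd R R).
    rewrite p1, p2, q1, q2, f1, f2, f3, f4; split; [|lra].
    rewrite <- e1, <- e2, e; ring. }
  assert (jphi : near_O (fun v => jac_det (fun w => Q (P' w)) v = 1)).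
  { destruct hP as (P1 & P2 & P3 & P4 & P5 & P6), hQ as (Q1 & _).
    assert (tP := smooth_tends0 P P1 P3); assert (tP' := smooth_tends0 P' P2 P4).
    assert (s1 := smooth_comp Q P' Q1 P2 P4).
    (* Since [Q (P' (P v)) = Q v], the Jacobian of the composite at [P v] is the quotient of those
       of [Q] and [P], which is 1; every point near the origin is of the form [P v]. *)
    assert (hh : near_O (fun v => jac_det (fun w => Q (P' w)) (P v) = 1)).
    { near (jac_det_comp _ P s1 P1 P3); near jP.
      assert (hn : near_O (fun v => Q (P' (P v)) = Q v)) by (near P5; near_end; now intros v ->).
      near (jac_det_ext _ _ hn (smooth_comp _ P s1 P1 P3)).
      near_end; intros v e1 [e2 e3] e4; rewrite e1, <- e2 in e4.
      apply (Rmult_eq_reg_r (jac_det P v)); auto; lra. }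
    near (near_comp _ _ tP' hh); near P6; near_end; intros v e1 e2; now rewrite e1 in e2. }
  exists (fun v => Q (P' v)), (fun v => P (Q' v)); split; [exact hphi|split; [exact jphi|]].
  split; [exact (jac_det_inv _ _ hphi jphi)|].
  assert (tP' : tends0 P') by (apply smooth_tends0; apply hP).
  split; [|split].
  - apply (intertwines_comp P' Q Cconj Cconj Cconj tP').
    + apply (intertwines_inv P P'); auto using tends0_conj.
      red; near_end; intros [x y]; unfold P, Cconj; simpl.
      generalize (proj1 (symc (x, y))); simpl; intros ->; f_equal; ring.
    + red; near_end; intros [x y]; unfold Q, Cconj; simpl.
      generalize (proj2 (symc (x, y))); simpl; now intros ->.
  - apply (intertwines_comp P' Q cneg cneg cneg tP').
    + apply (intertwines_inv P P'); auto using tends0_cneg.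
      red; near_end; intros v; unfold P. rewrite (proj1 (symn v)); unfold cneg; simpl; f_equal; ring.
    + red; near_end; intros v; unfold Q. rewrite (proj2 (symn v)); unfold cneg; simpl; f_equal; ring.
  - destruct hP as (P1 & P2 & P3 & P4 & P5 & P6).
    assert (oP' := smooth_bigO1 P' P2 P4).
    set (Y := fun z => (Sy z, - Sx z)).
    assert (sY : smooth_near_O Y) by (apply smoothR_pair; auto using smoothR_opp).
    assert (oY : bigO k Y) by (apply bigO_split; split; simpl; auto using bigOR_opp).
    assert (hd1 : bigO k (fun z => P' z - z)%C).
    { apply (bigO_ext _ (fun z => (0, - Sx (P' z)))).
      - near P6; near_end; intros z e; rewrite <- e at 3; unfold P.
        destruct (P' z) as [a b]; unfold Cminus, Copp, Cplus; simpl; f_equal; ring.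
      - apply bigO_split; split; simpl; [apply bigOR_0|]; apply bigOR_opp, bigOR_comp; auto. }
    (* With [w = P' z] one has exactly [phi z - z = Q w - P w = Y w]. The error is thus a change of
       argument inside [Y], of order (k - 1) + k, which is at least k + 2 because k >= 3. *)
    apply (bigO_ext _ (fun z => Y (P' z) - Y z)%C).
    + near P6; near_end; intros z e; rewrite ex, ey.
      assert (e1 : fst z = fst (P' z)) by now rewrite <- e at 1.
      assert (e2 : snd z = snd (P' z) + Sx (P' z)) by now rewrite <- e at 1.
      unfold Y, Q; apply injective_projections; simpl; [rewrite e1|rewrite e2]; ring.
    + apply (bigO_weaken _ ((k - 1) + k)); [lia|].
      apply bigO_diff_comp; auto using bigO_id.
      now replace (S (k - 1)) with k by lia.
Qed.

(** * Homogeneous polynomial maps and the homological equation *)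

Definition hfield (n : nat) (X : C -> C) : Prop :=
  hpoly n (fun z => fst (X z)) /\ hpoly n (fun z => snd (X z)).

(** The same maps as [hfield], in the basis [z^a conj(z)^b]: real components serve derivatives and
    estimates, while this basis diagonalises rotations. *)
Inductive zpoly (n : nat) : (C -> C) -> Prop :=
| zpoly_mono a b c : (a + b = n)%nat -> zpoly n (fun z => c * Cpow z a * Cpow (Cconj z) b)%C
| zpoly_plus f g : zpoly n f -> zpoly n g -> zpoly n (fun z => f z + g z)%C
| zpoly_ext f g : (forall z, f z = g z) -> zpoly n f -> zpoly n g.

Lemma zpoly_scal n c f : zpoly n f -> zpoly n (fun z => c * f z)%C.
Proof.
  intros h; induction h as [a b k e|f g _ IH1 _ IH2|f g e _ IH].
  - apply (zpoly_ext n (fun z => c * k * Cpow z a * Cpow (Cconj z) b)%C); [intros; ring|].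
    now apply zpoly_mono.
  - apply (zpoly_ext n (fun z => c * f z + c * g z)%C); [intros; ring|now apply zpoly_plus].
  - apply (zpoly_ext n (fun z => c * f z)%C); [intros; now rewrite e|auto].
Qed.

Lemma zpoly_mul_id n f : zpoly n f -> zpoly (S n) (fun z => z * f z)%C.
Proof.
  intros h; induction h as [a b c e|f g _ IH1 _ IH2|f g e _ IH].
  - apply (zpoly_ext _ (fun z => c * Cpow z (S a) * Cpow (Cconj z) b)%C).
    + intros; rewrite Cpow_S; ring.
    + apply zpoly_mono; lia.
  - apply (zpoly_ext _ (fun z => z * f z + z * g z)%C); [intros; ring|now apply zpoly_plus].
  - apply (zpoly_ext _ (fun z => z * f z)%C); [intros; now rewrite e|auto].
Qed.

Lemma zpoly_mul_conj n f : zpoly n f -> zpoly (S n) (fun z => Cconj z * f z)%C.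
Proof.
  intros h; induction h as [a b c e|f g _ IH1 _ IH2|f g e _ IH].
  - apply (zpoly_ext _ (fun z => c * Cpow z a * Cpow (Cconj z) (S b))%C).
    + intros; rewrite Cpow_S; ring.
    + apply zpoly_mono; lia.
  - apply (zpoly_ext _ (fun z => Cconj z * f z + Cconj z * g z)%C); [intros; ring|now apply zpoly_plus].
  - apply (zpoly_ext _ (fun z => Cconj z * f z)%C); [intros; now rewrite e|auto].
Qed.

Lemma zpoly_mul_fst n f : zpoly n f -> zpoly (S n) (fun z => RtoC (fst z) * f z)%C.
Proof.
  intros h.
  apply (zpoly_ext _ (fun z => RtoC (/ 2) * (z * f z) + RtoC (/ 2) * (Cconj z * f z))%C).
  - intros [x y]; transitivity (RtoC (/ 2) * ((x, y) + Cconj (x, y)) * f (x, y))%C; [ring|].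
    f_equal; unfold Cconj, Cplus, Cmult, RtoC; simpl; f_equal; field.
  - apply zpoly_plus; apply zpoly_scal; auto using zpoly_mul_id, zpoly_mul_conj.
Qed.

Lemma zpoly_mul_snd n f : zpoly n f -> zpoly (S n) (fun z => RtoC (snd z) * f z)%C.
Proof.
  intros h.
  (* This is [y = -(i/2) z + (i/2) conj(z)]. *)
  apply (zpoly_ext _ (fun z => (0, - / 2)%R * (z * f z) + (0, / 2)%R * (Cconj z * f z))%C).
  - intros [x y].
    transitivity (((0, - / 2)%R * (x, y) + (0, / 2)%R * Cconj (x, y)) * f (x, y))%C; [ring|].
    f_equal; unfold Cconj, Cplus, Cmult, RtoC; simpl; f_equal; field.
  - apply zpoly_plus; apply zpoly_scal; auto using zpoly_mul_id, zpoly_mul_conj.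
Qed.

Lemma zpoly_hpoly n f : hpoly n f -> zpoly n (fun z => RtoC (f z)).
Proof.
  intros h; induction h as [a b c <-|f g _ IH1 _ IH2|f g e _ IH].
  - apply (zpoly_ext _ (fun z => RtoC c * (RtoC (fst z) ^ a * RtoC (snd z) ^ b))%C).
    { intros z; rewrite !RtoC_mult, !RtoC_pow; ring. }
    apply zpoly_scal; induction a as [|a IH]; simpl.
    + induction b as [|b IH]; simpl.
      * apply (zpoly_ext 0 (fun z => 1 * Cpow z 0 * Cpow (Cconj z) 0)%C); [intros; simpl; ring|].
        now apply zpoly_mono.
      * apply (zpoly_ext _ (fun z => RtoC (snd z) * (1 * RtoC (snd z) ^ b))%C); [intros; ring|].
        apply zpoly_mul_snd; auto.
    + apply (zpoly_ext _ (fun z => RtoC (fst z) * (RtoC (fst z) ^ a * RtoC (snd z) ^ b))%C);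
        [intros; ring|].
      apply zpoly_mul_fst; auto.
  - apply (zpoly_ext _ (fun z => RtoC (f z) + RtoC (g z))%C); [intros; now rewrite RtoC_plus|].
    now apply zpoly_plus.
  - apply (zpoly_ext _ (fun z => RtoC (f z))); [intros; now rewrite e|auto].
Qed.

Lemma hfield_zpoly n X : hfield n X -> zpoly n X.
Proof.
  intros [h1 h2].
  apply (zpoly_ext _ (fun z => RtoC (fst (X z)) + Ci * RtoC (snd (X z)))%C).
  - intros z; destruct (X z) as [a b]; unfold RtoC, Cplus, Cmult, Ci; simpl; f_equal; ring.
  - apply zpoly_plus; [|apply zpoly_scal]; now apply zpoly_hpoly.
Qed.

Lemma hpoly_mul_fst n f : hpoly n f -> hpoly (S n) (fun v => fst v * f v).
Proof.
  intros h; induction h as [a b c e|f g _ IH1 _ IH2|f g e _ IH].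
  - apply (hpoly_ext _ (fun v => c * fst v ^ S a * snd v ^ b)); [intros; simpl; ring|].
    apply hpoly_mono; lia.
  - apply (hpoly_ext _ (fun v => fst v * f v + fst v * g v)); [intros; ring|now apply hpoly_plus].
  - apply (hpoly_ext _ (fun v => fst v * f v)); [intros; now rewrite e|auto].
Qed.

Lemma hpoly_mul_snd n f : hpoly n f -> hpoly (S n) (fun v => snd v * f v).
Proof.
  intros h; induction h as [a b c e|f g _ IH1 _ IH2|f g e _ IH].
  - apply (hpoly_ext _ (fun v => c * fst v ^ a * snd v ^ S b)); [intros; simpl; ring|].
    apply hpoly_mono; lia.
  - apply (hpoly_ext _ (fun v => snd v * f v + snd v * g v)); [intros; ring|now apply hpoly_plus].
  - apply (hpoly_ext _ (fun v => snd v * f v)); [intros; now rewrite e|auto].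
Qed.

Lemma hpoly_lin n f g a b : hpoly n f -> hpoly n g -> hpoly n (fun v => a * f v + b * g v).
Proof. intros; apply hpoly_plus; now apply hpoly_const_scal. Qed.

Lemma hfield_ext n X Y : (forall z, X z = Y z) -> hfield n X -> hfield n Y.
Proof.
  intros e [h1 h2]; split; [eapply hpoly_ext; [|exact h1]|eapply hpoly_ext; [|exact h2]];
    intros z; cbv beta; now rewrite e.
Qed.

Lemma hfield_plus n X Y : hfield n X -> hfield n Y -> hfield n (fun z => X z + Y z)%C.
Proof. intros [h1 h2] [k1 k2]; split; simpl; now apply hpoly_plus. Qed.

Lemma hfield_scal n c X : hfield n X -> hfield n (fun z => c * X z)%C.
Proof.
  intros [h1 h2]; split; simpl.
  - apply (hpoly_ext _ (fun z => fst c * fst (X z) + (- snd c) * snd (X z))); [intros; ring|].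
    now apply hpoly_lin.
  - now apply hpoly_lin.
Qed.

Lemma hfield_minus n X Y : hfield n X -> hfield n Y -> hfield n (fun z => X z - Y z)%C.
Proof.
  intros hX hY; apply (hfield_ext _ (fun z => X z + (- (1)) * Y z)%C); [intros; ring|].
  apply hfield_plus; auto using hfield_scal.
Qed.

Lemma hfield_mul_id n X : hfield n X -> hfield (S n) (fun z => z * X z)%C.
Proof.
  intros [h1 h2]; split; simpl.
  - apply (hpoly_ext _ (fun z => 1 * (fst z * fst (X z)) + (-1) * (snd z * snd (X z))));
      [intros; ring|]; apply hpoly_lin; auto using hpoly_mul_fst, hpoly_mul_snd.
  - apply hpoly_plus; auto using hpoly_mul_fst, hpoly_mul_snd.
Qed.

Lemma hfield_mul_conj n X : hfield n X -> hfield (S n) (fun z => Cconj z * X z)%C.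
Proof.
  intros [h1 h2]; split; simpl.
  - apply (hpoly_ext _ (fun z => fst z * fst (X z) + snd z * snd (X z)));
      [intros; ring|]; apply hpoly_plus; auto using hpoly_mul_fst, hpoly_mul_snd.
  - apply (hpoly_ext _ (fun z => 1 * (fst z * snd (X z)) + (-1) * (snd z * fst (X z))));
      [intros; ring|]; apply hpoly_lin; auto using hpoly_mul_fst, hpoly_mul_snd.
Qed.

Lemma hfield_const c : hfield 0 (fun _ => c).
Proof.
  split; simpl;
    [apply (hpoly_ext _ (fun z => fst c * fst z ^ 0 * snd z ^ 0))
    |apply (hpoly_ext _ (fun z => snd c * fst z ^ 0 * snd z ^ 0))];
    try (intros; simpl; ring); now apply hpoly_mono.
Qed.

Lemma zpoly_hfield n f : zpoly n f -> hfield n f.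
Proof.
  intros h; induction h as [a b c <-|f g _ IH1 _ IH2|f g e _ IH].
  - apply (hfield_ext _ (fun z => c * (Cpow z a * Cpow (Cconj z) b))%C); [intros; ring|].
    apply hfield_scal; induction a as [|a IH]; simpl.
    + induction b as [|b IH]; simpl.
      * apply (hfield_ext _ (fun _ => RtoC 1)); [intros; ring|apply hfield_const].
      * apply (hfield_ext _ (fun z => Cconj z * (1 * Cpow (Cconj z) b))%C); [intros; ring|].
        now apply hfield_mul_conj.
    + apply (hfield_ext _ (fun z => z * (Cpow z a * Cpow (Cconj z) b))%C); [intros; ring|].
      now apply hfield_mul_id.
  - now apply hfield_plus.
  - now apply (hfield_ext _ f).
Qed.

Lemma hfield_comp_rot n e X : hfield n X -> hfield n (fun z => X (e * z)%C).
Proof.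
  intros hX; apply hfield_zpoly in hX; apply zpoly_hfield.
  induction hX as [a b c h|f g _ IH1 _ IH2|f g h _ IH].
  - apply (zpoly_ext _ (fun z => c * Cpow e a * Cpow (Cconj e) b * Cpow z a * Cpow (Cconj z) b)%C).
    + intros z; rewrite Cmult_conj, !Cpow_mult_l; ring.
    + now apply zpoly_mono.
  - apply (zpoly_plus _ (fun z => f (e * z)%C) (fun z => g (e * z)%C)); auto.
  - apply (zpoly_ext _ (fun z => f (e * z)%C)); auto.
Qed.

Lemma hfield_reflect n X : hfield n X -> hfield n (fun z => Cconj (X (Cconj z))).
Proof.
  intros hX; apply hfield_zpoly in hX; apply zpoly_hfield.
  induction hX as [a b c h|f g _ IH1 _ IH2|f g h _ IH].
  - apply (zpoly_ext _ (fun z => Cconj c * Cpow z a * Cpow (Cconj z) b)%C).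
    + intros z; rewrite !Cmult_conj, !Cpow_conj, !Cconj_conj; ring.
    + now apply zpoly_mono.
  - apply (zpoly_ext _ (fun z => Cconj (f (Cconj z)) + Cconj (g (Cconj z)))%C).
    + intros z; now rewrite Cplus_conj.
    + now apply zpoly_plus.
  - apply (zpoly_ext _ (fun z => Cconj (f (Cconj z)))); auto; intros; now rewrite h.
Qed.

Lemma hfield_smooth n X : hfield n X -> smooth_near_O X.
Proof. intros [h1 h2]; apply smooth_iff; split; eapply hpoly_smoothR; eauto. Qed.

Lemma hfield_bigO n X : hfield n X -> bigO n X.
Proof. intros [h1 h2]; apply bigO_split; split; now apply hpoly_bigOR. Qed.

Lemma hfield_zero n X : hfield n X -> bigO (S n) X -> forall z, X z = RtoC 0.
Proof.
  intros [h1 h2] h z; apply bigO_split in h; destruct h as [k1 k2].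
  apply injective_projections; simpl; [apply (hpoly_zero n _ h1 k1)|apply (hpoly_zero n _ h2 k2)].
Qed.

(** * Roots of unity, resonances and the homological operator *)

Lemma expi_pow t k : Cpow (expi t) k = expi (INR k * t).
Proof.
  induction k as [|k IH].
  - simpl; unfold expi; rewrite Rmult_0_l, cos_0, sin_0; reflexivity.
  - rewrite Cpow_S, IH, S_INR, Rmult_plus_distr_r, Rmult_1_l, Rplus_comm.
    unfold expi, Cmult; simpl; rewrite cos_plus, sin_plus; f_equal; ring.
Qed.

Lemma expi_conj t : (Cconj (expi t) * expi t)%C = RtoC 1.
Proof.
  unfold expi, Cconj, Cmult, RtoC; simpl; generalize (sin2_cos2 t); unfold Rsqr; intros h.
  f_equal; lra.
Qed.

Lemma expi_res_pow_q p q : (0 < q)%nat -> Cpow (expi (res_angle p q)) q = RtoC 1.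
Proof.
  intros hq; rewrite expi_pow; unfold res_angle.
  replace (INR q * (2 * PI * INR p / INR q)) with (0 + 2 * INR p * PI)
    by (field; apply not_0_INR; lia).
  unfold expi; now rewrite cos_period, sin_period, cos_0, sin_0.
Qed.

(** [r] is a primitive q-th root of unity: [cos t = 1] forces [sin (t / 2) = 0], so [t / 2 = j pi],
    that is [k p = j q], and [q] divides [k] because it is coprime to [p]. *)
Lemma expi_res_pow_1 p q k :
  (0 < q)%nat -> Nat.gcd p q = 1%nat -> Cpow (expi (res_angle p q)) k = RtoC 1 -> Nat.divide q k.
Proof.
  intros hq hg; rewrite expi_pow; unfold expi; intros h; injection h as hc _.
  set (t := INR k * res_angle p q) in *.
  assert (hs : sin (t / 2) = 0).
  { replace t with (2 * (t / 2)) in hc by field; rewrite cos_2a_sin in hc; nra. }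
  destruct (sin_eq_0_0 _ hs) as [j hj].
  assert (e : INR (k * p) = IZR j * INR q).
  { assert (hq0 : INR q <> 0) by (apply not_0_INR; lia).
    apply (Rmult_eq_reg_r PI); [|apply PI_neq0].
    rewrite mult_INR; replace (INR k * INR p * PI) with (t / 2 * INR q).
    - rewrite hj; ring.
    - unfold t, res_angle; field; auto. }
  rewrite !INR_IZR_INZ, <- mult_IZR in e; apply eq_IZR in e.
  rewrite Nat.gcd_comm in hg.
  apply (Nat.gauss q p k); [|exact hg].
  exists (Z.to_nat j); apply Nat2Z.inj.
  rewrite !Nat2Z.inj_mul in *.
  assert (0 <= j)%Z by nia.
  rewrite Z2Nat.id; lia.
Qed.

(** Oddness of [q] enters here: [q] divides the difference of [a] and [b], which is even, so a
    nonzero difference would be at least [2 q > q + 1]. *)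
Lemma resonance_order p q a b :
  (3 < q)%nat -> Nat.Odd q -> Nat.gcd p q = 1%nat -> Nat.Even (a + b) -> (a + b <= q + 1)%nat ->
  Cpow (expi (res_angle p q)) a = Cpow (expi (res_angle p q)) b -> a = b.
Proof.
  intros hq ho hg.
  assert (w : forall a b, (a <= b)%nat -> Nat.Even (a + b) -> (a + b <= q + 1)%nat ->
    Cpow (expi (res_angle p q)) a = Cpow (expi (res_angle p q)) b -> a = b).
  { clear a b; intros a b hab he hle e.
    set (r := expi (res_angle p q)) in *.
    assert (hr : (Cconj r * r)%C = RtoC 1) by apply expi_conj.
    replace b with (a + (b - a))%nat in e by lia; rewrite Cpow_add_r in e.
    assert (e1 : Cpow r (b - a) = RtoC 1).
    { transitivity (Cpow (Cconj r) a * (Cpow r a * Cpow r (b - a)))%C.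
      - rewrite Cmult_assoc, <- Cpow_mult_l, hr, Cpow_1_l; ring.
      - rewrite <- e, <- Cpow_mult_l, hr, Cpow_1_l; ring. }
    apply expi_res_pow_1 in e1; [|lia|auto].
    destruct e1 as [c hc], ho as [o ho], he as [m hm].
    destruct c as [|[|c]]; [lia| |nia].
    lia. }
  intros he hle e; destruct (Nat.le_ge_cases a b); [now apply w|].
  symmetry; apply w; auto; now rewrite Nat.add_comm.
Qed.

(** The operator taking [Y] to [r^-1 Y(r z) - Y] is diagonal on the monomials [z^a conj(z)^b], with
    eigenvalue [mu - 1]. It is inverted where [mu] differs from 1; where [mu = 1], [resonance_order]
    gives [a = b + 1] and the monomial goes to the right-hand side. *)
Lemma homological_equation p q m X :
  (3 < q)%nat -> Nat.Odd q -> Nat.gcd p q = 1%nat -> (2 * m + 1 <= q)%nat -> hfield (2 * m + 1) X ->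
  let r := expi (res_angle p q) in
  exists Y c, hfield (2 * m + 1) Y /\
    forall z, (X z + Cconj r * Y (r * z) - Y z = c * RtoC ((Cmod z ^ 2) ^ m) * z)%C.
Proof.
  intros hq ho hg hm hX r; apply hfield_zpoly in hX.
  assert (hr : (Cconj r * r)%C = RtoC 1) by apply expi_conj.
  induction hX as [a b k e|f g _ [Y1 [c1 [h1 e1]]] _ [Y2 [c2 [h2 e2]]]|f g e _ [Y [c [h1 e1]]]].
  - set (mu := (Cpow r a * Cpow (Cconj r) (S b))%C).
    destruct (excluded_middle_informative (mu = RtoC 1)) as [h|h].
    + assert (hab : a = S b).
      { apply (resonance_order p q); auto; try (rewrite Nat.add_succ_r, e); try lia.
        - exists (S m); lia.
        - fold r; transitivity (Cpow r a * (Cpow (Cconj r) (S b) * Cpow r (S b)))%C.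
          + rewrite <- Cpow_mult_l, hr, Cpow_1_l; ring.
          + rewrite Cmult_assoc; fold mu; rewrite h; ring. }
      exists (fun _ => RtoC 0), k; split.
      * apply (hfield_ext _ (fun z => RtoC 0 * (RtoC 0 * Cpow z a * Cpow (Cconj z) b))%C);
          [intros; ring|].
        apply hfield_scal, zpoly_hfield, zpoly_mono, e.
      * intros z; assert (hb : b = m) by lia; rewrite hab, hb, Cpow_S.
        rewrite RtoC_pow, Cmod2_conj, Cpow_mult_l; ring.
    + assert (h' : (1 - mu)%C <> RtoC 0).
      { intros h0; apply h; transitivity (1 - (1 - mu))%C; [ring|rewrite h0; ring]. }
      exists (fun z => k / (1 - mu) * Cpow z a * Cpow (Cconj z) b)%C, (RtoC 0); split.
      * apply zpoly_hfield; now apply zpoly_mono.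
      * intros z; rewrite Cmult_conj, !Cpow_mult_l.
        transitivity ((k + (mu - 1) * (k / (1 - mu))) * Cpow z a * Cpow (Cconj z) b)%C.
        -- unfold mu at 3; rewrite Cpow_S; ring.
        -- replace (k + (mu - 1) * (k / (1 - mu)))%C with (RtoC 0) by (field; auto); ring.
  - exists (fun z => Y1 z + Y2 z)%C, (c1 + c2)%C; split; [now apply hfield_plus|].
    intros z; transitivity ((f z + Cconj r * Y1 (r * z) - Y1 z) + (g z + Cconj r * Y2 (r * z) - Y2 z))%C;
      [ring|rewrite e1, e2; ring].
  - exists Y, c; split; auto; intros z; now rewrite <- e.
Qed.

(** Along one orbit of [z -> r z] the q increments of [F], weighted by powers of [s], all equal
    [Q z], while their sum is [F z - F z]. Applied with [s = r^-1] to fields and with [s = 1] to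
    functions. *)
Lemma telescoping q r s (F Q : C -> C) :
  (0 < q)%nat -> Cpow r q = RtoC 1 -> Cpow s q = RtoC 1 ->
  (forall z, F z - s * F (r * z) = Q z)%C -> (forall z, s * Q (r * z) = Q z)%C ->
  forall z, Q z = RtoC 0.
Proof.
  intros hq hr hs hF hQ.
  assert (Qn : forall n z, (Cpow s n * Q (Cpow r n * z) = Q z)%C).
  { induction n as [|n IH]; intros z; [simpl; rewrite !Cmult_1_l; reflexivity|].
    rewrite !Cpow_S, <- (hQ z), <- (IH (r * z)%C).
    replace (r * Cpow r n * z)%C with (Cpow r n * (r * z))%C by ring; ring. }
  assert (Fn : forall n z, (F z - Cpow s n * F (Cpow r n * z) = RtoC (INR n) * Q z)%C).
  { induction n as [|n IH]; intros z; [simpl; rewrite !Cmult_1_l; ring|].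
    transitivity ((F z - Cpow s n * F (Cpow r n * z)) +
      Cpow s n * (F (Cpow r n * z) - s * F (r * (Cpow r n * z))))%C.
    - replace (Cpow r (S n) * z)%C with (r * (Cpow r n * z))%C by (rewrite Cpow_S; ring).
      rewrite Cpow_S; ring.
    - rewrite IH, hF, Qn, S_INR, RtoC_plus; ring. }
  intros z; assert (h := Fn q z); rewrite hr, hs, !Cmult_1_l in h.
  assert (hq0 : RtoC (INR q) <> RtoC 0).
  { intros e; injection e; apply not_0_INR; lia. }
  transitivity (/ RtoC (INR q) * (RtoC (INR q) * Q z))%C; [field; auto|rewrite <- h; ring].
Qed.

(** * Divergence of plane fields and its behaviour under rotations *)

Definition divergence (X : C -> C) (v : R * R) : R :=
  d_dx (fun z => fst (X z)) v + d_dy (fun z => snd (X z)) v.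

Definition diff_field (X : C -> C) (v : R * R) : Prop :=
  dlim (fun z => fst (X z)) v (d_dx (fun z => fst (X z)) v) (d_dy (fun z => fst (X z)) v) /\
  dlim (fun z => snd (X z)) v (d_dx (fun z => snd (X z)) v) (d_dy (fun z => snd (X z)) v).

Lemma dlim_partial f v a b : dlim f v a b -> dlim f v (d_dx f v) (d_dy f v).
Proof. intros h; destruct (dlim_unique _ _ _ _ h) as [-> ->]; auto. Qed.

Lemma hfield_diff_field n X v : hfield (S n) X -> diff_field X v.
Proof.
  intros [h1 h2]; destruct (hpoly_deriv _ _ h1) as (? & ? & _ & _ & _ & k1).
  destruct (hpoly_deriv _ _ h2) as (? & ? & _ & _ & _ & k2).
  split; eapply dlim_partial; eauto.
Qed.

Lemma hpoly_divergence n X : hfield (S n) X -> hpoly n (divergence X).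
Proof.
  intros [h1 h2]; destruct (hpoly_deriv _ _ h1) as (fx & fy & a1 & a2 & _ & k1).
  destruct (hpoly_deriv _ _ h2) as (gx & gy & b1 & b2 & _ & k2).
  apply (hpoly_ext _ (fun v => fx v + gy v)); [|now apply hpoly_plus].
  intros v; unfold divergence; now rewrite (proj1 (dlim_unique _ _ _ _ (k1 v))),
    (proj2 (dlim_unique _ _ _ _ (k2 v))).
Qed.

Lemma smooth_diff_field X : smooth_near_O X -> near_O (diff_field X).
Proof.
  intros h; apply smooth_iff in h; destruct h as [h1 h2].
  near (smoothR_dlim _ h1); near (smoothR_dlim _ h2); near_end; intros v k2 k1; now split.
Qed.

Lemma divergence_plus X Y v :
  diff_field X v -> diff_field Y v -> divergence (fun z => X z + Y z)%C v = divergence X v + divergence Y v.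
Proof.
  intros [a b] [c d]; unfold divergence; simpl.
  rewrite (proj1 (dlim_unique _ _ _ _ (dlim_plus _ _ _ _ _ _ _ a c))).
  rewrite (proj2 (dlim_unique _ _ _ _ (dlim_plus _ _ _ _ _ _ _ b d))); ring.
Qed.

Lemma divergence_minus X Y v :
  diff_field X v -> diff_field Y v -> divergence (fun z => X z - Y z)%C v = divergence X v - divergence Y v.
Proof.
  intros [a b] [c d]; unfold divergence; simpl.
  rewrite (proj1 (dlim_unique _ _ _ _ (dlim_plus _ _ _ _ _ _ _ a (dlim_opp _ _ _ _ c)))).
  rewrite (proj2 (dlim_unique _ _ _ _ (dlim_plus _ _ _ _ _ _ _ b (dlim_opp _ _ _ _ d)))); ring.
Qed.

Lemma dlim_rot_fst r v : dlim (fun z => fst (r * z)%C) v (fst r) (- snd r).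
Proof.
  generalize (dlim_minus _ _ _ _ _ _ _ (dlim_scal (fst r) _ _ _ _ (dlim_fst v))
    (dlim_scal (snd r) _ _ _ _ (dlim_snd v))).
  rewrite !Rmult_1_r, !Rmult_0_r, Rminus_0_r, Rminus_0_l; auto.
Qed.

Lemma dlim_rot_snd r v : dlim (fun z => snd (r * z)%C) v (snd r) (fst r).
Proof.
  generalize (dlim_plus _ _ _ _ _ _ _ (dlim_scal (fst r) _ _ _ _ (dlim_snd v))
    (dlim_scal (snd r) _ _ _ _ (dlim_fst v))).
  rewrite !Rmult_1_r, !Rmult_0_r, Rplus_0_r, Rplus_0_l; auto.
Qed.

Lemma divergence_rot r X v :
  (Cconj r * r)%C = RtoC 1 -> diff_field X (r * v)%C ->
  divergence (fun z => Cconj r * X (r * z))%C v = divergence X (r * v)%C.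
Proof.
  intros hr [hx hy].
  assert (kx := dlim_comp _ (fun z => r * z)%C v _ _ _ _ _ _ hx (dlim_rot_fst r v) (dlim_rot_snd r v)).
  assert (ky := dlim_comp _ (fun z => r * z)%C v _ _ _ _ _ _ hy (dlim_rot_fst r v) (dlim_rot_snd r v)).
  cbv beta in kx, ky; unfold divergence; simpl.
  destruct (dlim_unique _ _ _ _ (dlim_minus _ _ _ _ _ _ _
    (dlim_scal (fst r) _ _ _ _ kx) (dlim_scal (- snd r) _ _ _ _ ky))) as [-> _].
  destruct (dlim_unique _ _ _ _ (dlim_plus _ _ _ _ _ _ _
    (dlim_scal (fst r) _ _ _ _ ky) (dlim_scal (- snd r) _ _ _ _ kx))) as [_ ->].
  injection hr; intros _ h.
  match goal with |- ?a + ?b = ?c + ?d =>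
    transitivity ((fst r * fst r - - snd r * snd r) * (c + d)); [ring|rewrite h; ring] end.
Qed.

(** * One normalization step *)

Lemma smooth_plus (F G : C -> C) : smooth_near_O F -> smooth_near_O G ->
  smooth_near_O (fun z => F z + G z)%C.
Proof.
  intros hF hG; apply smooth_iff in hF, hG; destruct hF, hG; apply smooth_iff.
  split; simpl; now apply smoothR_plus.
Qed.

Lemma smooth_scal c F : smooth_near_O F -> smooth_near_O (fun z => c * F z)%C.
Proof.
  intros hF; apply smooth_iff in hF; destruct hF; apply smooth_iff; split; simpl.
  - apply smoothR_minus; apply smoothR_mult; auto using smoothR_const.
  - apply smoothR_plus; apply smoothR_mult; auto using smoothR_const.
Qed.

Lemma smooth_ext F G : near_O (fun z => F z = G z) -> smooth_near_O F -> smooth_near_O G.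
Proof.
  intros e hF; apply smooth_iff in hF; destruct hF as [h1 h2]; apply smooth_iff; split.
  - apply (smoothR_ext (fun z => fst (F z))); auto; near e; near_end; now intros z ->.
  - apply (smoothR_ext (fun z => snd (F z))); auto; near e; near_end; now intros z ->.
Qed.

(* ring fails when the carrier is displayed as R * R instead of C. *)
Ltac cring := first [ring | match goal with |- ?a = ?b => change (@eq C a b); ring end].

Lemma smooth_minus (F G : C -> C) : smooth_near_O F -> smooth_near_O G ->
  smooth_near_O (fun z => F z - G z)%C.
Proof.
  intros hF hG; apply (smooth_ext (fun z => F z + (- (1)) * G z)%C).
  - near_end; intros; cring.
  - auto using smooth_plus, smooth_scal.
Qed.

Lemma smooth_id : smooth_near_O (fun z => z).
Proof. apply smooth_iff; split; [exact smoothR_fst|exact smoothR_snd]. Qed.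

Lemma smooth_conj : smooth_near_O Cconj.
Proof. apply smooth_iff; split; simpl; [exact smoothR_fst|exact (smoothR_opp _ smoothR_snd)]. Qed.

Lemma conj_00 : Cconj (0, 0) = (0, 0).
Proof. unfold Cconj; simpl; f_equal; cring. Qed.

Lemma mul_00 c : Cmult c (0, 0) = (0, 0).
Proof. unfold Cmult; simpl; f_equal; cring. Qed.

Lemma smooth_reflect F : smooth_near_O F -> smooth_near_O (fun z => Cconj (F (Cconj z))).
Proof.
  intros hF; apply (smooth_comp F Cconj) in hF; auto using smooth_conj, conj_00.
  apply smooth_iff in hF; destruct hF; apply smooth_iff; split; simpl; auto using smoothR_opp.
Qed.

Lemma bigO_conj : bigO 1 Cconj.
Proof. exists 1; split; [lra|]; near_end; intros; rewrite Cmod_conj; lra. Qed.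

Lemma bigO_reflect n F : bigO n F -> bigO n (fun z => Cconj (F (Cconj z))).
Proof.
  intros hF; apply (bigO_comp n _ _ bigO_conj) in hF; destruct hF as [K [hK h]].
  exists K; split; auto; near h; near_end; intros z; now rewrite Cmod_conj.
Qed.

Lemma bigO_cneg : bigO 1 cneg.
Proof.
  exists 1; split; [lra|]; near_end; intros z.
  replace (cneg z) with (- z)%C by (now destruct z); rewrite Cmod_opp; lra.
Qed.

Lemma bigO_rot r : bigO 1 (fun z => r * z)%C.
Proof. exact (bigO_scal 1 r _ bigO_id). Qed.

Lemma leading_part n X :
  smooth_near_O X -> bigO n X -> exists h, hfield n h /\ bigO (S n) (fun z => X z - h z)%C.
Proof.
  intros hs hO; apply smooth_iff in hs; destruct hs as [s1 s2].
  apply bigO_split in hO; destruct hO as [o1 o2].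
  destruct (leading_term _ n s1 o1) as [h1 [k1 r1]], (leading_term _ n s2 o2) as [h2 [k2 r2]].
  exists (fun z => (h1 z, h2 z)); split; [now split|].
  now apply bigO_split.
Qed.

Lemma hfield_cneg n X z : hfield n X -> X (cneg z) = (RtoC ((-1) ^ n) * X z)%C.
Proof.
  intros [h1 h2].
  assert (e1 := hpoly_homog n _ (-1) z h1); assert (e2 := hpoly_homog n _ (-1) z h2); cbv beta in e1, e2.
  replace (-1 * fst z, -1 * snd z) with (cneg z) in e1, e2
    by (unfold cneg; f_equal; cring).
  apply injective_projections; simpl; rewrite ?e1, ?e2; cring.
Qed.

Lemma odd_gain m X :
  smooth_near_O X -> intertwines X cneg cneg -> bigO (2 * m) X -> bigO (2 * m + 1) X.
Proof.
  intros hs ho hO; destruct (leading_part _ X hs hO) as [h [hh hr]].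
  rewrite Nat.add_1_r.
  assert (h0 : forall z, h z = RtoC 0).
  { apply (hfield_zero _ h hh).
    assert (hr' := bigO_comp _ _ _ bigO_cneg hr); red in ho.
    apply (bigO_ext _ (fun z => RtoC (- / 2) * ((X z - h z) + (X (cneg z) - h (cneg z))))%C).
    - near ho; near_end; intros z ->; rewrite (hfield_cneg _ _ z hh), pow_1_even.
      generalize (X z), (h z); intros [a b] [c d]; unfold cneg.
      apply injective_projections; simpl; field.
    - apply bigO_scal, bigO_plus; auto. }
  revert hr; apply bigO_ext; near_end; intros; rewrite h0; cring.
Qed.

Lemma conj_affine r a b c :
  Cconj (r * (Cconj a + b + c)) = (Cconj r * (a + Cconj b + Cconj c))%C.
Proof. now rewrite Cmult_conj, !Cplus_conj, Cconj_conj. Qed.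

(** What is retained of the terms already normalised: [Om(|z|^2) z] commutes with every rotation
    and, as [Om(0) = 0], starts at degree 3. *)
Definition twist_term (W : C -> C) : Prop :=
  smooth_near_O W /\ bigO 3 W /\
  forall u z, (Cconj u * u)%C = RtoC 1 -> W (u * z)%C = (u * W z)%C.

Lemma unit_conj u : (Cconj u * u)%C = RtoC 1 -> (Cconj (Cconj u) * Cconj u)%C = RtoC 1.
Proof. rewrite Cconj_conj; intros h; rewrite <- h; cring. Qed.

Lemma twist_term_reflect W : twist_term W -> twist_term (fun z => Cconj (W (Cconj z))).
Proof.
  intros (h1 & h2 & h3); split; [|split].
  - now apply smooth_reflect.
  - now apply bigO_reflect.
  - intros u z hu; rewrite Cmult_conj, h3, Cmult_conj, Cconj_conj; auto using unit_conj.
Qed.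

Lemma twist_term_plus (V W : C -> C) : twist_term V -> twist_term W -> twist_term (fun z => V z + W z)%C.
Proof.
  intros (h1 & h2 & h3) (k1 & k2 & k3); split; [|split].
  - now apply smooth_plus.
  - now apply bigO_plus.
  - intros u z hu; rewrite h3, k3; auto; cring.
Qed.

Definition radial (m : nat) (c : C) (z : C) : C := (c * RtoC ((Cmod z ^ 2) ^ m) * z)%C.

Lemma hfield_radial m c : hfield (2 * m + 1) (radial m c).
Proof.
  apply zpoly_hfield, (zpoly_ext _ (fun z => c * Cpow z (S m) * Cpow (Cconj z) m)%C).
  - intros z; unfold radial; rewrite RtoC_pow, Cmod2_conj, Cpow_mult_l, Cpow_S; cring.
  - apply zpoly_mono; lia.
Qed.

Lemma radial_rot m c u z : (Cconj u * u)%C = RtoC 1 -> radial m c (u * z)%C = (u * radial m c z)%C.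
Proof.
  intros hu; unfold radial; rewrite Cmod_mult.
  assert (h : Cmod u ^ 2 = 1).
  { apply RtoC_inj; rewrite Cmod2_conj, Cmult_comm; exact hu. }
  rewrite Rpow_mult_distr, h, Rmult_1_l; cring.
Qed.

Lemma twist_term_radial m c : (1 <= m)%nat -> twist_term (radial m c).
Proof.
  intros hm; split; [|split].
  - apply (hfield_smooth (2 * m + 1)), hfield_radial.
  - apply (bigO_weaken 3 (2 * m + 1)); [lia|]; apply hfield_bigO, hfield_radial.
  - intros; now apply radial_rot.
Qed.


(* With T X (z) = r^-1 X (r z) and g^R (z) = conj (g (conj z)), reversibility makes g + T g^R a T-invariant
   field. *)
Lemma reversible_leading (r : C) k (W f g : C -> C) :
  (Cconj r * r)%C = RtoC 1 -> (3 <= k)%nat -> twist_term W ->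
  smooth_near_O f -> bigO k f -> hfield k g -> bigO (k + 2) (fun z => f z - g z)%C ->
  near_O (fun z => let G := fun w => (r * (w + W w + f w))%C in Cconj (G (Cconj (G z))) = z) ->
  forall z, (Cconj r * (g (r * z) + Cconj r * Cconj (g (Cconj (r * (r * z))))) =
    g z + Cconj r * Cconj (g (Cconj (r * z))))%C.
Proof.
  intros hr hk hW sf of hg hfg hrev.
  set (V := fun z => Cconj (W (Cconj z))).
  assert (hV : twist_term V) by now apply twist_term_reflect.
  destruct hV as (sV & oV & eV), hW as (sW & oW & eW).
  set (fR := fun z => Cconj (f (Cconj z))).
  set (gR := fun z => Cconj (g (Cconj z))).
  assert (sfR : smooth_near_O fR) by now apply smooth_reflect.
  assert (ofR : bigO k fR) by now apply bigO_reflect.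
  assert (hfgR : bigO (k + 2) (fun z => fR z - gR z)%C).
  { apply bigO_reflect in hfg; revert hfg; apply bigO_ext; near_end; intros z.
    unfold fR, gR; now rewrite Cminus_conj. }
  set (p := fun z => (z + W z)%C).
  set (E := fun z => (z + W z + f z)%C).
  assert (op : bigO 1 p).
  { apply bigO_plus; [apply bigO_id|now apply (bigO_weaken 1 3); [lia|]]. }
  assert (oE : bigO 1 E).
  { apply bigO_plus; [exact op|now apply (bigO_weaken 1 k); [lia|]]. }
  (* [B] collects the terms of the reversibility identity that involve the twist part alone. It
     commutes with [r], hence cancels in [r^-1 L(r z) - L z]. *)
  set (B := fun z => (W z + V (p z))%C).
  assert (eB : forall z, B (r * z)%C = (r * B z)%C).
  { intros z; unfold B, p; rewrite eW by auto.
    replace (r * z + r * W z)%C with (r * (z + W z))%C by cring; rewrite eV by auto; cring. }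
  set (L := fun z => (g z + Cconj r * gR (r * z))%C).
  (* Replacing [E z] by [p z] inside [V], and by [z] inside [fR (r z)], costs O(|z|^(k+2)) each
     time: the orders are 2 + k and (k - 1) + 3, because [V] and [W] have order 3. *)
  assert (oL : bigO (k + 2) (fun z => L z + B z)%C).
  { assert (h1 : bigO (k + 2) (fun z => V (E z) - V (p z))%C).
    { apply (bigO_weaken _ (2 + k)); [lia|]; apply bigO_diff_comp; auto.
      apply (bigO_ext _ f); auto; near_end; intros z; unfold E, p; cring. }
    assert (h2 : bigO (k + 2) (fun z => fR (r * E z) - fR (r * z))%C).
    { apply (bigO_weaken _ ((k - 1) + 3)); [lia|].
      apply (bigO_diff_comp fR (k - 1) 3 (fun z => r * E z)%C (fun z => r * z)%C); auto using bigO_rot.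
      - now replace (S (k - 1)) with k by lia.
      - now apply bigO_scal.
      - apply (bigO_ext _ (fun z => r * (W z + f z))%C).
        + near_end; intros z; unfold E; cring.
        + apply bigO_scal, bigO_plus; auto; now apply (bigO_weaken 3 k). }
    assert (h3 := bigO_comp _ _ _ (bigO_rot r) hfgR).
    apply (bigO_ext _ (fun z => (- (V (E z) - V (p z)) - Cconj r * (fR (r * E z) - fR (r * z)))
      - (f z - g z) - Cconj r * (fR (r * z) - gR (r * z)))%C).
    - near hrev; near_end; intros z; cbv zeta; intros e.
      assert (e2 : (E z + V (E z) + Cconj r * fR (r * E z))%C = z).
      { transitivity (Cconj r * (r * E z + V (r * E z) + fR (r * E z)))%C.
        2:{ etransitivity; [|exact e]; symmetry; apply conj_affine. }
        rewrite eV by auto.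
        transitivity ((Cconj r * r) * (E z + V (E z)) + Cconj r * fR (r * E z))%C; [|cring].
        rewrite hr; cring. }
      assert (e3 : (Cconj r * fR (r * E z) = z - E z - V (E z))%C).
      { transitivity ((E z + V (E z) + Cconj r * fR (r * E z)) - E z - V (E z))%C; [cring|].
        now rewrite e2. }
      transitivity (- V (E z) + V (p z) - Cconj r * fR (r * E z) - f z + g z
        + Cconj r * gR (r * z))%C; [cring|].
      rewrite e3; unfold L, B, E; cring.
    - apply bigO_minus; [apply bigO_minus; [apply bigO_minus|exact hfg]|].
      + now apply bigO_opp.
      + now apply bigO_scal.
      + now apply bigO_scal. }
  assert (vL : hfield k L).
  { apply hfield_plus; auto; apply hfield_scal.
    apply (hfield_comp_rot k r gR), hfield_reflect, hg. }
  assert (h0 : forall z, (Cconj r * L (r * z) - L z = RtoC 0)%C).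
  { apply (hfield_zero k (fun z => Cconj r * L (r * z) - L z)%C).
    - apply hfield_minus; auto; apply hfield_scal; now apply (hfield_comp_rot k r L).
    - apply (bigO_weaken _ (k + 2)); [lia|].
      apply (bigO_ext _ (fun z => Cconj r * (L (r * z) + B (r * z)) - (L z + B z))%C).
      + near_end; intros z; rewrite eB.
        transitivity (Cconj r * L (r * z) - L z + (Cconj r * r) * B z - B z)%C; [cring|].
        rewrite hr; cring.
      + apply bigO_minus; auto; apply bigO_scal.
        exact (bigO_comp _ _ _ (bigO_rot r) oL). }
  intros z; change (Cconj r * L (r * z) = L z)%C.
  transitivity (Cconj r * L (r * z) - L z + L z)%C; [cring|rewrite h0; cring].
Qed.


Lemma jac_det_rot r v : (Cconj r * r)%C = RtoC 1 -> jac_det (fun z => r * z)%C v = 1.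
Proof.
  intros h; unfold jac_det.
  destruct (dlim_unique _ _ _ _ (dlim_rot_fst r v)) as [-> ->].
  destruct (dlim_unique _ _ _ _ (dlim_rot_snd r v)) as [-> ->].
  injection h; intros _ e; lra.
Qed.

Lemma bigOR_divergence n X : smooth_near_O X -> bigO (S n) X -> bigOR n (divergence X).
Proof.
  intros hs hO; apply smooth_iff in hs; destruct hs; apply bigO_split in hO; destruct hO.
  apply bigOR_plus; [now apply bigOR_dx|now apply bigOR_dy].
Qed.

(** Up to O(|v|^(k+1)) the Jacobian is that of [p = z + W], rotation invariant because [p] commutes
    with [r], plus [div f]. As the total is constant, [div f] is invariant up to that order, and its
    leading part [div g], of degree k - 1, is invariant exactly. *)
Lemma area_leading (r : C) k (W f g : C -> C) :
  (Cconj r * r)%C = RtoC 1 -> (3 <= k)%nat -> twist_term W ->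
  smooth_near_O f -> bigO k f -> hfield k g -> bigO (k + 2) (fun z => f z - g z)%C ->
  near_O (fun v => Rabs (jac_det (fun z => r * (z + W z + f z))%C v) = 1) ->
  forall v, divergence g (r * v)%C = divergence g v.
Proof.
  intros hr hk (sW & oW & eW) sf of hg hfg hj.
  set (p := fun z => (z + W z)%C).
  set (E := fun z => (z + W z + f z)%C).
  assert (sp : smooth_near_O p) by (apply smooth_plus; auto using smooth_id).
  assert (sE : smooth_near_O E) by (apply smooth_plus; auto using smooth_plus, smooth_id).
  assert (s1 : smooth_near_O (fun z => r * z)%C) by apply smooth_scal, smooth_id.
  assert (op : bigO 1 p).
  { apply bigO_plus; [apply bigO_id|now apply (bigO_weaken 1 3); [lia|]]. }
  assert (oE : bigO 1 E).
  { apply bigO_plus; [exact op|now apply (bigO_weaken 1 k); [lia|]]. }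
  assert (z0 : forall F, bigO 1 F -> F (0, 0) = (0, 0)).
  { intros F h; apply bigO_split in h; destruct h as [a b].
    apply injective_projections; [apply (bigOR_at0 _ _ a)|apply (bigOR_at0 _ _ b)]. }
  assert (sW' := sW); apply smooth_iff in sW'; destruct sW' as [w1 w2].
  assert (sf' := sf); apply smooth_iff in sf'; destruct sf' as [f1 f2].
  apply bigO_split in oW; destruct oW as [ow1 ow2].
  assert (of' := of); apply bigO_split in of'; destruct of' as [of1 of2].
  assert (w1x := bigOR_dx _ 2 w1 ow1); assert (w1y := bigOR_dy _ 2 w1 ow1).
  assert (w2x := bigOR_dx _ 2 w2 ow2); assert (w2y := bigOR_dy _ 2 w2 ow2).
  replace k with (S (k - 1)) in of1, of2 by lia.
  assert (f1x := bigOR_dx _ _ f1 of1); assert (f1y := bigOR_dy _ _ f1 of1).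
  assert (f2x := bigOR_dx _ _ f2 of2); assert (f2y := bigOR_dy _ _ f2 of2).
  (* The quadratic remainder: products of a derivative of [f] with one of [W] or of [f], of order at
     least k + 1 since k >= 3. *)
  set (q := fun v => jac_det E v - jac_det p v - divergence f v).
  assert (dec : near_O (fun v =>
    jac_det p v = (1 + d_dx (fun z => fst (W z)) v) * (1 + d_dy (fun z => snd (W z)) v)
      - d_dy (fun z => fst (W z)) v * d_dx (fun z => snd (W z)) v /\
    jac_det E v = (1 + d_dx (fun z => fst (W z)) v + d_dx (fun z => fst (f z)) v)
        * (1 + d_dy (fun z => snd (W z)) v + d_dy (fun z => snd (f z)) v)
      - (d_dy (fun z => fst (W z)) v + d_dy (fun z => fst (f z)) v)
        * (d_dx (fun z => snd (W z)) v + d_dx (fun z => snd (f z)) v))).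
  { near (smooth_diff_field W sW); near (smooth_diff_field f sf); near_end; intros v [a b] [c d].
    destruct (dlim_unique _ _ _ _ (dlim_plus _ _ _ _ _ _ _ (dlim_fst v) c)) as [p1 p2].
    destruct (dlim_unique _ _ _ _ (dlim_plus _ _ _ _ _ _ _ (dlim_snd v) d)) as [p3 p4].
    destruct (dlim_unique _ _ _ _ (dlim_plus _ _ _ _ _ _ _
      (dlim_plus _ _ _ _ _ _ _ (dlim_fst v) c) a)) as [q1 q2].
    destruct (dlim_unique _ _ _ _ (dlim_plus _ _ _ _ _ _ _
      (dlim_plus _ _ _ _ _ _ _ (dlim_snd v) d) b)) as [q3 q4].
    unfold jac_det, p, E, Cplus; simpl; rewrite p1, p2, p3, p4, q1, q2, q3, q4; split; cring. }
  assert (oq : bigOR (k + 1) q).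
  { apply (bigOR_ext _ (fun v =>
      (d_dx (fun z => fst (W z)) v * d_dy (fun z => snd (f z)) v
        + d_dy (fun z => snd (W z)) v * d_dx (fun z => fst (f z)) v)
      - (d_dy (fun z => fst (W z)) v * d_dx (fun z => snd (f z)) v
        + d_dx (fun z => snd (W z)) v * d_dy (fun z => fst (f z)) v)
      + (d_dx (fun z => fst (f z)) v * d_dy (fun z => snd (f z)) v
        - d_dy (fun z => fst (f z)) v * d_dx (fun z => snd (f z)) v))).
    { near dec; near_end; intros v [e1 e2]; unfold q, divergence; rewrite e1, e2; cring. }
    assert (hk2 : (k + 1 = 2 + (k - 1))%nat) by lia.
    assert (hk3 : (k + 1 = (k - 1) + 2)%nat) by lia.
    apply bigOR_plus; [apply bigOR_minus; apply bigOR_plus; rewrite hk2; apply bigOR_mult; auto|].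
    apply (bigOR_weaken _ ((k - 1) + (k - 1))); [lia|].
    apply bigOR_minus; apply bigOR_mult; auto. }
  assert (jp : near_O (fun v => jac_det p (r * v)%C = jac_det p v)).
  { near (jac_det_comp p _ sp s1 (mul_00 r)).
    near (jac_det_comp _ p s1 sp (z0 p op)).
    assert (he : near_O (fun v => (r * p v)%C = p (r * v)%C)).
    { near_end; intros v; unfold p; rewrite eW by auto; cring. }
    near (jac_det_ext _ _ he (smooth_scal r p sp)).
    near_end; intros v e1 e2 e3.
    assert (h : jac_det (fun z => r * z)%C (p v) * jac_det p v =
      jac_det p (r * v)%C * jac_det (fun z => r * z)%C v).
    { etransitivity; [symmetry; exact e2|etransitivity; [exact e1|exact e3]]. }
    rewrite !jac_det_rot in h by auto; lra. }
  (* Area preservation fixes the Jacobian only up to sign; the sign is positive because [jac_det E]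
     is 1 + O(|v|). *)
  assert (jE : near_O (fun v => jac_det E v = 1)).
  { assert (hpos : near_O (fun v => 0 < jac_det E v)).
    { assert (hc : bigOR 1 (fun v => jac_det E v - 1)).
      { apply (bigOR_ext _ (fun v => q v + divergence f v + (d_dx (fun z => fst (W z)) v
          + d_dy (fun z => snd (W z)) v
          + d_dx (fun z => fst (W z)) v * d_dy (fun z => snd (W z)) v
          - d_dy (fun z => fst (W z)) v * d_dx (fun z => snd (W z)) v))).
        { near dec; near_end; intros v [e1 e2]; unfold q; rewrite e1, e2; cring. }
        assert (hp : forall a b, bigOR 2 a -> bigOR 2 b -> bigOR 1 (fun v => a v * b v)).
        { intros a b ha hb; apply (bigOR_weaken 1 (2 + 2)); [lia|now apply bigOR_mult]. }
        apply bigOR_plus; [apply bigOR_plus|].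
        - now apply (bigOR_weaken 1 (k + 1)); [lia|].
        - apply (bigOR_weaken 1 (k - 1)); [lia|]; apply bigOR_divergence; auto.
          now replace (S (k - 1)) with k by lia.
        - apply bigOR_minus; [apply bigOR_plus; [apply bigOR_plus|]|]; auto;
            apply (bigOR_weaken 1 2); auto. }
      destruct hc as [K [hK hc]].
      assert (hd : 0 < / (K + 1)) by (apply Rinv_0_lt_compat; lra).
      near hc; near (near_ball _ hd); near_end; intros v hv h.
      rewrite pow_1 in h; apply Rabs_le_between in h.
      apply (Rmult_lt_compat_l (K + 1)) in hv; [|lra].
      rewrite Rinv_r in hv by lra; generalize (Cmod_ge_0 v); nra. }
    near hpos; near hj; near (jac_det_comp _ E s1 sE (z0 E oE)).
    near_end; intros v e h0 hp.
    assert (h : Rabs (jac_det (fun z => r * z)%C (E v) * jac_det E v) = 1)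
      by (rewrite <- e; exact h0).
    rewrite jac_det_rot, Rmult_1_l in h by auto.
    rewrite Rabs_pos_eq in h; lra. }
  assert (odf : bigOR (k + 1) (fun v => divergence f (r * v)%C - divergence f v)).
  { assert (tr := bigO1_tends0 _ (bigO_rot r)).
    apply (bigOR_ext _ (fun v => q v - q (r * v)%C)).
    - near jE; near (near_comp _ _ tr jE); near jp; near_end; intros v e1 e2 e3.
      unfold q; rewrite e1, e2, e3; cring.
    - apply bigOR_minus; auto; exact (bigOR_comp _ _ _ (bigO_rot r) oq). }
  assert (hdv : bigOR (k + 1) (fun v => divergence f v - divergence g v)).
  { apply (bigOR_ext _ (divergence (fun z => f z - g z)%C)).
    - near (smooth_diff_field f sf); near (smooth_diff_field g (hfield_smooth _ _ hg)); near_end.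
      intros v h1 h2; now apply divergence_minus.
    - apply bigOR_divergence; [apply smooth_minus; auto; now apply (hfield_smooth k)|].
      now replace (S (k + 1)) with (k + 2)%nat by lia. }
  replace k with (S (k - 1)) in hg by lia.
  assert (hv : forall v, diff_field g v) by (intros v; now apply (hfield_diff_field (k - 1))).
  (* Writing [div g(r v) - div g(v)] as the divergence of the homogeneous field [u] shows that it is
     a homogeneous polynomial, so that an estimate makes it vanish. *)
  set (u := fun z => (Cconj r * g (r * z) - g z)%C).
  assert (hgr : hfield (S (k - 1)) (fun z => Cconj r * g (r * z))%C).
  { apply hfield_scal; now apply (hfield_comp_rot _ r g). }
  assert (hu : hfield (S (k - 1)) u) by (apply hfield_minus; auto).
  assert (eu : forall v, divergence u v = divergence g (r * v)%C - divergence g v).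
  { intros v; unfold u; rewrite divergence_minus, divergence_rot; auto.
    now apply (hfield_diff_field (k - 1)). }
  assert (hz : forall v, divergence u v = 0).
  { apply (hpoly_zero (k - 1)); [now apply hpoly_divergence|].
    apply (bigOR_weaken _ (k + 1)); [lia|].
    apply (bigOR_ext _ (fun v => (divergence f (r * v)%C - divergence f v)
      - (divergence f (r * v)%C - divergence g (r * v)%C) + (divergence f v - divergence g v))).
    - near_end; intros v; rewrite eu; cring.
    - apply bigOR_plus; auto; apply bigOR_minus; auto.
      exact (bigOR_comp _ _ _ (bigO_rot r) hdv). }
  intros v; generalize (hz v); rewrite eu; lra.
Qed.

Definition hamiltonian (n : nat) (X : C -> C) (v : R * R) : R :=
  - / (INR n + 1) * (fst v * snd (X v) + - (snd v * fst (X v))).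

Lemma hpoly_hamiltonian n X : hfield n X -> hpoly (n + 1) (hamiltonian n X).
Proof.
  intros [h1 h2]; rewrite Nat.add_1_r; apply hpoly_const_scal, hpoly_plus; [now apply hpoly_mul_fst|].
  apply (hpoly_ext _ (fun v => (-1) * (snd v * fst (X v)))); [intros; ring|].
  now apply hpoly_const_scal, hpoly_mul_snd.
Qed.

(* By Euler's identity, J grad (hamiltonian X) = X - (div X) v / (n + 2). *)
Lemma hamiltonian_field n X v :
  hfield (S n) X ->
  d_dy (hamiltonian (S n) X) v = fst (X v) - divergence X v * / (INR (S n) + 1) * fst v /\
  d_dx (hamiltonian (S n) X) v = - (snd (X v) - divergence X v * / (INR (S n) + 1) * snd v).
Proof.
  intros [h1 h2].
  destruct (hpoly_deriv _ _ h1) as (fx & fy & _ & _ & e1 & k1).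
  destruct (hpoly_deriv _ _ h2) as (gx & gy & _ & _ & e2 & k2).
  specialize (e1 v); specialize (e2 v); specialize (k1 v); specialize (k2 v).
  destruct (dlim_unique _ _ _ _ (dlim_scal (- / (INR (S n) + 1)) _ _ _ _
    (dlim_plus _ _ _ _ _ _ _ (dlim_mult _ _ _ _ _ _ _ (dlim_fst v) k2)
    (dlim_opp _ _ _ _ (dlim_mult _ _ _ _ _ _ _ (dlim_snd v) k1))))) as [d1 d2].
  unfold hamiltonian, divergence; rewrite d1, d2.
  rewrite (proj1 (dlim_unique _ _ _ _ k1)), (proj2 (dlim_unique _ _ _ _ k2)).
  assert (hn : INR (S n) + 1 <> 0) by (generalize (pos_INR (S n)); lra).
  split.
  - apply (Rmult_eq_reg_l (INR (S n) + 1)); auto; field_simplify; auto; lra.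
  - apply (Rmult_eq_reg_l (INR (S n) + 1)); auto; field_simplify; auto; lra.
Qed.


(** The average [X] of a solution [Y] and its reflection [YR] is conjugation equivariant. It solves
    the equation exactly when [Q = 0], where [Q] compares [Y] and [YR] under the homological
    operator; the symmetry of [g] makes [Q] invariant, and [telescoping] kills it. *)
Lemma normalizing_field p q m g :
  let r := expi (res_angle p q) in
  (3 < q)%nat -> Nat.Odd q -> Nat.gcd p q = 1%nat ->
  (1 <= m)%nat -> (2 * m + 1 <= q)%nat -> hfield (2 * m + 1) g ->
  (forall z, (Cconj r * (g (r * z) + Cconj r * Cconj (g (Cconj (r * (r * z))))) =
    g z + Cconj r * Cconj (g (Cconj (r * z))))%C) ->
  (forall v, divergence g (r * v)%C = divergence g v) ->
  exists X c, hfield (2 * m + 1) X /\ (forall z, Cconj (X (Cconj z)) = X z) /\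
    (forall v, divergence X (r * v)%C = divergence X v) /\
    forall z, (g z + Cconj r * X (r * z) - X z = radial m c z)%C.
Proof.
  intros r hq ho hg hm hmq vg hrev hdv.
  assert (hr : (Cconj r * r)%C = RtoC 1) by apply expi_conj.
  assert (hrq : Cpow r q = RtoC 1) by (apply expi_res_pow_q; lia).
  assert (hsq : Cpow (Cconj r) q = RtoC 1).
  { rewrite <- Cpow_conj, hrq; unfold Cconj, RtoC; simpl; f_equal; ring. }
  destruct (homological_equation p q m g hq ho hg hmq vg) as [Y [c [vY hY]]]; fold r in hY.
  change (forall z, (g z + Cconj r * Y (r * z) - Y z = radial m c z)%C) in hY.
  set (YR := fun z => Cconj (Y (Cconj z))).
  assert (vYR : hfield (2 * m + 1) YR) by now apply hfield_reflect.
  assert (hrot : forall z, radial m c (r * z)%C = (r * radial m c z)%C).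
  { intros; now apply radial_rot. }
  set (D := fun z => (Y z - YR z)%C).
  assert (tR : forall z, Cconj (radial m c (Cconj (r * z))) = (r * Cconj (radial m c (Cconj z)))%C).
  { intros z; rewrite Cmult_conj, radial_rot, Cmult_conj, Cconj_conj; auto using unit_conj. }
  assert (hgz : forall z, g z = (radial m c z - Cconj r * Y (r * z) + Y z)%C).
  { intros z; rewrite <- hY; ring. }
  assert (hgR : forall z, (Cconj r * Cconj (g (Cconj (r * z))) =
    Cconj (radial m c (Cconj z)) - YR z + Cconj r * YR (r * z))%C).
  { intros z; rewrite hgz, Cplus_conj, Cminus_conj, tR, Cmult_conj, Cconj_conj.
    change (Cconj (Y (Cconj (r * z)))) with (YR (r * z)%C).
    replace (r * Cconj (r * z))%C with (Cconj z)
      by (rewrite Cmult_conj, Cmult_assoc, (Cmult_comm r), hr; ring).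
    change (Cconj (Y (Cconj z))) with (YR z).
    transitivity ((Cconj r * r) * (Cconj (radial m c (Cconj z)) - YR z) + Cconj r * YR (r * z))%C;
      [ring|rewrite hr; ring]. }
  set (Q := fun z => (D z - Cconj r * D (r * z))%C).
  assert (hQ0 : forall z, Q z = RtoC 0).
  { apply (telescoping q r (Cconj r) D Q); auto; [lia|].
    intros z.
    (* [Q] is an expression in [g] and the radial term alone; its invariance is [hrev] together with
       [hrot] and [tR]. *)
    assert (eQ : forall z, Q z = (g z + Cconj r * Cconj (g (Cconj (r * z)))
      - radial m c z - Cconj (radial m c (Cconj z)))%C).
    { intros w; rewrite hgR, hgz; unfold Q, D; ring. }
    rewrite !eQ, hrot, tR, <- (hrev z).
    transitivity (Cconj r * (g (r * z) + Cconj r * Cconj (g (Cconj (r * (r * z)))))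
      - (Cconj r * r) * radial m c z - (Cconj r * r) * Cconj (radial m c (Cconj z)))%C;
      [ring|rewrite hr; ring]. }
  set (X := fun z => (RtoC (/ 2) * (Y z + YR z))%C).
  assert (vX : hfield (2 * m + 1) X) by now apply hfield_scal, hfield_plus.
  assert (hX : forall z, (g z + Cconj r * X (r * z) - X z = radial m c z)%C).
  { intros z; rewrite <- hY; assert (h := hQ0 z); unfold Q, D in h.
    assert (h2 : (RtoC (/ 2) + RtoC (/ 2))%C = RtoC 1) by (rewrite <- RtoC_plus; f_equal; field).
    transitivity (g z + (RtoC (/ 2) + RtoC (/ 2)) * (Cconj r * Y (r * z) - Y z)
      + RtoC (/ 2) * (Y z - YR z - Cconj r * (Y (r * z) - YR (r * z))))%C; [unfold X; ring|].
    rewrite h, h2; ring. }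
  exists X, c; split; [auto|split; [|split; [|auto]]].
  - intros z; unfold X, YR; rewrite Cmult_conj, Cplus_conj, !Cconj_conj.
    f_equal; [unfold Cconj, RtoC; simpl; f_equal; ring|ring].
  - replace (2 * m + 1)%nat with (S (2 * m)) in * by lia.
    assert (dX : forall v, diff_field X v) by (intros v; now apply (hfield_diff_field (2 * m))).
    assert (vXr : hfield (S (2 * m)) (fun z => Cconj r * X (r * z))%C).
    { apply hfield_scal; now apply (hfield_comp_rot _ r X). }
    assert (vt : hfield (S (2 * m)) (radial m c)).
    { replace (S (2 * m)) with (2 * m + 1)%nat by lia; apply hfield_radial. }
    (* This is the divergence of the homological equation. Those of [g] and of the radial term being
       invariant, so is the increment of [div X] along the rotation, and [telescoping] with [s = 1]
       applies. *)
    assert (dt : forall v,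
      divergence (radial m c) v = divergence g v + divergence X (r * v)%C - divergence X v).
    { intros v; rewrite <- (divergence_rot r X v) by auto.
      rewrite <- divergence_plus, <- divergence_minus; auto;
        try (eapply hfield_diff_field; eauto using hfield_plus).
      assert (e : forall w, radial m c w = (g w + Cconj r * X (r * w) - X w)%C) by auto.
      unfold divergence, d_dx, d_dy; f_equal; apply Derive_ext; intros; now rewrite e. }
    assert (dtr : forall v, divergence (radial m c) (r * v)%C = divergence (radial m c) v).
    { intros v; rewrite <- (divergence_rot r _ v); auto; [|eapply hfield_diff_field; eauto].
      unfold divergence, d_dx, d_dy; f_equal; apply Derive_ext; intros t; rewrite hrot;
        now rewrite Cmult_assoc, hr, Cmult_1_l. }
    intros v.
    assert (h := telescoping q r (RtoC 1) (fun z => RtoC (divergence X z))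
      (fun z => RtoC (divergence X z) - RtoC (divergence X (r * z)%C))%C).
    assert (h0 : (RtoC (divergence X v) - RtoC (divergence X (r * v)%C))%C = RtoC 0).
    { apply h; auto; try lia.
      - apply Cpow_1_l.
      - intros; ring.
      - intros z; rewrite Cmult_1_l, <- !RtoC_minus; f_equal.
        generalize (dt z), (dt (r * z)%C), (dtr z), (hdv z); lra. }
    rewrite <- RtoC_minus in h0; apply RtoC_inj in h0; lra.
Qed.

(** To leading order the change [z + Z] replaces the error [g] by [g + r^-1 Z(r z) - Z], which the
    homological equation makes radial; the other contributions have order k + 2 because [W] has
    order 3. *)
Lemma normal_form_step p q m (G W : C -> C) :
  let r := expi (res_angle p q) in
  (3 < q)%nat -> Nat.Odd q -> Nat.gcd p q = 1%nat -> (1 <= m)%nat -> (2 * m + 1 <= q)%nat ->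
  twist_term W -> smooth_near_O G -> intertwines G cneg cneg ->
  near_O (fun z => Cconj (G (Cconj (G z))) = z) ->
  near_O (fun v => Rabs (jac_det G v) = 1) ->
  bigO (2 * m + 1) (fun z => G z - r * (z + W z))%C ->
  exists phi psi c, locinv phi psi /\
    near_O (fun v => jac_det phi v = 1) /\ near_O (fun v => jac_det psi v = 1) /\
    intertwines phi Cconj Cconj /\ intertwines phi cneg cneg /\
    bigO (2 * m + 3) (fun z => phi (G (psi z)) - r * (z + (W z + radial m c z)))%C.
Proof.
  intros r hq ho hg hm hmq hW sG oG rG jG hO.
  assert (hr : (Cconj r * r)%C = RtoC 1) by apply expi_conj.
  destruct hW as (sW & oW & eW).
  set (k := (2 * m + 1)%nat) in *.
  set (f := fun z => (Cconj r * G z - z - W z)%C).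
  assert (hG : forall z, G z = (r * (z + W z + f z))%C).
  { intros z; unfold f; transitivity ((Cconj r * r) * G z)%C; [rewrite hr; ring|ring]. }
  assert (sf : smooth_near_O f).
  { apply smooth_minus; auto; apply smooth_minus; auto using smooth_scal, smooth_id. }
  assert (of : bigO k f).
  { apply (bigO_ext _ (fun z => Cconj r * (G z - r * (z + W z)))%C); [|now apply bigO_scal].
    near_end; intros z; unfold f.
    transitivity (Cconj r * G z - (Cconj r * r) * (z + W z))%C; [cring|rewrite hr; cring]. }
  destruct (leading_part k f sf of) as [g [vg hfg]].
  assert (en : forall z, cneg z = (- z)%C) by (now intros [x y]).
  (* Degree k + 1 is even and excluded by the central symmetry, so the error beyond [g] starts at
     order k + 2. *)
  assert (hfg2 : bigO (k + 2) (fun z => f z - g z)%C).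
  { replace (k + 2)%nat with (2 * (m + 1) + 1)%nat by (unfold k; lia).
    apply odd_gain.
    - apply smooth_minus; auto; now apply (hfield_smooth k).
    - red in oG |- *; near oG; near_end; intros z e.
      rewrite (hfield_cneg k g z vg); unfold k; rewrite Nat.add_1_r, pow_1_odd; unfold f; rewrite e.
      assert (hneg : (Cconj (RtoC (-1)) * RtoC (-1))%C = RtoC 1).
      { unfold Cconj, Cmult, RtoC; simpl; f_equal; ring. }
      assert (e2 : cneg z = (RtoC (-1) * z)%C)
        by (destruct z; unfold cneg, Cmult, RtoC; simpl; f_equal; ring).
      assert (eWn : W (cneg z) = (RtoC (-1) * W z)%C) by (rewrite e2; now apply eW).
      rewrite eWn, (en (G z)), (en (Cconj r * G z - z - W z - g z)%C), (en z).
      replace (RtoC (-1)) with (- (1))%C by (unfold Copp, RtoC; simpl; f_equal; ring); cring.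
    - now replace (2 * (m + 1))%nat with (S k) by (unfold k; lia). }
  assert (hk : (3 <= k)%nat) by (unfold k; lia).
  assert (htw : twist_term W) by (split; [|split]; auto).
  assert (hrev := reversible_leading r k W f g hr hk htw sf of vg hfg2).
  assert (hdv : forall v, divergence g (r * v)%C = divergence g v).
  { apply (area_leading r k W f g); auto.
    near jG; near (jac_det_ext G (fun z => r * (z + W z + f z))%C ltac:(near_end; auto) sG).
    near_end; intros v <-; auto. }
  destruct (normalizing_field p q m g hq ho hg hm hmq vg) as [X [c (vX & hXR & hXd & hX)]]; auto.
  { apply hrev; near rG; near_end; intros z e; cbv zeta beta; now rewrite <- !hG. }
  fold r in hX, hXd; fold k in vX.
  assert (ek : k = S (2 * m)) by (unfold k; lia).
  set (Hm := hamiltonian k X).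
  assert (vH : hpoly (k + 1) Hm) by now apply hpoly_hamiltonian.
  assert (hH : forall v, d_dy Hm v = fst (X v) - divergence X v * / (INR k + 1) * fst v /\
    d_dx Hm v = - (snd (X v) - divergence X v * / (INR k + 1) * snd v)).
  { intros v; unfold Hm; rewrite ek; apply hamiltonian_field; now rewrite <- ek. }
  destruct (generating_function_map k Hm) as [phi [psi (hl & j1 & j2 & i1 & i2 & hphi)]]; auto.
  { intros v; unfold Hm, hamiltonian; simpl fst; simpl snd.
    assert (e := hXR v); destruct v as [x y]; unfold Cconj at 2 in e; simpl fst in e; simpl snd in e.
    rewrite <- e; unfold Cconj; simpl; ring. }
  { intros v; replace (cneg v) with ((-1) * fst v, (-1) * snd v) by (unfold cneg; f_equal; ring).
    rewrite (hpoly_homog _ _ (-1) v vH); replace (k + 1)%nat with (2 * (m + 1))%nat by (unfold k; lia).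
    rewrite pow_1_even; ring. }
  exists phi, psi, c; split; [auto|split; [auto|split; [auto|split; [auto|split; [auto|]]]]].
  set (Z := fun z : C => (X z - RtoC (divergence X z * / (INR k + 1)) * z)%C).
  assert (hZ : forall z, (d_dy Hm z, - d_dx Hm z) = Z z).
  { intros z; destruct (hH z) as [-> ->]; unfold Z; apply injective_projections; simpl; ring. }
  assert (vX2 : hfield (S (2 * m)) X) by now rewrite <- ek.
  assert (vZ : hfield k Z).
  { apply hfield_minus; auto.
    apply (hfield_ext _ (fun z => z * RtoC (divergence X z * / (INR k + 1)))%C); [intros; ring|].
    rewrite ek; apply hfield_mul_id; split; simpl.
    - apply (hpoly_ext _ (fun z => / (INR (S (2 * m)) + 1) * divergence X z));
        [intros; apply Rmult_comm|].
      apply hpoly_const_scal, hpoly_divergence; exact vX2.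
    - apply (hpoly_ext _ (fun z => 0 * divergence X z)); [intros; ring|].
      apply hpoly_const_scal, hpoly_divergence; exact vX2. }
  (* [Z] is the field that [Hm] actually generates. As [div X] is invariant under [r], the term
     subtracted from [X] commutes with [r] and drops out of the homological equation. *)
  assert (hZe : forall z, (g z + Cconj r * Z (r * z) - Z z = radial m c z)%C).
  { intros z; rewrite <- hX; unfold Z; rewrite hXd.
    set (d := RtoC (divergence X z * / (INR k + 1))).
    transitivity (g z + Cconj r * X (r * z) - (Cconj r * r) * (d * z) - X z + d * z)%C;
      [ring|rewrite hr; ring]. }
  assert (hphi' : bigO (k + 2) (fun z => phi z - z - Z z)%C).
  { revert hphi; apply bigO_ext; near_end; intros z; now rewrite hZ. }
  clear hphi.
  assert (sZ : smooth_near_O Z) by now apply (hfield_smooth k).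
  assert (oZ := hfield_bigO _ _ vZ).
  assert (htr := twist_term_radial m c hm).
  assert (vt := hfield_radial m c); fold k in vt.
  assert (hw : forall n F, (1 <= n)%nat -> bigO n F -> bigO 1 F).
  { intros n F hn; now apply bigO_weaken. }
  assert (oGz : bigO 1 G).
  { apply (bigO_ext _ (fun z => r * (z + W z + f z))%C); [near_end; auto|].
    apply bigO_scal, bigO_plus; [apply bigO_plus; [apply bigO_id|now apply (hw 3%nat); [lia|]]|].
    apply (hw k); auto; lia. }
  destruct hl as (s1 & s2 & p1 & p2 & l1 & l2).
  assert (ophi := smooth_bigO1 phi s1 p1).
  assert (opsi := smooth_bigO1 psi s2 p2).
  assert (ophi2 : bigO k (fun z => phi z - z)%C).
  { apply (bigO_ext _ (fun z => (phi z - z - Z z) + Z z)%C); [near_end; intros; cring|].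
    apply bigO_plus; auto; apply (bigO_weaken k (k + 2)); auto; lia. }
  (* The conjugacy is tested before [psi] is applied, comparing [phi (G w)] with the normal form at
     [phi w]; [psi] then enters only by substitution and is never expanded. *)
  assert (main : bigO (k + 2) (fun w =>
    phi (G w) - r * (phi w + (W (phi w) + radial m c (phi w))))%C).
  { assert (h1 := bigO_comp _ _ _ oGz hphi').
    assert (h2 : bigO (k + 2) (fun w => Z (G w) - Z (r * w)%C)%C).
    { apply (bigO_weaken _ ((k - 1) + 3)); [lia|].
      apply (bigO_diff_comp Z (k - 1) 3 G (fun w => r * w)%C); auto using bigO_rot.
      - now replace (S (k - 1)) with k by lia.
      - apply (bigO_ext _ (fun z => r * (W z + f z))%C).
        + near_end; intros z; rewrite hG; cring.
        + apply bigO_scal, bigO_plus; auto; now apply (bigO_weaken 3 k). }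
    assert (h3 : bigO (k + 2) (fun w => W (phi w) - W w)%C).
    { apply (bigO_weaken _ (2 + k)); [lia|].
      apply (bigO_diff_comp W 2 k phi (fun w => w)); auto using bigO_id. }
    assert (h4 : bigO (k + 2) (fun w => radial m c (phi w) - radial m c w)%C).
    { apply (bigO_weaken _ (2 + k)); [lia|].
      apply (bigO_diff_comp (radial m c) 2 k phi (fun w => w)); auto using bigO_id; apply htr. }
    apply (bigO_ext _ (fun w => (phi (G w) - G w - Z (G w)) + (Z (G w) - Z (r * w))
      + r * (f w - g w) - r * (phi w - w - Z w) - r * (W (phi w) - W w)
      - r * (radial m c (phi w) - radial m c w))%C).
    - near_end; intros w.
      transitivity (phi (G w) - r * (phi w + (W (phi w) + radial m c (phi w)))
        + (r * (w + W w + f w) - G w)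
        + (r * radial m c w - r * g w + r * Z w - Z (r * w)))%C; [cring|].
      rewrite <- hG, <- (hZe w).
      transitivity (phi (G w) - r * (phi w + (W (phi w) + radial m c (phi w)))
        + ((Cconj r * r) * Z (r * w) - Z (r * w)))%C; [cring|].
      rewrite hr; cring.
    - apply bigO_minus; [apply bigO_minus; [apply bigO_minus; [apply bigO_plus;
        [apply bigO_plus|]|]|]|]; try apply bigO_scal; auto. }
  apply (bigO_comp _ _ _ opsi) in main.
  apply (bigO_ext _ (fun z => phi (G (psi z)) - r * (phi (psi z)
    + (W (phi (psi z)) + radial m c (phi (psi z)))))%C).
  - near l2; near_end; intros z e; now rewrite e.
  - now replace (2 * m + 3)%nat with (k + 2)%nat by (unfold k; lia).
Qed.

(** * The cubic Henon maps *)

(** Treats both signs at once; the computations hold for any real [s]. *)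
Definition cubic_henon (M2 s : R) (H : R * R -> R * R) : Prop :=
  forall v, H v = (snd v, - fst v + M2 * snd v + s * snd v ^ 3).

Lemma H3_cubic_henon M2 H :
  H = H3_plus 0 M2 \/ H = H3_minus 0 M2 -> exists s, cubic_henon M2 s H.
Proof.
  intros [->| ->]; [exists 1|exists (-1)]; intros v; unfold H3_plus, H3_minus; f_equal; ring.
Qed.

Lemma cubic_henon_dlim M2 s H v :
  cubic_henon M2 s H ->
  dlim (fun w => fst (H w)) v 0 1 /\
  dlim (fun w => snd (H w)) v (-1) (M2 + 3 * s * snd v ^ 2).
Proof.
  intros hH; split.
  - apply (dlim_ext snd); [|apply dlim_snd].
    apply locally_2d_forall; intros; now rewrite hH.
  - generalize (dlim_plus _ _ _ _ _ _ _ (dlim_plus _ _ _ _ _ _ _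
      (dlim_opp _ _ _ _ (dlim_fst v)) (dlim_scal M2 _ _ _ _ (dlim_snd v)))
      (dlim_scal s _ _ _ _ (dlim_pow _ _ _ _ 3 (dlim_snd v)))).
    intros h; apply (dlim_ext _ (fun w => snd (H w))) in h.
    + revert h; match goal with |- dlim _ _ ?a ?b -> dlim _ _ ?c ?d =>
        replace c with a by (simpl; ring); replace d with b by (simpl; ring) end; auto.
    + apply locally_2d_forall; intros; now rewrite hH.
Qed.

Lemma cubic_henon_smooth M2 s H : cubic_henon M2 s H -> smooth_near_O H.
Proof.
  intros hH.
  apply (smooth_ext (fun v => (snd v, - fst v + M2 * snd v + s * snd v ^ 3))).
  - near_end; intros; now rewrite hH.
  - apply smoothR_pair; [exact smoothR_snd|].
    apply smoothR_plus; [apply smoothR_plus|]; [apply smoothR_opp, smoothR_fst| |];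
      apply smoothR_mult; auto using smoothR_const, smoothR_snd, smoothR_pow.
Qed.

Lemma cubic_henon_jac M2 s H v : cubic_henon M2 s H -> jac_det H v = 1.
Proof.
  intros hH; destruct (cubic_henon_dlim M2 s H v hH) as [h1 h2].
  destruct (dlim_unique _ _ _ _ h1) as [a b], (dlim_unique _ _ _ _ h2) as [c d].
  unfold jac_det; rewrite a, b, c, d; ring.
Qed.

(** An eigenvector for [l] has the form [(a, l a)] with [a] nonzero, and the second row of the
    linear part then gives [M2 = l + l^-1]. *)
Lemma cubic_henon_trace M2 s H p q :
  cubic_henon M2 s H -> at_resonance p q H -> M2 = 2 * cos (res_angle p q).
Proof.
  intros hH [_ [[a [b [hab [h1 h2]]]] _]].
  destruct (cubic_henon_dlim M2 s H (0, 0) hH) as [k1 k2].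
  rewrite (proj1 (dlim_unique _ _ _ _ k1)), (proj2 (dlim_unique _ _ _ _ k1)) in h1.
  rewrite (proj1 (dlim_unique _ _ _ _ k2)), (proj2 (dlim_unique _ _ _ _ k2)) in h2.
  set (l := expi (res_angle p q)) in *.
  assert (hl : (Cconj l * l)%C = RtoC 1) by apply expi_conj.
  assert (hb : b = (l * a)%C) by (rewrite <- h1; ring).
  assert (ha : a <> RtoC 0).
  { intros e; apply hab; split; auto; rewrite hb, e; ring. }
  replace (M2 + 3 * s * snd (0, 0) ^ 2) with M2 in h2 by (simpl; ring).
  assert (h3 : RtoC M2 = (Cconj l + l)%C).
  { transitivity (Cconj l * (RtoC (-1) * a + RtoC M2 * b) / a + Cconj l
      + RtoC M2 * (1 - Cconj l * l))%C.
    - rewrite hb; replace (RtoC (-1)) with (- (1))%C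
        by (unfold Copp, RtoC; simpl; f_equal; ring); field; auto.
    - rewrite h2, hb, hl; transitivity ((Cconj l * l) * l + Cconj l)%C; [field; auto|].
      rewrite hl; ring. }
  apply (f_equal fst) in h3; unfold l, expi in h3; simpl in h3; lra.
Qed.

(** Equal to [i (e^(-i t) x - e^(i t) y)], a linear form multiplied by [e^(2 i t)] under the linear
    part of the map, so [t] is half the resonance angle. The complex factor is chosen so that
    exchanging [x] and [y] acts as conjugation. *)
Definition lin_coord (t : R) (v : R * R) : C :=
  (sin t * (fst v + snd v), cos t * (fst v - snd v)).

Definition lin_coord_inv (t : R) (z : C) : R * R :=
  (/ 2 * (/ sin t * fst z + / cos t * snd z), / 2 * (/ sin t * fst z - / cos t * snd z)).

Lemma smoothR_lin a b : smoothR (fun v => a * fst v + b * snd v).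
Proof. apply smoothR_plus; apply smoothR_mult; auto using smoothR_const, smoothR_fst, smoothR_snd. Qed.

Lemma dlim_lin a b v : dlim (fun v => a * fst v + b * snd v) v a b.
Proof.
  generalize (dlim_plus _ _ _ _ _ _ _ (dlim_scal a _ _ _ _ (dlim_fst v))
    (dlim_scal b _ _ _ _ (dlim_snd v))).
  rewrite !Rmult_1_r, !Rmult_0_r, Rplus_0_r, Rplus_0_l; auto.
Qed.

Lemma lin_coord_smooth t : smooth_near_O (lin_coord t).
Proof.
  apply smoothR_pair.
  - apply (smoothR_ext (fun v => sin t * fst v + sin t * snd v));
      auto using smoothR_lin.
    near_end; intros; ring.
  - apply (smoothR_ext (fun v => cos t * fst v + (- cos t) * snd v));
      auto using smoothR_lin.
    near_end; intros; ring.
Qed.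

Lemma lin_coord_inv_smooth t : smooth_near_O (lin_coord_inv t).
Proof.
  apply smoothR_pair.
  - apply (smoothR_ext (fun v => / 2 * / sin t * fst v + / 2 * / cos t * snd v));
      auto using smoothR_lin.
    near_end; intros; ring.
  - apply (smoothR_ext (fun v => / 2 * / sin t * fst v + (- (/ 2 * / cos t)) * snd v));
      auto using smoothR_lin.
    near_end; intros; ring.
Qed.

Lemma lin_coord_jac t v : jac_det (lin_coord t) v = - (2 * (sin t * cos t)).
Proof.
  assert (h1 := dlim_lin (sin t) (sin t) v).
  assert (h2 := dlim_lin (cos t) (- cos t) v).
  apply (dlim_ext _ (fun w => fst (lin_coord t w))) in h1;
    [|apply locally_2d_forall; intros; unfold lin_coord; simpl; ring].
  apply (dlim_ext _ (fun w => snd (lin_coord t w))) in h2;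
    [|apply locally_2d_forall; intros; unfold lin_coord; simpl; ring].
  unfold jac_det.
  rewrite (proj1 (dlim_unique _ _ _ _ h1)), (proj2 (dlim_unique _ _ _ _ h1)).
  rewrite (proj1 (dlim_unique _ _ _ _ h2)), (proj2 (dlim_unique _ _ _ _ h2)); ring.
Qed.

Lemma lin_coord_locinv t : sin t <> 0 -> cos t <> 0 -> locinv (lin_coord t) (lin_coord_inv t).
Proof.
  intros hs hc; split; [apply lin_coord_smooth|split; [apply lin_coord_inv_smooth|]].
  split; [unfold lin_coord; simpl; f_equal; ring|].
  split; [unfold lin_coord_inv; simpl; f_equal; ring|].
  split; near_end; intros [x y]; unfold lin_coord, lin_coord_inv; simpl; f_equal; field; auto.
Qed.

Lemma intertwines_all (F a b : R * R -> R * R) : (forall v, F (a v) = b (F v)) -> intertwines F a b.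
Proof. intros h; red; near_end; auto. Qed.

Lemma cubic_henon_lin_coord M2 s H t :
  cubic_henon M2 s H -> M2 = 2 * cos (2 * t) -> sin t <> 0 -> cos t <> 0 ->
  bigO 3 (fun z => lin_coord t (H (lin_coord_inv t z)) - expi (2 * t) * z)%C.
Proof.
  intros hH hM hs hc.
  assert (h : bigO 3 (fun v => lin_coord t (H v) - expi (2 * t) * lin_coord t v)%C).
  { apply (bigO_ext _ (fun v => (sin t * (s * snd v ^ 3), - (cos t * (s * snd v ^ 3))))).
    - near_end; intros [x y]; rewrite hH, hM; unfold lin_coord, expi.
      rewrite cos_2a, sin_2a; generalize (sin2_cos2 t); unfold Rsqr; intros e.
      apply injective_projections; simpl.
      + replace (sin t * (y + (- x + 2 * (cos t * cos t - sin t * sin t) * y + s * (y * (y * (y * 1))))))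
          with (sin t * ((sin t * sin t + cos t * cos t) * (y - x)
            + 2 * (cos t * cos t - sin t * sin t) * y + s * (y * (y * (y * 1)))))
          by (rewrite e; ring); ring.
      + replace (cos t * (y - (- x + 2 * (cos t * cos t - sin t * sin t) * y + s * (y * (y * (y * 1))))))
          with (cos t * ((sin t * sin t + cos t * cos t) * (y + x)
            - 2 * (cos t * cos t - sin t * sin t) * y - s * (y * (y * (y * 1)))))
          by (rewrite e; ring); ring.
    - assert (h3 : bigOR 3 (fun v => snd v ^ 3)) by exact (bigOR_pow 1 3 snd bigOR_snd).
      apply bigO_split; split; simpl fst; simpl snd; [|apply bigOR_opp]; auto using bigOR_scal. }
  destruct (lin_coord_locinv t hs hc) as (h1 & h2 & h3 & h4 & h5 & h6).
  assert (k := bigO_comp _ _ _ (smooth_bigO1 _ h2 h4) h); revert k.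
  apply bigO_ext; near h6; near_end; intros z e; now rewrite e.
Qed.

Definition twist_poly (a : nat -> C) (n : nat) (t : R) : C :=
  sum_n (fun i => Cmult (a i) (RtoC (t ^ i))) n.

Lemma twist_poly_S a n t :
  twist_poly a (S n) t = (twist_poly a n t + a (S n) * RtoC (t ^ S n))%C.
Proof. unfold twist_poly; now rewrite sum_Sn. Qed.

Lemma twist_term_poly a n :
  a 0%nat = RtoC 0 -> twist_term (fun z => twist_poly a n (Cmod z ^ 2) * z)%C.
Proof.
  intros h0.
  assert (ext : forall V W : C -> C, (forall z, V z = W z) -> twist_term V -> twist_term W).
  { intros V W e (h1 & h2 & h3); split; [|split].
    - apply (smooth_ext V); auto; near_end; auto.
    - apply (bigO_ext _ V); auto; near_end; auto.
    - intros u z hu; rewrite <- !e; auto. }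
  induction n as [|n IH].
  - apply (ext (radial 1 (RtoC 0))); [|apply twist_term_radial; lia].
    intros z; unfold twist_poly, radial; rewrite sum_O, h0; ring.
  - apply (ext (fun z => twist_poly a n (Cmod z ^ 2) * z + radial (S n) (a (S n)) z)%C).
    + intros z; rewrite twist_poly_S; unfold radial; ring.
    + apply twist_term_plus; auto; apply twist_term_radial; lia.
Qed.

Lemma twist_poly_ext a b n t :
  (forall i, (i <= n)%nat -> a i = b i) -> twist_poly a n t = twist_poly b n t.
Proof. intros h; apply sum_n_ext_loc; intros i hi; now rewrite h. Qed.

Lemma tends0_swap : tends0 swap.
Proof. exact (bigO1_tends0 swap bigO_swap). Qed.

(** Induction on the number of twist terms found. Area preservation and the symmetries of [phi]
    belong to the invariant; oddness and reversibility of the conjugated map are recovered from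
    those of [H]. *)
Lemma normal_form_coordinates M2 s H p q m :
  cubic_henon M2 s H -> at_resonance p q H ->
  (3 < q)%nat -> Nat.Odd q -> Nat.gcd p q = 1%nat -> (2 * m + 1 <= q)%nat ->
  exists phi psi a, locinv phi psi /\
    intertwines phi swap Cconj /\ intertwines phi cneg cneg /\
    near_O (fun v => Rabs (jac_det (fun z => phi (H (psi z))) v) = 1) /\ a 0%nat = RtoC 0 /\
    bigO (2 * m + 3) (fun z => phi (H (psi z))
      - expi (res_angle p q) * (z + twist_poly a m (Cmod z ^ 2)%R * z))%C.
Proof.
  intros hH hres hq ho hg.
  assert (H0 : H (0, 0) = (0, 0)) by (rewrite hH; simpl; f_equal; ring).
  assert (sH := cubic_henon_smooth _ _ _ hH).
  assert (tH := smooth_tends0 H sH H0).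
  induction m as [|m IH]; intros hmq.
  - set (th := res_angle p q).
    (* [sin th = 0] would give [r^2 = 1], so [q] would divide 2. The double angle formula then keeps
       [sin t] and [cos t] away from 0. *)
    assert (hsin : sin th <> 0).
    { intros e; assert (h : Cpow (expi th) 2 = RtoC 1).
      { unfold expi; generalize (sin2_cos2 th); rewrite e; unfold Rsqr; intros h.
        apply injective_projections; simpl; lra. }
      apply expi_res_pow_1 in h; [|lia|auto].
      apply Nat.divide_pos_le in h; lia. }
    set (t := th / 2); replace th with (2 * t) in hsin by (unfold t; field).
    rewrite sin_2a in hsin.
    assert (hs : sin t <> 0) by (intros e; apply hsin; rewrite e; ring).
    assert (hc : cos t <> 0) by (intros e; apply hsin; rewrite e; ring).
    assert (hl := lin_coord_locinv t hs hc).
    exists (lin_coord t), (lin_coord_inv t), (fun _ => RtoC 0); split; [auto|].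
    split; [|split; [|split; [|split; [auto|]]]].
    + apply intertwines_all; intros [x y]; unfold lin_coord, swap, Cconj; simpl; f_equal; ring.
    + apply intertwines_all; intros [x y]; unfold lin_coord, cneg; simpl; f_equal; ring.
    + destruct hl as (h1 & h2 & h3 & h4 & h5 & h6).
      near (jac_det_comp (fun v => lin_coord t (H v)) _
        (smooth_comp _ _ h1 sH H0) h2 h4).
      near (near_comp _ _ (smooth_tends0 _ h2 h4) (jac_det_comp _ _ h1 sH H0)).
      near (jac_det_comp _ _ h1 h2 h4).
      near (jac_det_ext _ _ h6 (smooth_comp _ _ h1 h2 h4)).
      near_end; intros v; rewrite jac_det_id; intros e1 e2 e3 e4.
      rewrite e4, e3, (cubic_henon_jac _ _ _ _ hH), !lin_coord_jac, Rmult_1_r.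
      rewrite e1, lin_coord_jac in e2; rewrite <- e2; apply Rabs_R1.
    + assert (hM := cubic_henon_trace _ _ _ _ _ hH hres).
      fold th in hM |- *; replace th with (2 * t) in hM |- * by (unfold t; field).
      generalize (cubic_henon_lin_coord _ _ _ t hH hM hs hc).
      apply bigO_ext; near_end; intros z; unfold twist_poly; rewrite sum_O; cring.
  - destruct IH as [phi [psi [a (hl & is & ic & hj & ha & hO)]]]; [lia|].
    destruct (hl) as (s1 & s2 & p1 & p2 & l1 & l2).
    set (G := fun z => phi (H (psi z))) in *.
    set (r := expi (res_angle p q)) in *.
    assert (tphi := smooth_tends0 _ s1 p1); assert (tpsi := smooth_tends0 _ s2 p2).
    assert (sG : smooth_near_O G).
    { apply (smooth_comp phi (fun z => H (psi z))); auto; [|now rewrite p2].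
      now apply smooth_comp. }
    assert (ipc := intertwines_inv _ _ _ _ hl tends0_cneg ic).
    assert (iH : intertwines H cneg cneg).
    { apply intertwines_all; intros v; rewrite !hH; unfold cneg; simpl; f_equal; ring. }
    assert (iG : intertwines G cneg cneg).
    { apply (intertwines_comp (fun z => H (psi z)) phi _ cneg); auto.
      - now apply tends0_comp.
      - now apply (intertwines_comp psi H _ cneg). }
    (* This is the reversibility identity [swap (H (swap (H v))) = v], transported by [phi]. *)
    assert (rG : near_O (fun z => Cconj (G (Cconj (G z))) = z)).
    { assert (t1 : tends0 (fun z => H (psi z))) by now apply tends0_comp.
      assert (t2 : tends0 (fun z => swap (H (psi z))))
        by (apply (tends0_comp swap); auto using tends0_swap).
      assert (t3 : tends0 (fun z => H (swap (H (psi z))))) by now apply (tends0_comp H).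
      red in is; near (near_comp _ _ t1 is); near (near_comp _ _ t2 l1); near (near_comp _ _ t3 is).
      near l2; near_end; intros z e1 e2 e3 e4; unfold G.
      rewrite <- e4, e3, <- e2.
      replace (swap (H (swap (H (psi z))))) with (psi z); [exact e1|].
      generalize (psi z); intros [x y]; rewrite !hH; unfold swap; simpl; f_equal; ring. }
    destruct (normal_form_step p q (S m) G (fun z => twist_poly a m (Cmod z ^ 2) * z)%C)
      as [phi' [psi' [c (hl' & j1 & j2 & i1 & i2 & hO')]]]; auto; try lia.
    { now apply twist_term_poly. }
    { now replace (2 * S m + 1)%nat with (2 * m + 3)%nat by lia. }
    fold r in hO'.
    (* The new coefficient is placed at index m + 1; index 0 keeps the value 0, which encodes
       [Om(0) = 0]. *)
    set (a' := fun i => if Nat.eq_dec i (S m) then c else a i).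
    exists (fun v => phi' (phi v)), (fun z => psi (psi' z)), a'.
    split; [now apply locinv_comp|].
    split; [now apply (intertwines_comp phi phi' _ Cconj)|].
    split; [now apply (intertwines_comp phi phi' _ cneg)|].
    split; [|split; [exact ha|]].
    + destruct hl' as (s1' & s2' & p1' & p2' & _ & _).
      assert (G0 : G (0, 0) = (0, 0)) by (unfold G; now rewrite p2, H0, p1).
      assert (tpsi' := smooth_tends0 _ s2' p2').
      assert (tG := smooth_tends0 _ sG G0).
      near (near_comp _ _ tpsi' hj); near j2.
      near (near_comp _ _ (tends0_comp _ _ tG tpsi') j1).
      near (near_comp _ _ tpsi' (jac_det_comp phi' G s1' sG G0)).
      near (jac_det_comp (fun v => phi' (G v)) psi' (smooth_comp _ _ s1' sG G0) s2' p2').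
      near_end; intros v e1 e2 e3 e4 e5.
      change (Rabs (jac_det (fun z => phi' (G (psi' z))) v) = 1).
      rewrite e1, e2, e3, e4, Rmult_1_l, Rmult_1_r; exact e5.
    + revert hO'.
      apply bigO_ext; near_end; intros z.
      rewrite twist_poly_S, (twist_poly_ext a' a).
      * unfold a'; destruct (Nat.eq_dec (S m) (S m)) as [_|h]; [|now elim h].
        unfold G, radial; cring.
      * intros i hi; unfold a'; destruct (Nat.eq_dec i (S m)); [lia|auto].
Qed.

(** With [q = 2 o + 1], the last admissible step [m = o] leaves an error O(|z|^(2o+3)), which is
    O(|z|^(q+2)), and only twist terms. *)
Lemma cubic_henon_triple_degenerate M2 s H p q :
  cubic_henon M2 s H -> at_resonance p q H ->
  (3 < q)%nat -> Nat.Odd q -> Nat.gcd p q = 1%nat -> at_least_triple_degenerate p q H.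
Proof.
  intros hH hres hq ho hg; destruct (ho) as [o eo].
  destruct (normal_form_coordinates M2 s H p q o hH hres hq ho hg)
    as [phi [psi [a (hl & is & ic & hj & ha & K & hK & hO)]]]; [lia|].
  destruct hl as (s1 & s2 & p1 & p2 & l1 & l2).
  exists phi, psi, (twist_poly a o); split; [|split; [|split]].
  - split; [exact p1|repeat split; auto].
  - now exists o, a.
  - unfold twist_poly; clear - ha; induction o as [|o IH].
    + rewrite sum_O, ha; ring.
    + rewrite sum_Sn, IH; simpl; rewrite Rmult_0_l.
      match goal with |- plus ?x ?y = _ => change (plus x y) with (Cplus x y) end; ring.
  - exists K; near hO; near_end; intros z; rewrite eo.
    replace (2 * o + 1 + 2)%nat with (2 * o + 3)%nat by lia; intros h.
    replace (normal_form_poly p (2 * o + 1) (twist_poly a o) 0 0 0 z) with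
      (expi (res_angle p (2 * o + 1)) * (z + twist_poly a o (Cmod z ^ 2) * z))%C; [exact h|].
    unfold normal_form_poly; cring.
Qed.

(** Adding the error at [z] and [-z] removes the odd map and the odd terms [z + Om(|z|^2) z],
    whatever [Om] is. The lower degree q - 1 isolates A; B and C share the degree q + 1 and are told
    apart by evaluation at two points of the unit circle. *)
Lemma resonant_coefficients_vanish M2 s H p q phi psi Om cA cB cC :
  cubic_henon M2 s H -> (3 < q)%nat -> Nat.Odd q ->
  has_normal_form p q H phi psi Om cA cB cC ->
  cA = RtoC 0 /\ cB = RtoC 0 /\ cC = RtoC 0.
Proof.
  intros hH hq ho ((p1 & s1 & s2 & l1 & l2 & _ & _ & ic) & _ & _ & K & hO).
  assert (H0 : H (0, 0) = (0, 0)) by (rewrite hH; simpl; f_equal; ring).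
  assert (tH := smooth_tends0 H (cubic_henon_smooth _ _ _ hH) H0).
  assert (p2 : psi (0, 0) = (0, 0)).
  { assert (e := near_at0 _ l1); cbv beta in e; now rewrite p1 in e. }
  assert (hl : locinv phi psi) by (repeat split; auto).
  assert (tpsi := smooth_tends0 _ s2 p2).
  assert (ic' : intertwines phi cneg cneg) by exact ic.
  assert (ipc := intertwines_inv _ _ _ _ hl tends0_cneg ic').
  set (G := fun z => phi (H (psi z))) in *.
  assert (iH : intertwines H cneg cneg).
  { apply intertwines_all; intros v; rewrite !hH; unfold cneg; simpl; f_equal; ring. }
  assert (iG : intertwines G cneg cneg).
  { apply (intertwines_comp (fun z => H (psi z)) phi _ cneg); auto.
    - now apply tends0_comp.
    - now apply (intertwines_comp psi H _ cneg). }
  set (r := expi (res_angle p q)).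
  assert (hr : (Cconj r * r)%C = RtoC 1) by apply expi_conj.
  set (D := fun z : C => (G z - normal_form_poly p q Om cA cB cC z)%C).
  assert (oD : bigO (q + 2) D).
  { exists (Rabs K); split; [apply Rabs_pos|]; near hO; near_end; intros z h.
    eapply Rle_trans; [exact h|]; apply Rmult_le_compat_r; [apply pow_le, Cmod_ge_0|apply Rle_abs]. }
  destruct ho as [o eo].
  set (PA := fun z : C => (cA * Cpow z 0 * Cpow (Cconj z) (q - 1))%C).
  set (PB := fun z : C => (cB * Cpow z (q + 1) * Cpow (Cconj z) 0)%C).
  set (PC := fun z : C => (cC * Cpow z 1 * Cpow (Cconj z) q)%C).
  assert (vA : hfield (q - 1) PA) by (apply zpoly_hfield, zpoly_mono; lia).
  assert (vB : hfield (q + 1) PB) by (apply zpoly_hfield, zpoly_mono; lia).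
  assert (vC : hfield (q + 1) PC) by (apply zpoly_hfield, zpoly_mono; lia).
  assert (en : forall z, cneg z = (- z)%C) by (now intros [x y]).
  assert (even : forall n P z, hfield n P -> Nat.Even n -> P (- z)%C = P z).
  { intros n P z vP [k hk]; rewrite <- en, (hfield_cneg n P z vP), hk, pow_1_even; ring. }
  assert (hN : forall z, normal_form_poly p q Om cA cB cC z =
    (r * (z + Om (Cmod z ^ 2)%R * z + PA z + PB z + PC z))%C).
  { intros z; unfold normal_form_poly, PA, PB, PC; fold r; simpl; ring. }
  assert (oE : bigO (q + 2) (fun z => PA z + PB z + PC z)%C).
  { apply (bigO_ext _ (fun z => RtoC (- / 2) * (Cconj r * (D z + D (cneg z))))%C).
    - red in iG; near iG; near_end; intros z e; unfold D; rewrite e, !hN, (en z), (en (G z)).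
      rewrite Cmod_opp, (even _ PA z vA), (even _ PB z vB), (even _ PC z vC)
        by first [exists o; lia|exists (S o); lia].
      transitivity (RtoC (- / 2) * ((Cconj r * r) * - (1 + 1) * (PA z + PB z + PC z)))%C; [cring|].
      rewrite hr; replace (RtoC (- / 2)) with (- / (1 + 1))%C; [|].
      + field; intros h; apply (f_equal fst) in h; simpl in h; lra.
      + rewrite RtoC_opp, RtoC_inv, <- RtoC_plus; auto; lra.
    - apply bigO_scal, bigO_scal, bigO_plus; auto; exact (bigO_comp _ _ _ bigO_cneg oD). }
  assert (oBC : bigO (q + 1) (fun z => PB z + PC z)%C) by (apply bigO_plus; now apply hfield_bigO).
  assert (zA : forall z, PA z = RtoC 0).
  { apply (hfield_zero (q - 1)); auto.
    apply (bigO_ext _ (fun z => (PA z + PB z + PC z) - (PB z + PC z))%C);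
      [near_end; intros; cring|].
    apply bigO_minus; [apply (bigO_weaken _ (q + 2))|apply (bigO_weaken _ (q + 1))]; auto; lia. }
  assert (zBC : forall z, (PB z + PC z)%C = RtoC 0).
  { apply (hfield_zero (q + 1) (fun z => PB z + PC z)%C); [now apply hfield_plus|].
    apply (bigO_ext _ (fun z => PA z + PB z + PC z)%C).
    - near_end; intros z; rewrite zA; cring.
    - now replace (S (q + 1)) with (q + 2)%nat by lia. }
  assert (c1 : Cconj (RtoC 1) = RtoC 1) by (unfold Cconj, RtoC; simpl; f_equal; ring).
  assert (e1 := zBC (RtoC 1)); unfold PB, PC in e1; rewrite c1, !Cpow_1_l in e1.
  assert (eA := zA (RtoC 1)); unfold PA in eA; rewrite c1, !Cpow_1_l in eA.
  (* As [w^(2q) = -1], multiplying [PB w + PC w = 0] by [w^q conj(w)] gives [-cB + cC = 0], while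
     the point 1 gave [cB + cC = 0]. *)
  set (w := expi (PI / (2 * INR q))).
  assert (hw : (Cconj w * w)%C = RtoC 1) by apply expi_conj.
  assert (hwq : Cpow w (q + q) = (- (1))%C).
  { unfold w; rewrite expi_pow, plus_INR.
    replace ((INR q + INR q) * (PI / (2 * INR q))) with PI by (field; apply not_0_INR; lia).
    unfold expi; rewrite cos_PI, sin_PI; unfold Copp, RtoC; simpl; f_equal; ring. }
  assert (e2 : (- cB + cC)%C = RtoC 0).
  { transitivity (Cpow w q * Cconj w * (PB w + PC w))%C; [|rewrite zBC; ring].
    unfold PB, PC.
    transitivity (cB * Cpow w (q + q) * (Cconj w * w)
      + cC * (Cconj w * w) * Cpow (Cconj w * w) q)%C.
    - rewrite hwq, hw, Cpow_1_l; ring.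
    - rewrite Cpow_mult_l, !Cpow_add_r; simpl; ring. }
  assert (h2 : (1 + 1)%C <> RtoC 0).
  { intros h; apply (f_equal fst) in h; simpl in h; lra. }
  assert (hC : cC = RtoC 0).
  { transitivity (((cB * 1 * 1 + cC * 1 * 1) + (- cB + cC)) / (1 + 1))%C; [field; auto|].
    rewrite e2; simpl in e1; rewrite e1; field; auto. }
  split; [rewrite <- eA; ring|split; auto].
  transitivity (- ((- cB + cC) - cC))%C; [ring|rewrite e2, hC; ring].
Qed.

(** Degeneracy by itself asks for one coordinate with zero coefficients; the second conjunct makes
    the vanishing independent of the normalizing coordinate and of [Om]. *)
Theorem lemma3 (M2 : R) (H : R * R -> R * R) (p q : nat)
  (hH : H = H3_plus 0 M2 \/ H = H3_minus 0 M2)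
  (hp : (0 < p)%nat) (hq : (3 < q)%nat) (hodd : Nat.Odd q)
  (hpq : Nat.gcd p q = 1%nat)
  (hres : at_resonance p q H) :
  at_least_triple_degenerate p q H /\
  (forall (phi : R * R -> C) (psi : C -> R * R) (Om : R -> C) (cA cB cC : C),
     has_normal_form p q H phi psi Om cA cB cC ->
     cA = 0%C /\ cB = 0%C /\ cC = 0%C).
Proof.
  destruct (H3_cubic_henon M2 H hH) as [s hs]; split.
  - now apply (cubic_henon_triple_degenerate M2 s).
  - intros phi psi Om cA cB cC; now apply (resonant_coefficients_vanish M2 s).
Qed.
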